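(* Assume that $X_1$ is of Pareto-type with index $\alpha\in(0,1)$ and that the counting process $\{N(t);\,t\geq 0\}$ $\mathcal{D}$-averages in time to the random variable $\Lambda$. Then $$T_{N(t)}\stackrel{\mathcal{D}}{\longrightarrow}\frac{U_\alpha}{V_\alpha^2}\quad\text{as } t\rightarrow\infty,$$ where the random vector $(U_\alpha,V_\alpha)^\prime$ has the Laplace transform $$\mathbb{E}\left\{e^{-rU_\alpha-sV_\alpha}\right\}=\mathbb{E}\left\{e^{-\delta_\alpha(r,s)\,\Lambda}\right\},\quad r>0,\ s\geq 0,$$ with $$\delta_\alpha(r,s):=2\,e^{\frac{s^2}{4r}}\int_0^\infty e^{-\left(u+\frac{s}{2\sqrt r}\right)^2}\left(u+\frac{s}{2\sqrt r}\right)\left(\frac{u}{\sqrt r}\right)^{-\alpha}du .$$ In particular, $U_\alpha$ has the Laplace transform $\mathbb{E}\{e^{-rU_\alpha}\}=\mathbb{E}\{e^{-r^{\alpha/2}\Gamma(1-\alpha/2)\,\Lambda}\}$ for $r\geq 0$, and $V_\alpha$ has the Laplace transform $\mathbb{E}\{e^{-sV_\alpha}\}=\mathbb{E}\{e^{-s^{\alpha}\Gamma(1-\alpha)\,\Lambda}\}$ for $s\geq 0$.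
   Context: $\{X_1,X_2,\ldots\}$ is a sequence of i.i.d. positive random variables with distribution function $F$, and $\{N(t);\,t\geq 0\}$ is a counting process (nonnegative integer-valued, nondecreasing in $t$) independent of the $X_i$'s. For fixed $t\ge 0$, $$T_{N(t)}:=\frac{X_1^2+\cdots+X_{N(t)}^2}{(X_1+\cdots+X_{N(t)})^2}$$ if $N(t)\geq 1$, and $T_{N(t)}:=0$ otherwise. $X_1$ (or $F$) is of Pareto-type with index $\alpha>0$ if $1-F(x)\sim x^{-\alpha}\ell(x)$ as $x\to\infty$ for a slowly varying function $\ell$. The counting process $\mathcal{D}$-averages in time to the random variable $\Lambda$ if $N(t)/t\stackrel{\mathcal{D}}{\longrightarrow}\Lambda$ as $t\to\infty$, where $\mathbb{P}[\Lambda>0]=1$. $\stackrel{\mathcal{D}}{\longrightarrow}$ denotes convergence in distribution and $\Gamma$ is the gamma function. *)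

(* Defs.v *)
From HB Require Import structures.
From mathcomp Require Import all_boot all_order all_algebra finmap.
From mathcomp Require Import all_classical all_reals all_analysis.
From mathcomp Require Import measurable_realfun.

Set Implicit Arguments.
Unset Strict Implicit.
Unset Printing Implicit Defensive.

Import Order.TTheory GRing.Theory Num.Theory.
Import numFieldNormedType.Exports.

Local Open Scope classical_set_scope.
Local Open Scope ring_scope.

Section regular_variation.
Context {R : realType}.

(* l is only required to be positive and measurable on a neighbourhood of +oo;
   its values elsewhere are irrelevant. *)
Definition slowly_varying (l : R -> R) : Prop :=
  (exists x0 : R, measurable_fun `[x0, +oo[ l /\
                  forall x, x0 <= x -> 0 < l x) /\
  (forall c : R, 0 < c -> l (c * x) / l x @[x --> +oo] --> (1 : R)).

(* The asymptotic equivalence is stated as a ratio tending to 1: its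
   denominator is eventually positive. *)
Definition pareto_type (alpha : R) (F : R -> R) : Prop :=
  0 < alpha /\
  exists2 l : R -> R, slowly_varying l &
    (1 - F x) / (x `^ (- alpha) * l x) @[x --> +oo] --> (1 : R).

End regular_variation.

Section probability.
Context {R : realType} {d : measure_display} {T : measurableType d}.
Variable P : probability T R.

Definition distr_fun (X : {RV P >-> R}) (x : R) : R := fine (cdf X x).

Definition mutually_independent (X : nat -> {RV P >-> R}) : Prop :=
  forall (J : {fset nat}) (B : nat -> set R),
    (forall j, measurable (B j)) ->
    P (\bigcap_(j in [set` J]) X j @^-1` B j) =
    (\prod_(j <- J) P (X j @^-1` B j))%E.

Definition iid (X : nat -> {RV P >-> R}) : Prop :=
  mutually_independent X /\
  forall i (B : set R), measurable B ->
    distribution P (X i) B = distribution P (X 0%N) B.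

Definition family_sigma_algebra (I : Type) d' (T' : measurableType d')
    (D : set I) (X : I -> T -> T') : set (set T) :=
  <<s \bigcup_(i in D) g_sigma_algebra_preimage (X i) >>.

Definition independent_sigma_algebras (G H : set (set T)) : Prop :=
  forall A B, G A -> H B -> P (A `&` B) = (P A * P B)%E.

(* The process lives on the times t >= 0; N t is irrelevant for t < 0. *)
Definition counting_process (N : R -> {RV P >-> nat}) : Prop :=
  forall (s t : R) w, 0 <= s -> s <= t -> (N s w <= N t w)%N.

Definition sample_dispersion (X : nat -> {RV P >-> R}) (N : {RV P >-> nat})
    (w : T) : R :=
  if (1 <= N w)%N then
    (\sum_(i < N w) X i w ^+ 2) / (\sum_(i < N w) X i w) ^+ 2
  else 0.

Definition time_average (N : R -> {RV P >-> nat}) (t : R) (w : T) : R :=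
  (N t w)%:R / t.

(* 0 where V vanishes, since 0^-1 = 0. *)
Definition quotient_sqr (U V : {RV P >-> R}) (w : T) : R := U w / V w ^+ 2.

Lemma measurable_div_sqr (f g : T -> R) :
  measurable_fun setT f -> measurable_fun setT g ->
  measurable_fun setT (fun w => f w / g w ^+ 2).
Proof.
move=> mf mg.
have -> : (fun w => f w / g w ^+ 2) = f \* (fun w => (g w ^+ 2) `^ (-1)).
  by apply/funext => w /=; rewrite powR_inv1// sqr_ge0.
apply: measurable_funM => //.
apply: (measurableT_comp (measurable_powR (-1)) (measurable_funX 2 mg)).
Qed.

Lemma measurable_sample_dispersion X N :
  measurable_fun setT (sample_dispersion X N).
Proof.
pose f (n : nat) (w : T) : R := if (1 <= n)%N then
    (\sum_(i < n) X i w ^+ 2) / (\sum_(i < n) X i w) ^+ 2 else 0.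
have mf n : measurable_fun setT (f n).
  rewrite /f; case: (1 <= n)%N; last exact: measurable_cst.
  apply: measurable_div_sqr.
    apply: (@measurable_sum _ _ _ _ _ _ (fun i w => X (val i) w ^+ 2)) => i.
    exact/measurable_funX/measurable_funPT.
  by apply: (@measurable_sum _ _ _ _ _ _ (fun i w => X (val i) w)).
move=> _ Y mY.
have -> : setT `&` sample_dispersion X N @^-1` Y =
    \bigcup_n (N @^-1` [set n] `&` f n @^-1` Y).
  apply/seteqP; split => [w [_ Yw]|w [n _ [/= <-]]]; last by [].
  by exists (N w).
apply: bigcup_measurable => n _; apply: measurableI.
  by rewrite -[X in measurable X]setTI; exact: measurable_funPT.
by rewrite -[X in measurable X]setTI; exact: mf.
Qed.

Lemma measurable_time_average N t : measurable_fun setT (time_average N t).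
Proof.
apply: (measurableT_comp (f := fun n : nat => n%:R / t : R)) => //.
Qed.

HB.instance Definition _ X N := isMeasurableFun.Build _ _ _ _
  (sample_dispersion X N) (measurable_sample_dispersion X N).

HB.instance Definition _ N t := isMeasurableFun.Build _ _ _ _
  (time_average N t) (measurable_time_average N t).

HB.instance Definition _ U V := isMeasurableFun.Build _ _ _ _
  (quotient_sqr U V)
  (measurable_div_sqr (measurable_funPT U) (measurable_funPT V)).

End probability.

Definition cvg_in_distribution {R : realType}
    {d : measure_display} {T : measurableType d} (P : probability T R)
    {d' : measure_display} {T' : measurableType d'} (Q : probability T' R)
    (Y : R -> {RV P >-> R}) (Z : {RV Q >-> R}) : Prop :=
  forall x : R, {for x, continuous (cdf Z)} ->
    cdf (Y t) x @[t --> +oo] --> cdf Z x.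

Arguments cvg_in_distribution {R d T} P {d' T'} Q Y Z.

Definition D_averages_in_time {R : realType}
    {d : measure_display} {T : measurableType d} (P : probability T R)
    {d' : measure_display} {T' : measurableType d'} (Q : probability T' R)
    (N : R -> {RV P >-> nat}) (Lambda : {RV Q >-> R}) : Prop :=
  Q [set w | 0 < Lambda w] = 1%E /\
  cvg_in_distribution P Q (fun t => time_average N t) Lambda.

Section special_functions.
Context {R : realType}.

Definition Gamma (a : R) : R :=
  \int[lebesgue_measure]_(x in `]0, +oo[) (x `^ (a - 1) * expR (- x)).

Definition delta (alpha r s : R) : R :=
  let c := s / (2 * Num.sqrt r) in
  2 * expR (s ^+ 2 / (4 * r)) *
  \int[lebesgue_measure]_(u in `]0, +oo[)
    (expR (- (u + c) ^+ 2) * (u + c) * (u / Num.sqrt r) `^ (- alpha)).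

(* Lambda and (U, V) may live on different probability spaces: only their laws
   are related. *)
Definition has_joint_laplace (alpha : R)
    {d : measure_display} {T : measurableType d} (Q : probability T R)
    (Lambda : {RV Q >-> R})
    {d' : measure_display} {T' : measurableType d'} (P : probability T' R)
    (U V : {RV P >-> R}) : Prop :=
  forall r s : R, 0 < r -> 0 <= s ->
    ('E_P[fun w => expR (- r * U w - s * V w)] =
     'E_Q[fun w => expR (- delta alpha r s * Lambda w)])%E.

End special_functions.

(* Main.v *)
(* Given N(t), the pair (b^2 sum X_i^2, b sum X_i) has Laplace transform phi^N(t), with
   phi = E exp(- r b^2 X_1^2 - s b X_1). Writing 1 - phi as an integral of the tail of X_1
   and choosing b = 1 / a(t) with tail about 1 / t at a(t), regular variation and Potter's
   bound give t (1 - phi) --> delta(r, s), so the transform tends to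
   E exp(- delta(r, s) Lambda). Bernstein polynomials in exp(- U), exp(- V) turn this into
   convergence of the probability of U <= c V^2, that is T <= c by scale invariance.

   The limiting pair is LePage's series: the sums of Gamma_i^(- 2 / alpha) and of
   Gamma_i^(- 1 / alpha) over the arrival times Gamma_i of a unit Poisson process (built
   from the binary digits of a uniform variable), scaled by Lambda^(2 / alpha) and
   Lambda^(1 / alpha). Their transform comes from a martingale comparing partial sums to
   void probabilities of a thinned Poisson process. *)
Require Import Defs.
From mathcomp Require Import all_boot all_order all_algebra finmap.
From mathcomp Require Import all_classical all_reals all_analysis.
From mathcomp Require Import measurable_realfun.
From mathcomp Require Import ring lra.
Set Implicit Arguments.
Unset Strict Implicit.
Unset Printing Implicit Defensive.
Import Order.TTheory GRing.Theory Num.Theory.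
Import numFieldNormedType.Exports.
Local Open Scope classical_set_scope.
Local Open Scope ring_scope.

(** For a nonnegative Y, 1 - E exp(- r Y^2 - s Y) is the integral over y > 0 of (2 r y + s) exp(- r
    y^2 - s y) P(Y > y). With the tail y^(- alpha) this integral is the limit exponent; with the
    tail of X_1 it is 1 - phi; with r = 0 and the tail of N(t) / t it turns convergence of
    distribution functions into convergence of transforms. Each of these limits is then dominated
    convergence under one integral.

    The map (u, v) -> u / v^2 is singular at v = 0, and U, V are known only through a transform at r
    > 0. Nonnegativity of U and V, positivity of V and the transform at r = 0 are therefore deduced
    from that transform. A continuity point c of the limit law then puts no mass on the curve u = c
    v^2, where the indicator of u <= c v^2 jumps.

    For existence, 1 - exp(- r j^2 - s j) is read as the probability of marking a Poisson point with
    jump j. The transform of the jump sums becomes the probability that no point is marked, and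
    conditioning on the first n points gives the martingale. *)

(** * Measures determined by half-lines *)

Section uniqueness_on_rays.
Context {R : realType}.

(** Half-lines are stable under intersection, generate the Borel sets, and those with integer end
    cover the line with finite mass, so the uniqueness theorem for measures applies. *)
Lemma eq_measure_rays (m1 m2 : {measure set (measurableTypeR R) -> \bar R}) :
  (forall a, m1 `]-oo, a]%classic = m2 `]-oo, a]%classic) ->
  (forall a, m1 `]-oo, a]%classic < +oo)%E ->
  forall A, measurable A -> m1 A = m2 A.
Proof.
move=> m12 m1oo.
pose G := [set A : set (measurableTypeR R) | exists x : R, A = `]-oo, x]%classic].
apply: (measure_unique G (fun n => `]-oo, n%:R]%classic)).
- apply: (etrans (RGenOInfty.measurableE R)).
  apply/seteqP; split => A.
  + apply: smallest_sub; first exact: smallest_sigma_algebra.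
    move=> _ [x ->]; rewrite -setCitvl.
    rewrite -setTD; apply: sigma_algebraCD.
    by apply: sub_sigma_algebra; exists x.
  + apply: smallest_sub; first exact: smallest_sigma_algebra.
    move=> _ [x ->]; rewrite -setCitvr.
    rewrite -setTD; apply: sigma_algebraCD.
    by apply: sub_sigma_algebra; exists x.
- move=> _ _ [x ->] [y ->]; exists (Num.min x y).
  apply/seteqP; split => z /=; rewrite !in_itv/= le_min.
    by move=> [-> ->].
  by move=> /andP.
- by move=> i; exists i%:R.
- apply/seteqP; split => // x _.
  exists (Num.truncn x).+1 => //=; rewrite in_itv/=; apply/ltW.
  by rewrite truncnS_gt.
- by move=> _ [x ->].
- by [].
Qed.

(** The event [D] and the factor [c] let one statement serve both to identify a law ([D] everything,
    [c = 1]) and to prove independence from [D] ([c] its probability). *)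
Lemma probability_preimage_rays d (T : measurableType d) (P : probability T R)
    (D : set T) (f : T -> measurableTypeR R) (c : R)
    (Q : probability (measurableTypeR R) R) :
  measurable D -> measurable_fun setT f -> 0 <= c ->
  (forall a, P (D `&` f @^-1` `]-oo, a]) = c%:E * Q `]-oo, a]%classic)%E ->
  forall A, measurable A -> P (D `&` f @^-1` A) = (c%:E * Q A)%E.
Proof.
move=> mD mf c0 H A mA.
pose m2 : {measure set (measurableTypeR R) -> \bar R} := mscale (NngNum c0) Q.
have := @eq_measure_rays (pushforward (mrestr P mD) f) m2.
rewrite /= => HH; rewrite setIC; apply: (HH mf) => // a.
  by rewrite -[RHS]H setIC.
rewrite (le_lt_trans (probability_le1 _ _)) ?ltry//.
by apply: measurableI => //; rewrite -[X in measurable X]setTI; exact: mf.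
Qed.

End uniqueness_on_rays.

(** * Binary digits: two independent uniform variables from one *)

Section binary_digits.
Context {R : realType}.

Definition dbit (w : R) : R := if w < 2^-1 then 0 else 1.
Definition dshift (w : R) : R := 2 * w - dbit w.

Lemma measurable_dbit : measurable_fun setT dbit.
Proof.
apply: measurable_fun_if => //=.
by apply: measurable_fun_ltr => //; exact: measurable_id.
Qed.

Lemma measurable_dshift : measurable_fun setT dshift.
Proof.
by apply: measurable_funB; [exact: measurable_funM|exact: measurable_dbit].
Qed.

Definition unif : probability (measurableTypeR R) R := uniform_prob (@ltr01 R).

Lemma unifE (A : set (measurableTypeR R)) : measurable A ->
  unif A = lebesgue_measure (A `&` `[0, 1]%classic).
Proof.
move=> mA; rewrite /unif/= /uniform_prob integral_uniform_pdf.
rewrite (eq_integral (fun=> 1%E)); last first.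
  move=> x; rewrite inE /= => -[_]; rewrite in_itv/= /uniform_pdf => ->.
  by rewrite subr0 invr1.
by rewrite integral_cst//= ?mul1e//; exact: measurableI.
Qed.

Lemma unif_ray (a : R) : unif `]-oo, a]%classic = (Num.max 0 (Num.min a 1))%:E.
Proof.
rewrite unifE//.
have [a0|a0] := ltP a 0.
  rewrite (_ : _ `&` _ = set0) ?measure0.
    by rewrite min_l ?max_l// ltW// (lt_trans a0).
  rewrite -subset0 => x /= [].
  rewrite !in_itv/= => xa /andP[x0 _].
  by have := le_lt_trans x0 (le_lt_trans xa a0); rewrite ltxx.
rewrite (_ : _ `&` _ = `[0, Num.min a 1]%classic); last first.
  apply/seteqP; split => x /=; rewrite !in_itv/= le_min.
    by move=> [-> /andP[-> ->]].
  by move=> /and3P[-> -> ->].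
rewrite lebesgue_measure_itv/= lte_fin.
rewrite -EFinD subr0 /Order.max.
by case: ifP.
Qed.

Local Notation U := (measurableTypeR R).

Lemma measurable_dshift_preimage (A : set U) : measurable A ->
  measurable (dshift @^-1` A : set U).
Proof. by move=> mA; rewrite -[X in measurable X]setTI; exact: measurable_dshift. Qed.

Lemma measurable_half_lt : measurable ([set w | w < 2^-1] : set U).
Proof. by rewrite -set_itvNyo. Qed.

Lemma measurable_half_ge : measurable ([set w | 2^-1 <= w] : set U).
Proof. by rewrite -set_itvcy. Qed.

(** With its companion on the upper half: under the uniform law the first digit is a fair coin, and
    the shifted point is again uniform and independent of that digit. *)
Lemma unif_preimage_lt (A : set U) : measurable A ->
  unif ([set w | w < 2^-1] `&` dshift @^-1` A) = (2^-1%:E * unif A)%E.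
Proof.
apply: probability_preimage_rays => //; [exact: measurable_half_lt|exact: measurable_dshift|] => a.
rewrite unif_ray unifE; last first.
  by apply: measurableI; [exact: measurable_half_lt|exact: measurable_dshift_preimage].
have [a0|a0] := ltP a 0.
  rewrite (_ : _ `&` _ = set0) ?measure0 ?min_l ?max_l ?mule0//; [exact: ltW|lra|].
  rewrite -subset0 => x /= [[+ +]].
  by rewrite !in_itv/= /dshift /dbit => -> ? ; lra.
rewrite max_r; last by rewrite le_min a0 ler01.
(* The first digit 0 excludes the point 1/2, so the interval is open on the right exactly when
   [1 <= a]; as a right end, [BSide true] is strict. *)
rewrite (_ : _ `&` _ = [set` Interval (BLeft 0) (BSide (1 <= a) (Num.min a 1 / 2))]).
  rewrite lebesgue_measure_itv/= lte_fin oppr0 adde0 -EFinM mulrC.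
  have : 0 <= Num.min a 1 by rewrite le_min a0 ler01.
  by case: ltP => // ? ?; congr EFin; lra.
apply/seteqP; split => x /=; rewrite !in_itv/= /dshift /dbit; case: (leP 1 a) => a1 /=.
- by move=> [[h _] ?]; lra.
- by move=> [[-> ] ?]; lra.
- by move=> ?; have -> : x < 2^-1; [lra|split; [split => //; lra|lra]].
- by move=> ?; have -> : x < 2^-1; [lra|split; [split => //; lra|lra]].
Qed.

Lemma unif_preimage_ge (A : set U) : measurable A ->
  unif ([set w | 2^-1 <= w] `&` dshift @^-1` A) = (2^-1%:E * unif A)%E.
Proof.
apply: probability_preimage_rays => //; [exact: measurable_half_ge|exact: measurable_dshift|] => a.
rewrite unif_ray unifE; last first.
  by apply: measurableI; [exact: measurable_half_ge|exact: measurable_dshift_preimage].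
have [a0|a0] := ltP a 0.
  rewrite (_ : _ `&` _ = set0) ?measure0 ?min_l ?max_l ?mule0//; [exact: ltW|lra|].
  rewrite -subset0 => x /= [[+ +]].
  by rewrite !in_itv/= /dshift /dbit; case: ifP => ? ? ? ?; lra.
rewrite max_r; last by rewrite le_min a0 ler01.
set m := Num.min a 1.
have /andP[m0 m1] : 0 <= m <= 1 by rewrite /m le_min a0 ler01 ge_min lexx orbT.
rewrite (_ : _ `&` _ = `[2^-1, (m + 1) / 2]%classic).
  rewrite lebesgue_measure_itv/= lte_fin; case: ifPn => h.
    by rewrite -EFinD -EFinM; congr EFin; lra.
  by rewrite (_ : m = 0) ?mule0//; lra.
have H x : (x <= (m + 1) / 2) = (2 * x - 1 <= a) && (x <= 1).
  rewrite ler_pdivlMr// -lerBlDr mulrC /m le_min; congr andb.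
  by apply/idP/idP; lra.
apply/seteqP; split => x /=; rewrite !in_itv/= /dshift /dbit.
  by rewrite H; case: ifP => ? [[? ?] ?]; lra.
rewrite H => ?; have -> : (x < 2^-1) = false by lra.
by split; [split => //; lra|lra].
Qed.

(** Partial sums of the binary expansion whose digits are those of odd rank in [w]; two shifts lead
    to the next such digit. *)
Fixpoint dexp_approx (n : nat) (w : R) : R :=
  if n is n'.+1 then (dbit w + dexp_approx n' (dshift (dshift w))) / 2 else 0.

Definition dexp (w : R) : R := limn (dexp_approx ^~ w).

Lemma dexp_approx01 n w : 0 <= dexp_approx n w <= 1.
Proof.
elim: n w => [|n IH] w /=; first by rewrite lexx ler01.
by have := IH (dshift (dshift w)); rewrite /dbit; case: ifP => _; lra.
Qed.

Lemma dexp_approxS n w : dexp_approx n w <= dexp_approx n.+1 w.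
Proof.
elim: n w => [|n IH] w.
  by have /andP[] := dexp_approx01 1 w.
rewrite -[leLHS]/((dbit w + dexp_approx n (dshift (dshift w))) / 2).
rewrite -[leRHS]/((dbit w + dexp_approx n.+1 (dshift (dshift w))) / 2).
by rewrite ler_pM2r ?invr_gt0// lerD2l.
Qed.

Lemma cvg_dexp w : dexp_approx n w @[n --> \oo] --> dexp w.
Proof.
apply: nondecreasing_is_cvgn.
  by apply/nondecreasing_seqP => n; exact: dexp_approxS.
by exists 1 => _ [n _ <-]; have /andP[] := dexp_approx01 n w.
Qed.

Lemma dexpE w : dexp w = (dbit w + dexp (dshift (dshift w))) / 2.
Proof.
apply: (cvg_unique _ (@cvg_dexp w)); first exact: norm_hausdorff.
rewrite /=.
rewrite -(cvg_shiftS (dexp_approx ^~ w)) /=.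
apply: cvgMr_tmp; apply: cvgD; first exact: cvg_cst.
exact: cvg_dexp.
Qed.

Lemma dexp01 w : 0 <= dexp w <= 1.
Proof.
apply/andP; split.
  apply: limr_ge; first by apply/cvg_ex; exists (dexp w); exact: cvg_dexp.
  by apply: nearW => n; have /andP[] := dexp_approx01 n w.
apply: limr_le; first by apply/cvg_ex; exists (dexp w); exact: cvg_dexp.
by apply: nearW => n; have /andP[] := dexp_approx01 n w.
Qed.

Lemma measurable_dexp : measurable_fun [set: U] dexp.
Proof.
have md n : measurable_fun [set: U] (dexp_approx n).
  elim: n => [|n IH] /=; first exact: measurable_cst.
  apply: measurable_funM; last exact: measurable_cst.
  apply: measurable_funD; first exact: measurable_dbit.
  apply: (measurableT_comp IH).
  by apply: measurableT_comp; exact: measurable_dshift.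
apply: (@measurable_fun_cvg _ _ _ _ dexp_approx) => // w _.
exact: cvg_dexp.
Qed.

(** The digits of even rank: one shift gives them odd rank. *)
Definition dexp2 (w : R) : R := dexp (dshift w).

Lemma measurable_dexp2 : measurable_fun [set: U] dexp2.
Proof. by apply: (measurableT_comp measurable_dexp); exact: measurable_dshift. Qed.

Let joint (a b : R) := fine (unif (dexp @^-1` `]-oo, a] `&` dexp2 @^-1` `]-oo, b])).
Let c (a : R) := Num.max 0 (Num.min a 1).

Let mpre (f : R -> R) (A : set U) : measurable_fun [set: U] f -> measurable A ->
  measurable (f @^-1` A : set U).
Proof. by move=> mf mA; rewrite -[X in measurable X]setTI; exact: mf. Qed.

Let mjoint a b : measurable (dexp @^-1` `]-oo, a] `&` dexp2 @^-1` `]-oo, b] : set U).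
Proof.
by apply: measurableI; apply: mpre => //; [exact: measurable_dexp|exact: measurable_dexp2].
Qed.

(** Reading the first digit exchanges the two expansions: with [w' = dshift w], [dexp2 w] is
    [dexp w'], and [dexp w] is half the sum of the digit and [dexp2 w']. Hence the swapped
    arguments, and one term for each value of the digit. *)
Let joint_rec a b : joint a b = (joint b (2 * a) + joint b (2 * a - 1)) / 2.
Proof.
rewrite /joint.
have -> : dexp @^-1` `]-oo, a] `&` dexp2 @^-1` `]-oo, b] =
    ([set w | w < 2^-1] `&` dshift @^-1` (dexp @^-1` `]-oo, b] `&` dexp2 @^-1` `]-oo, 2 * a])) `|`
    ([set w | 2^-1 <= w] `&` dshift @^-1` (dexp @^-1` `]-oo, b] `&` dexp2 @^-1` `]-oo, 2 * a - 1])).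
  apply/seteqP; split => w /=; rewrite !in_itv/= /dexp2; case: ltP => h.
  - by rewrite (dexpE w) /dbit h => -[? ?]; left; split => //; split => //; lra.
  - by rewrite (dexpE w) /dbit ltNge h /= => -[? ?]; right; split => //; split => //; lra.
  - by rewrite (dexpE w) /dbit h => -[[_ [? ?]]|[]//]; split => //; lra.
  - by rewrite (dexpE w) /dbit ltNge h /= => -[[]//|[_ [? ?]]]; split => //; lra.
rewrite measureU/=; last 3 first.
- by apply: measurableI; [exact: measurable_half_lt|exact: measurable_dshift_preimage].
- by apply: measurableI; [exact: measurable_half_ge|exact: measurable_dshift_preimage].
- by rewrite -subset0 => w /= [[? _] [? _]]; lra.
rewrite unif_preimage_lt// unif_preimage_ge// fineD ?fineM ?fin_numM ?fin_num_measure//=.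
by rewrite -mulrDr mulrC.
Qed.

Let joint_neg a b : b < 0 -> joint a b = 0.
Proof.
move=> b0; rewrite /joint (_ : _ `&` _ = set0) ?measure0//.
rewrite -subset0 => w /= []; rewrite !in_itv/= => _; rewrite /dexp2.
by have /andP[] := dexp01 (dshift w); lra.
Qed.

Let joint_big a b : 1 <= a -> 1 <= b -> joint a b = 1.
Proof.
move=> a1 b1; rewrite /joint (_ : _ `&` _ = setT) ?probability_setT//.
apply/seteqP; split => w //= _; rewrite !in_itv/= /dexp2.
by have := dexp01 (dshift w); have := dexp01 w; lra.
Qed.

Let cE a : c a = (if a < 0 then 0 else if 1 < a then 1 else a).
Proof.
rewrite /c; case: (ltP a 0) => a0.
  by rewrite min_l ?max_l//; lra.
rewrite max_r; last by rewrite le_min a0 ler01.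
by case: (ltP 1 a).
Qed.

Let c01 a : 0 <= c a <= 1.
Proof. by rewrite cE; case: ifP => ?; [|case: ifP => ?]; lra. Qed.

Let joint01 a b : 0 <= joint a b <= 1.
Proof. by rewrite fine_ge0//= -lee_fin fineK ?fin_num_measure// probability_le1. Qed.

Let eq_half_powers (x y : R) : (forall n, `|x - y| <= 2^-1 ^+ n) -> x = y.
Proof.
move=> H; apply/eqP; rewrite -subr_eq0 -normr_le0.
have h1 : `|2^-1 : R| < 1 by rewrite ger0_norm ?invr_ge0//; lra.
have := cvg_expr h1 => h2.
rewrite -(cvg_lim _ h2)//; apply: limr_ge; first by apply/cvg_ex; exists 0.
by apply: nearW => n; exact: H.
Qed.

(** The clamp [c] obeys the same recursion. A first step swaps the arguments and keeps the error; in
    a second step one of the two terms is exact, so the error is halved. *)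
Let joint_margin b e : 1 <= e -> joint b e = c b.
Proof.
move=> e1; apply: eq_half_powers => n; elim: n b e e1 => [|n IH] b e e1.
  by rewrite expr0 ler_norml; have := joint01 b e; have := c01 b; lra.
have Hsym x : `|joint e x - c x| <= 2^-1 ^+ n.
  rewrite joint_rec.
  have h1 : `|joint x (2 * e) - c x| <= 2^-1 ^+ n by apply: IH; lra.
  have h2 : `|joint x (2 * e - 1) - c x| <= 2^-1 ^+ n by apply: IH; lra.
  move: h1 h2; rewrite !ler_norml; lra.
rewrite joint_rec exprS; have [b2|b2] := ltP (2 * b) 1.
  rewrite (@joint_neg _ (2 * b - 1)); last lra.
  have := Hsym (2 * b); rewrite !ler_norml !cE.
  case: ifP => ?; [|case: ifP => ?]; case: ifP => ?; try (case: ifP => ?); lra.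
rewrite joint_big//.
have := Hsym (2 * b - 1); rewrite !ler_norml !cE.
case: ifP => ?; [|case: ifP => ?]; case: ifP => ?; try (case: ifP => ?); lra.
Qed.

(** Halving again: after one step, one term is exact, being 0 when [2 * a < 1] and a margin
    otherwise. *)
Let joint_prod a b : joint a b = c a * c b.
Proof.
apply: eq_half_powers => n; elim: n a b => [|n IH] a b.
  have /andP[a0 a1] := c01 a; have /andP[b0 b1] := c01 b.
  have : 0 <= c a * c b by rewrite mulr_ge0.
  have : c a * c b <= 1 by rewrite mulr_ile1.
  by rewrite expr0 ler_norml; have := joint01 a b; lra.
rewrite joint_rec exprS; have [a2|a2] := ltP (2 * a) 1.
  rewrite (@joint_neg _ (2 * a - 1)); last lra.
  have : c a = c (2 * a) / 2.
    by rewrite !cE; case: ifP => ?; [|case: ifP => ?]; case: ifP => ?; try (case: ifP => ?); lra.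
  have := IH b (2 * a); rewrite !ler_norml => + ->.
  by lra.
rewrite joint_margin//.
have : c a = (1 + c (2 * a - 1)) / 2.
  by rewrite !cE; case: ifP => ?; [|case: ifP => ?]; case: ifP => ?; try (case: ifP => ?); lra.
have := IH b (2 * a - 1); rewrite !ler_norml => + ->.
by lra.
Qed.

(** Independence passes from half-lines to Borel sets one coordinate at a time. As [dexp2] is again
    uniform, the split can be repeated forever, which supplies the independent sequence behind the
    Poisson process. *)
Lemma unif_split (f : U * U -> \bar R) : measurable_fun setT f ->
  (forall z, 0 <= f z)%E ->
  (\int[unif]_w f (dexp w, dexp2 w) = \int[unif]_x \int[unif]_y f (x, y))%E.
Proof.
move=> mf f0.
have jE a b : unif (dexp @^-1` `]-oo, a] `&` dexp2 @^-1` `]-oo, b]) = (c a * c b)%:E.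
  by rewrite -joint_prod /joint fineK// fin_num_measure.
have c0 x : 0 <= c x by have /andP[] := c01 x.
have step1 A b : measurable A ->
    unif (dexp2 @^-1` `]-oo, b] `&` dexp @^-1` A) = ((c b)%:E * unif A)%E.
  apply: probability_preimage_rays => //.
  - by apply: mpre => //; exact: measurable_dexp2.
  - exact: measurable_dexp.
  - by move=> a; rewrite setIC jE unif_ray mulrC EFinM.
have step2 A B : measurable A -> measurable B ->
    unif (dexp @^-1` A `&` dexp2 @^-1` B) = (unif A * unif B)%E.
  move=> mA; have fA : unif A \is a fin_num by exact: fin_num_measure.
  rewrite -[X in (X * _)%E](fineK fA).
  apply: probability_preimage_rays => //.
  - by apply: mpre => //; exact: measurable_dexp.
  - exact: measurable_dexp2.
  - exact: fine_ge0.
  - by move=> b; rewrite setIC step1// unif_ray fineK// muleC.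
have mpair : measurable_fun [set: U] ((fun w => (dexp w, dexp2 w)) : U -> U * U).
  by apply/measurable_fun_pairP; split; [exact: measurable_dexp|exact: measurable_dexp2].
pose m := pushforward unif ((fun w => (dexp w, dexp2 w)) : U -> U * U).
transitivity (\int[m]_z f z)%E; first by rewrite ge0_integral_pushforward.
transitivity (\int[(unif \x unif)%E]_z f z)%E.
  apply: eq_measure_integral => A mA _.
  by apply/esym; apply: (@product_measure_unique _ _ _ _ _ unif unif m).
by rewrite fubini_tonelli1.
Qed.

End binary_digits.

Section positive_half_line.
Context {R : realType}.
Notation mu := (@lebesgue_measure R).

(** Meant for integrands whose primitive is known to be differentiable at positive points only: the
    fundamental theorem is applied away from 0. *)
Lemma cvg_integral_0y (f : R -> \bar R) :
  measurable_fun (`]0%R, +oo[%classic : set R) f -> (forall x, (0 < x)%R -> 0 <= f x)%E ->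
  (\int[mu]_(x in `[(n.+1%:R^-1)%R, +oo[) f x @[n --> \oo] -->
   \int[mu]_(x in `]0%R, +oo[) f x)%E.
Proof.
move=> mf f0.
have E : `]0%R, +oo[%classic = \bigcup_k `[k.+1%:R^-1, +oo[%classic :> set R.
  by rewrite itvoyEbigcup; apply: eq_bigcup => // k _; rewrite add0r.
rewrite E; apply: ge0_nondecreasing_set_cvg_integral.
- apply/nondecreasing_seqP => n; apply/subsetPset => x /=; rewrite !in_itv/= !andbT.
  by apply: le_trans; rewrite lef_pV2 ?posrE// ler_nat.
- by move=> n; exact: measurable_itv.
- move=> n; apply: measurable_funS mf => // x /=; rewrite !in_itv/= !andbT.
  by apply: lt_le_trans; rewrite invr_gt0.
- by move=> n x /=; rewrite !in_itv/= !andbT => h; apply: f0; apply: lt_le_trans h; rewrite invr_gt0.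
Qed.

End positive_half_line.

Lemma is_derive_continuous (R : realType) (f : R -> R) (x df : R) :
  is_derive x 1 f df -> {for x, continuous f}.
Proof. by case=> fx _; apply/differentiable_continuous/derivable1_diffP. Qed.

(** * The exponent r y^2 + s y and its density *)

Section exponent.
Context {R : realType}.
Implicit Types (r s y a : R).

Definition qlin r s y := r * y ^+ 2 + s * y.
Definition qlin_dens r s y := (2 * r * y + s) * expR (- qlin r s y).

Lemma qlin_ge0 r s y : 0 <= r -> 0 <= s -> 0 <= y -> 0 <= qlin r s y.
Proof. by move=> r0 s0 y0; rewrite addr_ge0// mulr_ge0// sqr_ge0. Qed.

Lemma qlin_dens_ge0 r s y : 0 <= r -> 0 <= s -> 0 <= y -> 0 <= qlin_dens r s y.
Proof. by move=> r0 s0 y0; rewrite mulr_ge0 ?expR_ge0// addr_ge0// !mulr_ge0. Qed.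

Lemma is_derive_qlin r s y :
  is_derive y 1 (fun y => 1 - expR (- qlin r s y)) (qlin_dens r s y).
Proof.
rewrite /qlin /qlin_dens; apply: trigger_derive.
rewrite /GRing.scale/= /qlin; ring.
Qed.

Lemma continuous_qlin_dens r s : continuous (qlin_dens r s).
Proof.
move=> y; apply: cvgM.
  by apply: cvgD; [apply: cvgMl_tmp; exact: cvg_id|exact: cvg_cst].
apply: continuous_cvg; first exact: continuous_expR.
apply: cvgN; apply: cvgD; last by apply: cvgMl_tmp; exact: cvg_id.
by apply: cvgMl_tmp; exact: exprn_continuous.
Qed.

Lemma measurable_qlin r s : measurable_fun [set: R] (qlin r s).
Proof.
by apply: measurable_funD; apply: measurable_funM => //.
Qed.

Lemma measurable_qlin_dens r s : measurable_fun [set: R] (qlin_dens r s).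
Proof.
apply: measurable_funM; first by apply: measurable_funD => //; exact: measurable_funM.
apply: measurableT_comp => //; apply: measurableT_comp => //; exact: measurable_qlin.
Qed.

Lemma integral_qlin_dens r s x : 0 <= r -> 0 <= s -> 0 <= x ->
  (\int[(@lebesgue_measure R)]_(y in `]0%R, x[) (qlin_dens r s y)%:E)%E = (1 - expR (- qlin r s x))%:E.
Proof.
move=> r0 s0; rewrite le_eqVlt => /orP[/eqP<-|x0].
  by rewrite set_itvoo0 integral_set0 /qlin expr0n/= !mulr0 addr0 oppr0 expR0 subrr.
rewrite -(integral_itv_bndoo true false); last first.
  apply/measurable_EFinP; apply: measurable_funS (measurable_qlin_dens r s) => //.
rewrite (@continuous_FTC2 _ (qlin_dens r s) (fun y => 1 - expR (- qlin r s y)))//.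
- by rewrite /qlin expr0n/= !mulr0 addr0 oppr0 expR0 subrr oppr0 adde0.
- by apply: continuous_subspaceT; exact: continuous_qlin_dens.
- have cF : continuous (fun y => 1 - expR (- qlin r s y)).
    by move=> y; exact: is_derive_continuous (is_derive_qlin r s y).
  split; [|exact/cvg_at_right_filter/cF|exact/cvg_at_left_filter/cF].
  by move=> y _; have [] := is_derive_qlin r s y.
- by move=> y _; rewrite derive1E; have [_ ->] := is_derive_qlin r s y.
Qed.

End exponent.

(** * Layer-cake formulas *)

Section layer_cake.
Context {R : realType} d (T : measurableType d) (m : {sigma_finite_measure set T -> \bar R}).
Notation mu := (@lebesgue_measure R).

Let measurable_ltr_natr d1 (T1 : measurableType d1) (f g : T1 -> R) :
  measurable_fun setT f -> measurable_fun setT g ->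
  measurable_fun setT (fun t => (f t < g t)%R%:R : R).
Proof.
move=> mf mg; rewrite (_ : (fun t => _) = (fun t => if f t < g t then 1 else 0)).
  by apply: measurable_fun_if => //=; exact: measurable_fun_ltr.
by apply/funext => t; case: ifP.
Qed.

Lemma weighted_layer_cake (W x : T -> R) (k : R -> R) :
  measurable_fun setT W -> (forall t, 0 <= W t) -> measurable_fun setT x ->
  measurable_fun setT k -> (forall y, 0 < y -> 0 <= k y) ->
  (\int[m]_t ((W t)%:E * \int[mu]_(y in `]0%R, x t[) (k y)%:E) =
   \int[mu]_(y in `]0%R, +oo[) ((k y)%:E * \int[m]_t (W t * (y < x t)%R%:R)%:E))%E.
Proof.
move=> mW W0 mx mk k0.
(* [k] is nonnegative at positive points only; extended by 0 elsewhere it satisfies Tonelli's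
   theorem on the whole product. *)
pose k' y := if 0 < y then k y else 0.
have k'0 y : 0 <= k' y by rewrite /k'; case: ifP => // /k0.
have mk' : measurable_fun [set: R] k'.
  apply: measurable_fun_if => //; first exact: measurable_fun_ltr.
  exact: measurable_funTS.
pose b (z : T * measurableTypeR R) : R := (z.2 < x z.1)%R%:R.
have mb : measurable_fun setT b.
  by apply: measurable_ltr_natr => //; exact: measurableT_comp.
pose f z := (W z.1 * (k' z.2 * b z))%:E.
have mf : measurable_fun setT f.
  apply/measurable_EFinP; apply: measurable_funM; first exact: measurableT_comp.
  by apply: measurable_funM => //; exact: (measurableT_comp mk').
have f0 z : (0 <= f z)%E by rewrite lee_fin !mulr_ge0.
have := @fubini_tonelli _ _ _ _ _ m mu f mf f0.
have -> : (\int[m]_t \int[mu]_y f (t, y) =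
    \int[m]_t ((W t)%:E * \int[mu]_(y in `]0%R, x t[) (k y)%:E))%E.
  apply: eq_integral => t _; rewrite [X in (_ * X)%E]integral_mkcond -ge0_integralZl//.
  - apply: eq_integral => y _; rewrite patchE mem_setE in_itv/= /f /k' /b /=.
    by case: (0 < y); case: (y < x t); rewrite /= ?mul0r ?mulr0 ?mulr1 ?mule0.
  - apply/(measurable_restrictT _ (measurable_itv _)).
    exact/measurable_EFinP/measurable_funTS.
  - move=> y _; rewrite patchE; case: ifPn => //; rewrite inE/= in_itv/= => /andP[y0 _].
    by rewrite lee_fin k0.
  - by rewrite lee_fin.
move=> ->; rewrite [RHS]integral_mkcond; apply: eq_integral => y _ /=.
rewrite patchE mem_setE in_itv/= andbT /f/= /k'; case: ifPn => y0; last first.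
  by rewrite integral0_eq// => t _; rewrite mul0r mulr0.
rewrite -ge0_integralZl//.
- by apply: eq_integral => t _; rewrite mulrCA EFinM.
- apply/measurable_EFinP; apply: measurable_funM => //.
  exact: measurable_ltr_natr.
- by move=> t _; rewrite lee_fin mulr_ge0.
- by rewrite lee_fin k0.
Qed.

Lemma layer_cake (x : T -> R) (k : R -> R) (D : set T) : measurable D ->
  measurable_fun setT x -> measurable_fun setT k -> (forall y, 0 < y -> 0 <= k y) ->
  (\int[m]_(t in D) \int[mu]_(y in `]0%R, x t[) (k y)%:E =
   \int[mu]_(y in `]0%R, +oo[) ((k y)%:E * m (D `&` [set t | (y < x t)%R])))%E.
Proof.
move=> mD mx mk k0.
transitivity (\int[m]_t ((\1_D t)%:E * \int[mu]_(y in `]0%R, x t[) (k y)%:E))%E.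
  rewrite integral_mkcond; apply: eq_integral => t _.
  by rewrite patchE indicE; case: ifP; rewrite ?mul1e ?mul0e.
rewrite weighted_layer_cake//; apply: eq_integral => y _; congr mule.
have mDx : measurable (D `&` [set t | (y < x t)%R]).
  apply: measurableI => //; rewrite -[X in measurable X]setTI.
  by have := measurable_fun_ltr (measurable_cst y) mx; apply.
rewrite -[D `&` _]setIT -integral_indic//; apply: eq_integral => t _.
rewrite !indicE in_setI; have -> : (t \in [set t | y < x t]) = (y < x t).
  by apply/idP/idP; rewrite inE.
by case: (t \in D); rewrite ?mul0r ?mul1r.
Qed.

End layer_cake.

(** * The Laplace exponent of the stable pair *)

Section exponent_integral.
Context {R : realType}.
Notation mu := (@lebesgue_measure R).
Implicit Types (r s a : R).

(* [stable_exponent a r s] is the Laplace exponent of the pair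
   (sum of squares, sum) of the jumps of the a-stable subordinator. *)
Definition stable_exponent a r s : \bar R :=
  (\int[mu]_(y in `]0%R, +oo[) (qlin_dens r s y * y `^ (- a))%:E)%E.

Lemma measurable_stable_density a r s :
  measurable_fun [set: R] (fun y => qlin_dens r s y * y `^ (- a)).
Proof.
by apply: measurable_funM; [exact: measurable_qlin_dens|exact: measurable_powR].
Qed.

Lemma stable_density_ge0 a r s y : 0 <= r -> 0 <= s -> 0 < y ->
  0 <= qlin_dens r s y * y `^ (- a).
Proof. by move=> r0 s0 y0; rewrite mulr_ge0 ?powR_ge0 ?qlin_dens_ge0// ltW. Qed.

Lemma integral_powR01 a : a < 1 ->
  (\int[mu]_(y in `]0%R, 1%R]) (y `^ (- a))%:E <= ((1 - a)^-1)%:E)%E.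
Proof.
move=> a1.
have E : `]0%R, 1%R]%classic = \bigcup_k `[(k.+2%:R^-1 : R), 1%R]%classic :> set R.
  apply/seteqP; split => x /=; rewrite in_itv/=.
    move=> /andP[x0 x1]; exists (Num.truncn x^-1) => //=; rewrite in_itv/= x1 andbT.
    rewrite invf_ple ?posrE// (le_trans (ltW (truncnS_gt _)))//.
    by rewrite ler_nat.
  by move=> [k _] /=; rewrite in_itv/= => /andP[kx ->]; rewrite (lt_le_trans _ kx)// invr_gt0.
have L : (\int[mu]_(y in `[(n.+2%:R^-1)%R, 1%R]) (y `^ (- a))%:E @[n --> \oo] -->
    \int[mu]_(y in `]0%R, 1%R]) (y `^ (- a))%:E)%E.
  rewrite E; apply: ge0_nondecreasing_set_cvg_integral.
  - apply/nondecreasing_seqP => n; apply/subsetPset => x /=; rewrite !in_itv/=.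
    move=> /andP[h ->]; rewrite andbT (le_trans _ h)//.
    by rewrite lef_pV2 ?posrE// ler_nat.
  - by move=> n; exact: measurable_itv.
  - by move=> n; apply/measurable_EFinP/measurable_funTS; exact: measurable_powR.
  - by move=> n x _; rewrite lee_fin powR_ge0.
rewrite -(cvg_lim _ L)//; apply: lime_le; first by apply/cvg_ex; eexists; exact: L.
apply: nearW => n; set e : R := n.+2%:R^-1.
have e0 : 0 < e by rewrite invr_gt0.
have e1 : e < 1 by rewrite invf_lt1// ltr1n.
have a'0 : 0 < 1 - a by rewrite subr_gt0.
have dF (y : R) : 0 < y -> is_derive y 1 (fun y => (1 - a)^-1 * y `^ (1 - a)) (y `^ (- a)).
  move=> y0; have := is_derive1_powR (1 - a) y0 => H.
  apply: trigger_derive; rewrite /GRing.scale/= mulrA mulVf ?gt_eqF// mul1r.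
  by congr powR; ring.
have cF (y : R) : 0 < y -> {for y, continuous (fun y => (1 - a)^-1 * y `^ (1 - a))}.
  by move=> y0; exact: is_derive_continuous (dF _ y0).
rewrite (@continuous_FTC2 _ _ (fun y => (1 - a)^-1 * y `^ (1 - a)))//.
- rewrite powR1 mulr1 -EFinB lee_fin lerBlDr lerDl mulr_ge0 ?powR_ge0//.
  by rewrite invr_ge0 ltW.
- apply: continuous_in_subspaceT => y; rewrite inE/= in_itv/= => /andP[ey _].
  have y0 := lt_le_trans e0 ey.
  exact: is_derive_continuous (is_derive1_powR (- a) y0).
- split; [|exact/cvg_at_right_filter/cF|exact/cvg_at_left_filter/cF].
  move=> y; rewrite in_itv/= => /andP[ey _].
  by have [] := dF _ (lt_trans e0 ey).
- move=> y; rewrite in_itv/= => /andP[ey _].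
  by rewrite derive1E; have [_ ->] := dF _ (lt_trans e0 ey).
Qed.

Lemma qlin_dens_le r s y : 0 <= r -> 0 <= s -> 0 <= y <= 1 -> qlin_dens r s y <= 2 * r + s.
Proof.
move=> r0 s0 /andP[y0 y1]; rewrite /qlin_dens -[leRHS]mulr1; apply: ler_pM.
- by rewrite addr_ge0// !mulr_ge0.
- exact: expR_ge0.
- by rewrite lerD2r ler_piMr// mulr_ge0.
- by rewrite expR_le1 oppr_le0 qlin_ge0.
Qed.

(** The total mass is 1 unless [r = s = 0], when the density vanishes; the inequality covers both
    cases. *)
Lemma integral_qlin_dens_le1 r s : 0 <= r -> 0 <= s ->
  (\int[mu]_(y in `]0%R, +oo[) (qlin_dens r s y)%:E <= 1)%E.
Proof.
move=> r0 s0.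
have E : `]0%R, +oo[%classic = \bigcup_k `]0%R, (k%:R : R)[%classic :> set R.
  apply/seteqP; split => x /=; rewrite in_itv/= ?andbT.
    by move=> x0; exists (Num.truncn x).+1 => //=; rewrite in_itv/= x0 truncnS_gt.
  by move=> [k _] /=; rewrite in_itv/= => /andP[].
have L : (\int[mu]_(y in `]0%R, n%:R%R[) (qlin_dens r s y)%:E @[n --> \oo] -->
    \int[mu]_(y in `]0%R, +oo[) (qlin_dens r s y)%:E)%E.
  rewrite E; apply: ge0_nondecreasing_set_cvg_integral.
  - apply/nondecreasing_seqP => n; apply/subsetPset => x /=; rewrite !in_itv/=.
    by move=> /andP[-> h]/=; rewrite (lt_le_trans h)// ler_nat.
  - by move=> n; exact: measurable_itv.
  - by move=> n; apply/measurable_EFinP/measurable_funTS; exact: measurable_qlin_dens.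
  - by move=> n x /=; rewrite in_itv/= => /andP[x0 _]; rewrite lee_fin qlin_dens_ge0// ltW.
rewrite -(cvg_lim _ L)//; apply: lime_le; first by apply/cvg_ex; eexists; exact: L.
by apply: nearW => n; rewrite integral_qlin_dens// lee_fin gerBl expR_ge0.
Qed.

Lemma integrable_qlin_dens r s : 0 <= r -> 0 <= s ->
  mu.-integrable `]0, +oo[ (fun y => (qlin_dens r s y)%:E).
Proof.
move=> r0 s0.
have mq : measurable_fun (`]0%R, +oo[%classic : set R) (fun y => (qlin_dens r s y)%:E).
  by apply/measurable_EFinP/measurable_funTS; exact: measurable_qlin_dens.
apply/integrableP; split => //.
apply: (@le_lt_trans _ _ 1%E); last exact: ltry.
apply: le_trans (integral_qlin_dens_le1 r0 s0).
apply: ge0_le_integral => //; first exact: measurableT_comp.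
move=> y /=; rewrite in_itv/= andbT => y0.
by rewrite ger0_norm// qlin_dens_ge0// ltW.
Qed.

(** Near 0 the density is bounded and the power is integrable since [a < 1]; beyond 1 the power is
    at most 1 since [0 <= a], and the density alone is integrable. *)
Lemma stable_exponent_lty a r s : 0 <= a -> a < 1 -> 0 <= r -> 0 <= s ->
  (stable_exponent a r s < +oo)%E.
Proof.
move=> a0 a1 r0 s0; rewrite /stable_exponent.
have E : `]0%R, +oo[%classic = `]0%R, 1%R] `|` `]1%R, +oo[ :> set R.
  apply/seteqP; split => y /=; rewrite !in_itv/= !andbT.
    by move=> ->; case: (leP y 1) => ?; [left|right].
  by move=> [/andP[]//|]; apply: lt_trans.
have md (D : set R) : measurable_fun D (fun y => (qlin_dens r s y * y `^ (- a))%:E).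
  by apply/measurable_EFinP/measurable_funTS; exact: measurable_stable_density.
rewrite E ge0_integral_setU//; last 3 first.
- exact: md.
- by move=> y; rewrite -E/= in_itv/= andbT => y0; rewrite lee_fin stable_density_ge0.
- by apply/disj_setPS => y /= []; rewrite !in_itv/= andbT => /andP[_]; rewrite leNgt => /negP.
apply: lte_add_pinfty.
  apply: (@le_lt_trans _ _ ((2 * r + s)%:E * ((1 - a)^-1)%:E)%E); last by rewrite -EFinM ltry.
  apply: (@le_trans _ _ (\int[mu]_(y in `]0%R, 1%R]) ((2 * r + s)%:E * (y `^ (- a))%:E))%E).
    apply: ge0_le_integral => //.
    - by move=> y /=; rewrite in_itv/= => /andP[y0 _]; rewrite lee_fin stable_density_ge0.
    - exact: md.
    - apply: measurable_funeM.
      by apply/measurable_EFinP/measurable_funTS; exact: measurable_powR.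
    - move=> y /=; rewrite in_itv/= => /andP[y0 y1]; rewrite lee_fin ler_wpM2r ?powR_ge0//.
      by apply: qlin_dens_le => //; rewrite ltW.
  rewrite ge0_integralZl//; last 3 first.
  - by apply/measurable_EFinP/measurable_funTS; exact: measurable_powR.
  - by move=> y _; rewrite lee_fin powR_ge0.
  - by rewrite lee_fin addr_ge0// mulr_ge0.
  by apply: lee_wpmul2l; [rewrite lee_fin addr_ge0// mulr_ge0|exact: integral_powR01].
apply: (@le_lt_trans _ _ 1%E); last exact: ltry.
apply: le_trans (integral_qlin_dens_le1 r0 s0).
rewrite E ge0_integral_setU//; last 3 first.
- by apply/measurable_EFinP/measurable_funTS; exact: measurable_qlin_dens.
- by move=> y; rewrite -E/= in_itv/= andbT => y0; rewrite lee_fin qlin_dens_ge0// ltW.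
- by apply/disj_setPS => y /= []; rewrite !in_itv/= andbT => /andP[_]; rewrite leNgt => /negP.
rewrite -[leLHS]add0e; apply: leeD.
  by apply: integral_ge0 => y /=; rewrite in_itv/= => /andP[y0 _]; rewrite lee_fin qlin_dens_ge0// ltW.
apply: ge0_le_integral => //.
- by move=> y /=; rewrite in_itv/= andbT => y1; rewrite lee_fin stable_density_ge0// (lt_trans _ y1).
- exact: md.
- by apply/measurable_EFinP/measurable_funTS; exact: measurable_qlin_dens.
- move=> y /=; rewrite in_itv/= andbT => y1; rewrite lee_fin ler_piMr//.
    by rewrite qlin_dens_ge0// ltW// (lt_trans _ y1).
  rewrite -(powRr0 y); apply: ler_powR; [exact: ltW|by rewrite oppr_le0].
Qed.

Lemma stable_exponent_gt0 a r s : 0 <= r -> 0 <= s -> 0 < r + s ->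
  (0 < stable_exponent a r s)%E.
Proof.
(* A lower bound of the integrand on [1, 2], an interval of length 1; the maximum covers negative
   [a]. *)
move=> r0 s0 rs0; pose c := (2 * r + s) * expR (- qlin r s 2) * 2 `^ (- Num.max a 0).
have c0 : 0 < c by rewrite !mulr_gt0 ?expR_gt0 ?powR_gt0//; lra.
apply: (@lt_le_trans _ _ (c%:E * mu `[1%R, 2%R]%classic)%E).
  by rewrite lebesgue_measure_itv/= lte_fin ltr1n -EFinB -EFinM lte_fin; lra.
rewrite -integral_cst//.
apply: (@le_trans _ _ (\int[mu]_(y in `[1%R, 2%R]) (qlin_dens r s y * y `^ (- a))%:E)%E).
  apply: ge0_le_integral => //.
  - by move=> y _; rewrite lee_fin ltW.
  - by apply/measurable_EFinP/measurable_funTS; exact: measurable_stable_density.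
  - move=> y /=; rewrite in_itv/= => /andP[y1 y2]; rewrite lee_fin /c.
    have y0 : 0 < y by lra.
    apply: ler_pM; rewrite ?powR_ge0//.
    + by rewrite mulr_ge0 ?expR_ge0//; lra.
    + apply: ler_pM; rewrite ?expR_ge0//; [lra| |].
        by rewrite lerD2r ler_peMr//; lra.
      by rewrite ler_expR lerN2 /qlin lerD// ler_wpM2l// lerXn2r ?nnegrE//; lra.
    + rewrite !powRN lef_pV2 ?posrE ?powR_gt0//.
      apply: (@le_trans _ _ (y `^ Num.max a 0)); first by apply: ler_powR; rewrite // le_max lexx.
      by apply: ge0_ler_powR; rewrite ?nnegrE ?le_max ?lexx ?orbT//; lra.
apply: ge0_subset_integral => //.
- by apply/measurable_EFinP/measurable_funTS; exact: measurable_stable_density.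
- by move=> y /=; rewrite in_itv/= andbT => y0; rewrite lee_fin stable_density_ge0.
- by move=> y /=; rewrite !in_itv/= andbT => /andP[y1 _]; rewrite (lt_le_trans _ y1).
Qed.

Lemma stable_exponent_ge0 a r s : 0 <= r -> 0 <= s -> (0 <= stable_exponent a r s)%E.
Proof.
move=> r0 s0; apply: integral_ge0 => y /=; rewrite in_itv/= andbT => y0.
by rewrite lee_fin stable_density_ge0.
Qed.

Lemma integrable_stable_density a r s : 0 < a < 1 -> 0 <= r -> 0 <= s ->
  mu.-integrable `]0, +oo[ (fun y => (qlin_dens r s y * y `^ (- a))%:E).
Proof.
move=> /andP[a0 a1] r0 s0; apply/integrableP; split.
  by apply/measurable_EFinP/measurable_funTS; exact: measurable_stable_density.
apply: le_lt_trans (stable_exponent_lty (ltW a0) a1 r0 s0).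
apply: ge0_le_integral => //.
- apply: measurableT_comp => //.
  by apply/measurable_EFinP/measurable_funTS; exact: measurable_stable_density.
- by apply/measurable_EFinP/measurable_funTS; exact: measurable_stable_density.
- by move=> y /=; rewrite in_itv/= andbT => y0; rewrite ger0_norm// stable_density_ge0.
Qed.

Lemma stable_exponent_fin_num a r s : 0 < a < 1 -> 0 <= r -> 0 <= s ->
  stable_exponent a r s \is a fin_num.
Proof.
move=> /andP[a0 a1] r0 s0.
by rewrite ge0_fin_numE ?stable_exponent_ge0// stable_exponent_lty// ltW.
Qed.

Lemma stable_exponent00 a : stable_exponent a 0 0 = 0%E.
Proof. by apply: integral0_eq => y _; rewrite /qlin_dens mulr0 mul0r add0r !mul0r. Qed.

End exponent_integral.

(** * Poisson representation and closed forms of the exponent *)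

Section stable_thinning.
Context {R : realType}.
Notation mu := (@lebesgue_measure R).
Variable a : R.
Hypothesis a01 : 0 < a < 1.
Implicit Types (r s c : R).

(* The jumps of the stable subordinator are the images under [jump] of the points
   of a unit Poisson process. *)
Definition jump (y : R) := y `^ (- a^-1).
(** The probability of marking a Poisson point at [y]. The Laplace transform of the jump sums is
    then the probability that no point is marked. *)
Definition thinning r s (y : R) := 1 - expR (- qlin r s (jump y)).

Lemma jump_ge0 y : 0 <= jump y. Proof. exact: powR_ge0. Qed.

Lemma measurable_jump : measurable_fun [set: R] jump.
Proof. exact: measurable_powR. Qed.

Lemma measurable_thinning r s : measurable_fun [set: R] (thinning r s).
Proof.
apply: measurable_funB => //; apply: measurableT_comp => //; apply: measurableT_comp => //.
exact: (measurableT_comp (measurable_qlin r s) measurable_jump).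
Qed.

Lemma thinning01 r s y : 0 <= r -> 0 <= s -> 0 <= thinning r s y <= 1.
Proof.
move=> r0 s0; rewrite subr_ge0 gerBl expR_ge0 expR_le1 oppr_le0 qlin_ge0//.
exact: jump_ge0.
Qed.

Lemma continuous_thinning r s y : 0 < y -> {for y, continuous (thinning r s)}.
Proof.
move=> y0; have c := is_derive_continuous (is_derive1_powR (- a^-1) y0).
apply: cvgB; first exact: cvg_cst.
have K : - qlin r s (jump x) @[x --> y] --> - qlin r s (jump y).
  apply: cvgN; apply: cvgD; apply: cvgMl_tmp; last exact: c.
  by apply: cvgM; exact: c.
exact: (cvg_comp _ _ K (@continuous_expR R _)).
Qed.

(** The times [t] with [y < c * jump t] form an interval of length [c^a y^(-a)]: [jump] carries
    Lebesgue measure to the Levy measure of tail [y^(-a)]. *)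
Let integral_scaled_jump r s c : 0 <= r -> 0 <= s -> 0 < c ->
  (\int[mu]_(t in `]0%R, +oo[) (1 - expR (- qlin r s (c * jump t)))%:E =
   (c `^ a)%:E * stable_exponent a r s)%E.
Proof.
have /andP[a0 a1] := a01; move=> r0 s0 c0.
transitivity (\int[mu]_(t in `]0%R, +oo[) \int[mu]_(y in `]0%R, (c * jump t)%R[) (qlin_dens r s y)%:E)%E.
  by apply: eq_integral => t _; rewrite integral_qlin_dens// mulr_ge0 ?jump_ge0// ltW.
rewrite layer_cake//; last 3 first.
- by apply: measurable_funM => //; exact: measurable_jump.
- exact: measurable_qlin_dens.
- by move=> y y0; rewrite qlin_dens_ge0// ltW.
rewrite -ge0_integralZl//; last 3 first.
- by apply/measurable_EFinP/measurable_funTS; exact: measurable_stable_density.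
- by move=> y /=; rewrite in_itv/= andbT => y0; rewrite lee_fin stable_density_ge0.
- by rewrite lee_fin powR_ge0.
apply: eq_integral => y; rewrite inE/= in_itv/= andbT => y0.
rewrite -EFinM mulrCA [RHS]EFinM; congr mule.
have yc0 : 0 < y / c by rewrite divr_gt0.
have E : c `^ a * y `^ (- a) = (y / c) `^ (- a).
  by rewrite powRM ?invr_ge0 ?(ltW y0) ?(ltW c0)// -[c^-1]powR_inv1 ?(ltW c0)// -powRrM mulrNN mul1r mulrC.
have -> : `]0, +oo[%classic `&` [set t | y < c * jump t] = `]0, (y / c) `^ (- a)[%classic.
  apply/seteqP; split => t /=; rewrite !in_itv/= ?andbT -ltr_pdivrMl// (mulrC c^-1).
    move=> [t0 yt]; rewrite t0/=.
    have : (y / c) `^ a < (jump t) `^ a by rewrite gt0_ltr_powR// nnegrE ?jump_ge0// ltW.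
    rewrite /jump -powRrM mulNr mulVf ?gt_eqF// powR_inv1 ?(ltW t0)// powRN.
    by move=> h; rewrite -[t]invrK ltf_pV2 ?posrE ?invr_gt0 ?powR_gt0.
  move=> /andP[t0 ty]; split=> //.
  have : ((y / c) `^ (- a)) `^ (- a^-1) < t `^ (- a^-1).
    rewrite !(powRN _ a^-1) ltf_pV2 ?posrE ?powR_gt0//.
    by rewrite gt0_ltr_powR ?invr_gt0// ?nnegrE ?powR_ge0// ltW.
  by rewrite -powRrM mulrNN mulfV ?gt_eqF// powRr1// ltW.
by rewrite E lebesgue_measure_itv/= lte_fin powR_gt0// oppr0 adde0.
Qed.

Lemma integral_thinning r s : 0 <= r -> 0 <= s ->
  (\int[mu]_(y in `]0%R, +oo[) (thinning r s y)%:E)%E = stable_exponent a r s.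
Proof.
move=> r0 s0; have := integral_scaled_jump r0 s0 ltr01; rewrite powR1 mul1e => <-.
by apply: eq_integral => t _; rewrite mul1r.
Qed.

(** Dilating all jumps by [c] multiplies the Levy measure by [c^a]. The closed forms below rest on
    this homogeneity, and so does the mixing by powers of [Lambda]. *)
Lemma stable_exponent_scaling r s c : 0 <= r -> 0 <= s -> 0 < c ->
  (stable_exponent a (r * c ^+ 2) (s * c)%R = (c `^ a)%:E * stable_exponent a r s)%E.
Proof.
move=> r0 s0 c0; rewrite -integral_scaled_jump// -integral_thinning.
- apply: eq_integral => t _; congr (1 - expR (- _))%:E.
  by rewrite /qlin; ring.
- by rewrite mulr_ge0// sqr_ge0.
- by rewrite mulr_ge0// ltW.
Qed.

Lemma stable_exponent_0s s : 0 < s ->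
  stable_exponent a 0 s = (s `^ a * Gamma (1 - a))%:E.
Proof.
move=> s0; have -> : stable_exponent a 0 s = stable_exponent a (0 * s ^+ 2) (1 * s).
  by rewrite mul0r mul1r.
rewrite stable_exponent_scaling// EFinM; congr mule.
rewrite -(fineK (stable_exponent_fin_num a01 (lexx 0) ler01)).
congr (fine _)%:E; apply: eq_integral => y _.
by rewrite /qlin_dens /qlin mulr0 !mul0r !add0r !mul1r mulrC (_ : 1 - a - 1 = - a)//; ring.
Qed.

(** Scaling by [q], the square root of [r], reduces to [r = 1]. Completing the square in
    [u^2 + (s / q) u] then produces the shift and the prefactor of [delta]. *)
Lemma delta_stable_exponent r s : 0 < r -> 0 <= s ->
  (delta a r s)%:E = stable_exponent a r s.
Proof.
move=> r0 s0; set q := Num.sqrt r.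
have q0 : 0 < q by rewrite sqrtr_gt0.
have q2 : q ^+ 2 = r by rewrite sqr_sqrtr// ltW.
have sq0 : 0 <= s / q by rewrite divr_ge0// ltW.
have -> : stable_exponent a r s = stable_exponent a (1 * q ^+ 2) (s / q * q).
  by rewrite mul1r q2 divfK// gt_eqF.
rewrite stable_exponent_scaling// -(fineK (stable_exponent_fin_num a01 ler01 sq0)).
rewrite -EFinM; apply: congr1; rewrite /delta -/q.
have K0 : 0 < 2 * expR (s ^+ 2 / (4 * r)) by rewrite mulr_gt0 ?expR_gt0.
set K := 2 * _ in K0 *.
have E u : 0 < u ->
    expR (- (u + s / (2 * q)) ^+ 2) * (u + s / (2 * q)) * (u / q) `^ (- a) =
    q `^ a / K * (qlin_dens 1 (s / q) u * u `^ (- a)).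
  move=> u0; rewrite powRM ?invr_ge0 ?(ltW u0) ?(ltW q0)// -[q^-1 in LHS]powR_inv1 ?(ltW q0)//.
  rewrite -powRrM mulrNN mul1r /qlin_dens /K /qlin.
  have -> : - (u + s / (2 * q)) ^+ 2 = - (1 * u ^+ 2 + s / q * u) - s ^+ 2 / (4 * r).
    by rewrite -q2; field; rewrite gt_eqF.
  rewrite expRD (expRN (_ / _)); field.
  by rewrite !gt_eqF ?expR_gt0.
under eq_Rintegral => u.
  rewrite inE/= in_itv/= andbT => u0; rewrite E//.
  over.
rewrite RintegralZl//; last exact: integrable_stable_density.
by rewrite mulrA mulrCA divff ?mulr1 ?gt_eqF.
Qed.

End stable_thinning.

Section laplace_exponents.
Context {R : realType}.
Notation mu := (@lebesgue_measure R).
Variable a : R.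
Hypothesis a01 : 0 < a < 1.
Implicit Types r s : R.

(* The squares of the jumps of an [a]-stable subordinator are those of an
   [a / 2]-stable one. *)
Lemma stable_exponent_r0 r : 0 < r ->
  stable_exponent a r 0 = (r `^ (a / 2) * Gamma (1 - a / 2))%:E.
Proof.
have /andP[a0 a1] := a01; move=> r0.
have b01 : 0 < a / 2 < 1 by lra.
rewrite -(stable_exponent_0s b01 r0).
rewrite -(integral_thinning a01 (ltW r0) (lexx 0)) -(integral_thinning b01 (lexx 0) (ltW r0)).
apply: eq_integral => y _; congr (1 - expR (- _))%:E.
rewrite /qlin !mul0r addr0 add0r; congr (_ * _).
by rewrite /jump -powR_mulrn ?powR_ge0// -powRrM; congr powR; field; rewrite gt_eqF.
Qed.

(** The joint transform is prescribed for [r > 0]; this limit opens the way to [r = 0]. Thinning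
    grows with [r], so its value at [r = 1] dominates. *)
Lemma cvg_stable_exponent_r0 s : 0 <= s ->
  stable_exponent a n.+1%:R^-1 s @[n --> \oo] --> stable_exponent a 0 s.
Proof.
move=> s0; rewrite -integral_thinning//.
rewrite (_ : (fun n => _) =
    (fun n => \int[mu]_(y in `]0%R, +oo[) (thinning a n.+1%:R^-1 s y)%:E)%E); last first.
  by apply/funext => n; rewrite integral_thinning.
have mt r (D : set R) : measurable_fun D (EFin \o thinning a r s).
  by apply/measurable_EFinP/measurable_funTS; exact: measurable_thinning.
have := @dominated_convergence _ _ _ mu `]0%R, +oo[%classic (measurable_itv _)
  (fun n => EFin \o thinning a n.+1%:R^-1 s) (EFin \o thinning a 0 s)
  (EFin \o thinning a 1 s) (fun n => mt _ _) (mt _ _).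
case => //.
- apply: aeW => y _; apply: cvg_EFin; first exact: nearW.
  apply: cvgB; first exact: cvg_cst.
  apply: continuous_cvg; first exact: continuous_expR.
  apply: cvgN; apply: cvgD; last exact: cvg_cst.
  by apply: cvgMr_tmp; exact: cvg_harmonic.
- apply/integrableP; split; first exact: mt.
  under eq_integral.
    move=> y _; rewrite /= ger0_norm; last by have /andP[] := thinning01 a y ler01 s0.
    over.
  by rewrite integral_thinning// stable_exponent_lty//; have /andP[] := a01; lra.
- apply: aeW => y n _ /=; have n0 : 0 <= n.+1%:R^-1 :> R by [].
  have /andP[t0 _] := thinning01 a y n0 s0.
  rewrite lee_fin ger0_norm// lerD2l lerN2 ler_expR lerN2 lerD2r ler_wpM2r ?sqr_ge0//.
  by rewrite invf_le1 ?ler1n.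
Qed.

End laplace_exponents.

(** * Bernstein approximation on the unit square *)

Section bernstein.
Context {R : realType}.
Implicit Types (x y t : R) (f g : nat -> R).

(** The mean of [f] at the number of successes in [m] independent trials of probability [x],
    obtained by conditioning on the first trial instead of summing binomial terms. *)
Fixpoint bernstein (m : nat) (x : R) (f : nat -> R) : R :=
  if m is m'.+1 then
    x * bernstein m' x (fun i => f i.+1) + (1 - x) * bernstein m' x f
  else f 0%N.

Lemma eq_bernstein m x f g : f =1 g -> bernstein m x f = bernstein m x g.
Proof. by elim: m f g => [|m IH] f g fg //=; rewrite (IH f g fg) (IH _ _ (fun i => fg i.+1)). Qed.

Lemma bernstein_cst m x t : bernstein m x (fun=> t) = t.
Proof. by elim: m => //= m ->; ring. Qed.

Lemma bernsteinD m x f g :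
  bernstein m x (fun i => f i + g i) = bernstein m x f + bernstein m x g.
Proof. by elim: m f g => //= m IH f g; rewrite !IH; ring. Qed.

Lemma bernsteinZ m x t f : bernstein m x (fun i => t * f i) = t * bernstein m x f.
Proof. by elim: m f => //= m IH f; rewrite !IH; ring. Qed.

Lemma le_bernstein m x f g : 0 <= x <= 1 -> (forall i, f i <= g i) ->
  bernstein m x f <= bernstein m x g.
Proof.
move=> /andP[x0 x1]; elim: m f g => [|m IH] f g fg /=; first exact: fg.
by rewrite lerD// ler_wpM2l ?subr_ge0// IH.
Qed.

(** The offset [t] makes the induction close: a success in the first trial raises it by one. *)
Lemma bernstein_variance m x t :
  bernstein m x (fun i => (i%:R + t) ^+ 2) = (m%:R * x + t) ^+ 2 + m%:R * (x * (1 - x)).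
Proof.
elim: m t => [|m IH] t /=; first by rewrite !mul0r addr0.
rewrite IH (@eq_bernstein m x _ (fun i => (i%:R + (t + 1)) ^+ 2)); last first.
  by move=> i; rewrite -natr1; ring.
by rewrite IH -natr1; ring.
Qed.

(** From [|u| <= e + u^2 / e] and the variance [x (1 - x) / m] of the frequency of successes. *)
Lemma bernstein_dist m x (e : R) : (0 < m)%N -> 0 <= x <= 1 -> 0 < e ->
  bernstein m x (fun i => `|i%:R / m%:R - x|) <= e + (e * m%:R)^-1.
Proof.
move=> m0 x01 e0; have mR : 0 < (m%:R : R) by rewrite ltr0n.
apply: (@le_trans _ _ (bernstein m x (fun i => e + (e^-1 / m%:R ^+ 2) * (i%:R + - (m%:R * x)) ^+ 2))).
  apply: le_bernstein => // i; set u := _ / _ - _.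
  have -> : e^-1 / m%:R ^+ 2 * (i%:R - m%:R * x) ^+ 2 = u ^+ 2 / e.
    by rewrite /u; field; rewrite !gt_eqF.
  rewrite -(ler_pM2r e0) mulrDl divfK ?gt_eqF// -(real_normK (num_real u)).
  move: (normr_ge0 u); set v := `|u| => v0.
  have := sqr_ge0 (v - e); have := mulr_ge0 v0 (ltW e0).
  have -> : (v - e) ^+ 2 = v ^+ 2 - 2 * (v * e) + e * e by ring.
  lra.
rewrite bernsteinD bernstein_cst bernsteinZ bernstein_variance lerD2l.
rewrite subrr expr0n/= add0r [leRHS]invfM.
have -> : e^-1 / m%:R ^+ 2 * (m%:R * (x * (1 - x))) = (e^-1 / m%:R) * (x * (1 - x)).
  by field; rewrite !gt_eqF.
rewrite ler_piMr//; first by rewrite divr_ge0 ?invr_ge0// ltW.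
by move: x01 => /andP[x0 x1]; rewrite mulr_ile1// ?subr_ge0// lerBlDr lerDl.
Qed.

Definition poly2 (p : R -> R -> R) := exists s : seq (R * nat * nat),
  forall x y, p x y = \sum_(t <- s) t.1.1 * (x ^+ t.1.2 * y ^+ t.2).

Lemma poly2_cst t : poly2 (fun _ _ => t).
Proof.
by exists [:: (t, 0%N, 0%N)] => x y; rewrite big_seq1/= !expr0 !mulr1.
Qed.

Lemma poly2D p q : poly2 p -> poly2 q -> poly2 (fun x y => p x y + q x y).
Proof. by move=> [s sE] [s' s'E]; exists (s ++ s') => x y; rewrite big_cat/= sE s'E. Qed.

Lemma poly2Z t p : poly2 p -> poly2 (fun x y => t * p x y).
Proof.
move=> [s sE]; exists [seq (t * u.1.1, u.1.2, u.2) | u <- s] => x y.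
by rewrite big_map sE mulr_sumr; apply: eq_bigr => u _ /=; rewrite mulrA.
Qed.

Lemma poly2Ml p : poly2 p -> poly2 (fun x y => x * p x y).
Proof.
move=> [s sE]; exists [seq (u.1.1, u.1.2.+1, u.2) | u <- s] => x y.
by rewrite big_map sE mulr_sumr; apply: eq_bigr => u _ /=; rewrite exprS; ring.
Qed.

Lemma poly2Mr p : poly2 p -> poly2 (fun x y => y * p x y).
Proof.
move=> [s sE]; exists [seq (u.1.1, u.1.2, u.2.+1) | u <- s] => x y.
by rewrite big_map sE mulr_sumr; apply: eq_bigr => u _ /=; rewrite exprS; ring.
Qed.

Lemma eq_poly2 p q : (forall x y, p x y = q x y) -> poly2 p -> poly2 q.
Proof. by move=> pq [s sE]; exists s => x y; rewrite -pq. Qed.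

Lemma poly2_bernsteinr m (f : nat -> R) : poly2 (fun _ y => bernstein m y f).
Proof.
elim: m f => [|m IH] f /=; first exact: poly2_cst.
apply: (eq_poly2 (p := fun x y => y * bernstein m y (fun i => f i.+1) +
    (bernstein m y f + (-1) * (y * bernstein m y f)))); first by move=> x y; ring.
by do ?[apply: poly2D|apply: poly2Mr|apply: poly2Z].
Qed.

Lemma poly2_bernsteinl m (f : nat -> R -> R) :
  (forall i, poly2 (fun _ y => f i y)) -> poly2 (fun x y => bernstein m x (f^~ y)).
Proof.
elim: m f => [|m IH] f pf /=; first exact: pf.
apply: (eq_poly2 (p := fun x y => x * bernstein m x (fun i => f i.+1 y) +
    (bernstein m x (f^~ y) + (-1) * (x * bernstein m x (f^~ y))))); first by move=> x y; ring.
have h1 := IH _ (fun i => pf i.+1); have h2 := IH _ pf.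
by do ?[apply: poly2D|apply: poly2Ml|apply: poly2Z].
Qed.

Lemma lipschitz_poly2_approx (F : R -> R -> R) (L e : R) : 0 <= L ->
  (forall x y x' y', `|F x y - F x' y'| <= L * (`|x - x'| + `|y - y'|)) ->
  0 < e ->
  exists2 p, poly2 p & forall x y, 0 <= x <= 1 -> 0 <= y <= 1 -> `|p x y - F x y| <= e.
Proof.
move=> L0 LF e0.
(* Each coordinate costs [L (a + 1 / (a m))]. Taking [m] beyond [1 / a^2] makes this at most
   [2 a L], and [4 a L <= e]; the [+ 1] allows [L = 0]. *)
pose a := e / (4 * (L + 1)).
have a0 : 0 < a by rewrite divr_gt0// mulr_gt0//; lra.
pose m := (Num.truncn (a ^- 2)).+1.
have mR : 0 < (m%:R : R) by rewrite ltr0n.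
have ma : (a * m%:R)^-1 <= a.
  have am0 : 0 < a * m%:R by rewrite mulr_gt0.
  rewrite -(ler_pM2l am0) divff ?gt_eqF//.
  have := truncnS_gt (a ^- 2); rewrite -/m -(ltr_pM2l (exprn_gt0 2 a0)).
  by rewrite divff ?gt_eqF ?exprn_gt0// expr2 => /ltW; rewrite mulrAC.
exists (fun x y => bernstein m x (fun i => bernstein m y (fun j => F (i%:R / m%:R) (j%:R / m%:R)))).
  by apply: poly2_bernsteinl => i; exact: poly2_bernsteinr.
move=> x y x01 y01.
have bx := bernstein_dist (ltn0Sn _ : (0 < m)%N) x01 a0.
have b_y := bernstein_dist (ltn0Sn _ : (0 < m)%N) y01 a0.
have normb k z f : 0 <= z <= 1 -> `|bernstein k z f| <= bernstein k z (fun i => `|f i|).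
  move=> z01; rewrite ler_norml; apply/andP; split; last first.
    by apply: le_bernstein => // i; exact: ler_norm.
  rewrite -mulN1r -bernsteinZ; apply: le_bernstein => // i.
  by rewrite mulN1r lerNl -normrN ler_norm.
have -> : bernstein m x (fun i => bernstein m y (fun j => F (i%:R / m%:R) (j%:R / m%:R))) - F x y =
    bernstein m x (fun i => bernstein m y (fun j => F (i%:R / m%:R) (j%:R / m%:R) + (- F x y))).
  rewrite [RHS](@eq_bernstein m x _ (fun i => bernstein m y (fun j => F (i%:R / m%:R) (j%:R / m%:R)) + - F x y)).
    by rewrite bernsteinD bernstein_cst.
  by move=> i; rewrite bernsteinD bernstein_cst.
apply: (le_trans (normb _ _ _ x01)).
apply: (@le_trans _ _ (bernstein m x (fun i => L * `|i%:R / m%:R - x| + L * (2 * a)))).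
  apply: le_bernstein => // i; apply: (le_trans (normb _ _ _ y01)).
  apply: (@le_trans _ _ (bernstein m y (fun j => L * `|i%:R / m%:R - x| + L * `|j%:R / m%:R - y|))).
    by apply: le_bernstein => // j; rewrite -mulrDr; exact: LF.
  rewrite bernsteinD bernstein_cst bernsteinZ lerD2l ler_wpM2l// (le_trans b_y)//.
  by lra.
rewrite bernsteinD bernstein_cst bernsteinZ.
have : L * bernstein m x (fun i => `|i%:R / m%:R - x|) <= L * (2 * a).
  by rewrite ler_wpM2l// (le_trans bx)//; lra.
have : L * (4 * a) <= e.
  rewrite /a (_ : L * (4 * _) = e * (L / (L + 1))); last by field; rewrite gt_eqF//; lra.
  by rewrite ler_piMr ?(ltW e0)// ler_pdivrMr; lra.
lra.
Qed.

End bernstein.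

Lemma norm_expRN_le1 (R : realType) (x : R) : 0 <= x -> `|expR (- x)| <= 1.
Proof. by move=> x0; rewrite ger0_norm ?expR_ge0// expR_le1 oppr_le0. Qed.

(** * Expectations of bounded variables *)

Section bounded_expectation.
Context {R : realType} d (T : measurableType d) (P : probability T R).
Implicit Types (f g : T -> R).

Lemma bounded_integrable f (M : R) : measurable_fun setT f ->
  (forall w, `|f w| <= M) -> P.-integrable setT (EFin \o f).
Proof.
move=> mf fM; apply: measurable_bounded_integrable => //.
  by rewrite /= probability_setT ltry.
exists M; split; first exact: num_real.
by move=> x Mx w _ /=; apply: le_trans (fM w) _; exact: ltW.
Qed.

Lemma Rintegral_sum_seq (I : Type) (s : seq I) (f : I -> T -> R) :
  (forall i, P.-integrable setT (EFin \o f i)) ->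
  P.-integrable setT (EFin \o (fun w => \sum_(i <- s) f i w)) /\
  \int[P]_w (\sum_(i <- s) f i w) = \sum_(i <- s) \int[P]_w f i w.
Proof.
move=> intf; elim: s => [|i s [IH1 IH2]].
  split; last first.
    under eq_Rintegral do rewrite big_nil.
    by rewrite big_nil Rintegral_cst// mul0r.
  rewrite (_ : _ \o _ = cst 0%E); first exact: integrable0.
  by apply/funext => w /=; rewrite big_nil.
split.
  rewrite (_ : _ \o _ = ((EFin \o f i) \+ (EFin \o (fun w => \sum_(j <- s) f j w)%R))%E).
    exact: integrableD.
  by apply/funext => w /=; rewrite big_cons.
under eq_Rintegral do rewrite big_cons.
by rewrite RintegralD// IH2 big_cons.
Qed.

Lemma Rintegral_dist_le f g (e : R) : measurable_fun setT f -> measurable_fun setT g ->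
  P.-integrable setT (EFin \o f) -> P.-integrable setT (EFin \o g) ->
  (forall w, `|f w - g w| <= e) -> `|\int[P]_w f w - \int[P]_w g w| <= e.
Proof.
move=> mf mg intf intg fg; rewrite -RintegralB//.
have intfg : P.-integrable setT (EFin \o (fun w => f w - g w)).
  by apply: (bounded_integrable (M := e)) => //; exact: measurable_funB.
apply: le_trans (le_normr_Rintegral _ intfg) _ => //.
have -> : e = \int[P]_w (cst e w).
  by rewrite Rintegral_cst//= probability_setT mulr1.
apply: le_Rintegral => //.
  apply: (bounded_integrable (M := e)) => //.
    by apply: measurableT_comp => //; exact: measurable_funB.
  by move=> w; rewrite normr_id.
by apply: (bounded_integrable (M := `|e|)).
Qed.

Lemma cvg_Rintegral_bounded (f_ : nat -> T -> R) f (M : R) :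
  (forall n, measurable_fun setT (f_ n)) -> measurable_fun setT f ->
  (forall n w, `|f_ n w| <= M) ->
  {ae P, forall w, f_ n w @[n --> \oo] --> f w} ->
  \int[P]_w f_ n w @[n --> \oo] --> \int[P]_w f w.
Proof.
move=> mf_ mf fM ff.
have [] := @dominated_convergence _ T R P setT measurableT (fun n => EFin \o f_ n)
  (EFin \o f) (EFin \o cst M).
- by move=> n; exact/measurable_EFinP.
- exact/measurable_EFinP.
- by apply: filterS ff => w fw _; apply: cvg_EFin => //; exact: nearW.
- exact: finite_measure_integrable_cst.
- by apply: aeW => w n _; rewrite /= lee_fin.
move=> intf _ H; apply: fine_cvg.
by rewrite fineK//; exact: integrable_fin_num.
Qed.

Lemma probability_indic (A : set T) : measurable A -> fine (P A) = \int[P]_w \1_A w.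
Proof. by move=> mA; rewrite /Rintegral integral_indic// setIT. Qed.

Lemma indic_integrable (A : set T) : measurable A -> P.-integrable setT (EFin \o \1_A).
Proof.
move=> mA; apply: (bounded_integrable (M := 1)); first exact: measurable_indic.
by move=> w; rewrite ger0_norm// indicE; case: (_ \in _).
Qed.

End bounded_expectation.

Lemma Rintegral_cst1 (R : realType) d (T : measurableType d) (P : probability T R) :
  \int[P]_w cst (1 : R) w = 1.
Proof. by rewrite Rintegral_cst//= probability_setT mulr1. Qed.

(** * Convergence from joint moments *)

Section joint_laplace_continuity.
Context {R : realType} d (T : measurableType d) (P : probability T R).
Context d' (T' : measurableType d') (P' : probability T' R).
Variables (A B : nat -> T -> R) (A' B' : T' -> R).
Hypothesis mA : forall n, measurable_fun setT (A n).
Hypothesis mB : forall n, measurable_fun setT (B n).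
Hypothesis mA' : measurable_fun setT A'.
Hypothesis mB' : measurable_fun setT B'.
Hypothesis A01 : forall n w, 0 <= A n w <= 1.
Hypothesis B01 : forall n w, 0 <= B n w <= 1.
Hypothesis A'01 : forall w, 0 <= A' w <= 1.
Hypothesis B'01 : forall w, 0 <= B' w <= 1.
Hypothesis cvg_moments : forall i j : nat,
  \int[P]_w (A n w ^+ i * B n w ^+ j) @[n --> \oo] -->
  \int[P']_w (A' w ^+ i * B' w ^+ j).

Let moments_integrable d0 (T0 : measurableType d0) (P0 : probability T0 R)
    (a b : T0 -> R) i j : measurable_fun setT a -> measurable_fun setT b ->
  (forall w, 0 <= a w <= 1) -> (forall w, 0 <= b w <= 1) ->
  P0.-integrable setT (EFin \o (fun w => a w ^+ i * b w ^+ j)).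
Proof.
move=> ma mb a01 b01; apply: (@bounded_integrable _ _ _ P0 _ 1).
  by apply: measurable_funM; exact: measurable_funX.
move=> w; have /andP[a0 a1] := a01 w; have /andP[b0 b1] := b01 w.
rewrite ger0_norm; last by rewrite mulr_ge0 ?exprn_ge0.
by rewrite mulr_ile1 ?exprn_ge0 ?exprn_ile1.
Qed.

Let poly2_integral d0 (T0 : measurableType d0) (P0 : probability T0 R)
    (a b : T0 -> R) s : measurable_fun setT a -> measurable_fun setT b ->
  (forall w, 0 <= a w <= 1) -> (forall w, 0 <= b w <= 1) ->
  P0.-integrable setT (EFin \o (fun w => \sum_(t <- s) t.1.1 * (a w ^+ t.1.2 * b w ^+ t.2))) /\
  \int[P0]_w (\sum_(t <- s) t.1.1 * (a w ^+ t.1.2 * b w ^+ t.2)) =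
  \sum_(t <- s) t.1.1 * \int[P0]_w (a w ^+ t.1.2 * b w ^+ t.2).
Proof.
move=> ma mb a01 b01.
have [|h1 h2] := @Rintegral_sum_seq _ _ _ P0 _ s (fun (t : R * nat * nat) w => t.1.1 * (a w ^+ t.1.2 * b w ^+ t.2)).
  move=> t; have := integrableZl measurableT t.1.1 (moments_integrable P0 t.1.2 t.2 ma mb a01 b01).
  by apply: eq_integrable => // w _.
split => //; rewrite h2; apply: eq_bigr => t _; rewrite RintegralZl//.
exact: moments_integrable.
Qed.

Let cvg_poly2 p : poly2 p ->
  \int[P]_w (p (A n w) (B n w)) @[n --> \oo] --> \int[P']_w (p (A' w) (B' w)).
Proof.
move=> [s sE].
have -> : (fun n => \int[P]_w (p (A n w) (B n w))) =
    (fun n => \sum_(t <- s) t.1.1 * \int[P]_w (A n w ^+ t.1.2 * B n w ^+ t.2)).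
  apply/funext => n; rewrite -(poly2_integral P s (mA n) (mB n) (A01 n) (B01 n)).2.
  by apply: eq_Rintegral => w _; rewrite sE.
have -> : \int[P']_w (p (A' w) (B' w)) =
    \sum_(t <- s) t.1.1 * \int[P']_w (A' w ^+ t.1.2 * B' w ^+ t.2).
  rewrite -(poly2_integral P' s mA' mB' A'01 B'01).2.
  by apply: eq_Rintegral => w _; rewrite sE.
elim: s {sE} => [|t s IH].
  under eq_fun do rewrite big_nil.
  by rewrite big_nil; exact: cvg_cst.
under eq_fun do rewrite big_cons.
by rewrite big_cons; apply: cvgD => //; apply: cvgMl_tmp; exact: cvg_moments.
Qed.

(** Applied to [exp (- U)] and [exp (- V)], whose joint moments are the Laplace transform at integer
    points. Convergence holds for polynomials by linearity and passes to Lipschitz functions by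
    uniform approximation. *)
Lemma cvg_lipschitz_expectation (F : R -> R -> R) (L M : R) : 0 <= L ->
  (forall x y x' y', `|F x y - F x' y'| <= L * (`|x - x'| + `|y - y'|)) ->
  (forall x y, `|F x y| <= M) ->
  (forall n, measurable_fun setT (fun w => F (A n w) (B n w))) ->
  measurable_fun setT (fun w => F (A' w) (B' w)) ->
  \int[P]_w (F (A n w) (B n w)) @[n --> \oo] --> \int[P']_w (F (A' w) (B' w)).
Proof.
move=> L0 LF FM mF mF'; apply/cvgrPdist_le => e e0.
have e3 : 0 < e / 3 by rewrite divr_gt0.
have [p pp pF] := lipschitz_poly2_approx L0 LF e3.
have /cvgrPdist_le/(_ _ e3) H := cvg_poly2 pp.
have close d0 (T0 : measurableType d0) (P0 : probability T0 R) (a b : T0 -> R) :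
    measurable_fun setT a -> measurable_fun setT b ->
    (forall w, 0 <= a w <= 1) -> (forall w, 0 <= b w <= 1) ->
    measurable_fun setT (fun w => F (a w) (b w)) ->
    `|\int[P0]_w (p (a w) (b w)) - \int[P0]_w (F (a w) (b w))| <= e / 3.
  move=> ma mb a01 b01 mFab; have [s sE] := pp.
  have [ip _] := poly2_integral P0 s ma mb a01 b01.
  have ip' : P0.-integrable setT (EFin \o (fun w => p (a w) (b w))).
    by apply: eq_integrable ip => // w _ /=; rewrite sE.
  apply: Rintegral_dist_le => //.
  - exact/measurable_EFinP/(measurable_int P0).
  - by apply: (@bounded_integrable _ _ _ P0 _ M).
  - by move=> w; exact: pF.
near=> n.
have h1 := close _ _ P _ _ (mA n) (mB n) (A01 n) (B01 n) (mF n).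
have h2 := close _ _ P' _ _ mA' mB' A'01 B'01 mF'.
have h3 : `|\int[P']_w p (A' w) (B' w) - \int[P]_w p (A n w) (B n w)| <= e / 3.
  by near: n.
move: h1 h2 h3; set x := \int[P]_w p _ _; set y := \int[P']_w p _ _.
set x' := \int[P]_w F _ _; set y' := \int[P']_w F _ _.
by rewrite !ler_norml; lra.
Unshelve. all: by end_near.
Qed.

End joint_laplace_continuity.

(** * Lipschitz approximations of the region u <= c v^2 *)

Section quadratic_boundary.
Context {R : realType}.
Implicit Types (K x y z : R).

Definition clamp01 z : R := Num.max 0 (Num.min z 1).

Lemma clamp01_ge0 z : 0 <= clamp01 z. Proof. by rewrite le_max lexx. Qed.

Lemma clamp01_le1 z : clamp01 z <= 1.
Proof. by rewrite ge_max ler01 ge_min lexx orbT. Qed.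

Lemma clamp01_eq0 z : z <= 0 -> clamp01 z = 0.
Proof. by move=> z0; rewrite /clamp01 max_l// ge_min z0. Qed.

Lemma clamp01_eq1 z : 1 <= z -> clamp01 z = 1.
Proof. by move=> z1; rewrite /clamp01 min_r// max_r. Qed.

Lemma clamp01_lipschitz x y : `|clamp01 x - clamp01 y| <= `|x - y|.
Proof.
wlog xy : x y / x <= y.
  move=> H; case: (leP x y) => [/H//|/ltW/H].
  by rewrite distrC (distrC y x).
have cE z : clamp01 z = (if z <= 0 then 0 else if 1 <= z then 1 else z).
  case: ifPn => [/clamp01_eq0//|]; rewrite -ltNge => z0.
  case: ifPn => [/clamp01_eq1//|]; rewrite -ltNge => z1.
  by rewrite /clamp01 min_l ?max_r// ltW.
rewrite distrC (distrC x y) (ger0_norm (_ : 0 <= y - x)) ?subr_ge0// !cE.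
by do !case: ifPn => //; rewrite ?leNgt ?negbK => *; rewrite ger0_norm; lra.
Qed.

(** The inverse of [u -> exp (- u)], capped at [K]. The cap keeps the logarithm away from 0, which
    makes the function Lipschitz on the whole line with constant [exp K]. *)
Definition trunclog K x : R := - ln (Num.max (Num.min x 1) (expR (- K))).

Lemma trunclog_expR K x : 0 <= x -> trunclog K (expR (- x)) = Num.min x K.
Proof.
move=> x0; rewrite /trunclog (min_l (_ : expR (- x) <= 1)) ?expR_le1 ?oppr_le0//; case: (leP x K) => xK.
  by rewrite max_l ?expRK ?opprK// ler_expR lerN2.
by rewrite max_r ?expRK ?opprK// ler_expR lerN2 ltW.
Qed.

Lemma trunclog_le K x : trunclog K x <= K.
Proof.
rewrite lerNl -[leLHS]expRK ler_ln ?posrE ?expR_gt0// ?le_max ?lexx ?orbT//.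
by rewrite lt_max expR_gt0 orbT.
Qed.

Lemma trunclog_ge0 K x : 0 <= K -> 0 <= trunclog K x.
Proof.
by move=> K0; rewrite oppr_ge0 ln_le0// ge_max ge_min lexx orbT expR_le1 oppr_le0.
Qed.

Lemma trunclog_lipschitz K x y : `|trunclog K x - trunclog K y| <= expR K * `|x - y|.
Proof.
wlog xy : x y / x <= y.
  move=> H; case: (leP x y) => [/H//|/ltW/H].
  by rewrite distrC (distrC y x).
rewrite distrC (distrC x y) (ger0_norm (_ : 0 <= y - x)) ?subr_ge0//.
rewrite distrC /trunclog opprK addrC.
set a := Num.max (Num.min x 1) _; set b := Num.max (Num.min y 1) _.
have m1 : Num.min x 1 <= Num.min y 1 by rewrite le_min !ge_min xy lexx orbT.
have m2 : Num.min y 1 - Num.min x 1 <= y - x.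
  by case: (leP x 1) => h1; case: (leP y 1) => h2; lra.
have a0 : 0 < a by rewrite lt_max expR_gt0 orbT.
have b0 : 0 < b by rewrite lt_max expR_gt0 orbT.
have ab : a <= b by rewrite /a /b ge_max !le_max m1 lexx orbT.
have ba : b - a <= y - x.
  move: m1 m2; rewrite /a /b; move: (Num.min x 1) (Num.min y 1) => x1 y1 m1 m2.
  by case: (leP x1 (expR (- K))) => h1; case: (leP y1 (expR (- K))) => h2; lra.
have aK : a^-1 <= expR K.
  by rewrite invf_ple ?posrE ?expR_gt0// -expRN le_max lexx orbT.
rewrite ger0_norm; last by rewrite subr_ge0 ler_ln.
rewrite -ln_div ?posrE//.
have -> : b / a = 1 + (b - a) / a by field; rewrite gt_eqF.
apply: (@le_trans _ _ ((b - a) / a)).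
  apply: le_ln1Dx; apply: (@lt_le_trans _ _ 0); first by rewrite ltrN10.
  by rewrite divr_ge0 ?subr_ge0// ltW.
by rewrite mulrC; apply: ler_pM => //; rewrite ?subr_ge0// ?invr_ge0 ltW.
Qed.

Lemma measurable_trunclog K : measurable_fun setT (trunclog K).
Proof.
apply: measurableT_comp => //; apply: measurableT_comp; first exact: measurable_ln.
by apply: measurable_maxr => //; exact: measurable_minr.
Qed.

(** With [u = - ln x] and [v = - ln y], a ramp of width [e] along the curve [u = c v^2]: outside the
    region for [b = e], inside for [b = 0]. The cap [c K^2 + 1] is at least [c v^2 + e] for [v <= K]
    and [e <= 1], so capping [u] cannot bring an outer point back into the region. *)
Definition smooth_boundary (c K e b x y : R) : R :=
  clamp01 ((b + c * trunclog K y ^+ 2 - trunclog (c * K ^+ 2 + 1) x) / e).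

Lemma measurable_smooth_boundary d (T : measurableType d) (f g : T -> R) c K e b :
  measurable_fun setT f -> measurable_fun setT g ->
  measurable_fun setT (fun w => smooth_boundary c K e b (f w) (g w)).
Proof.
move=> mf mg; apply: measurable_maxr => //; apply: measurable_minr => //.
apply: measurable_funM => //; apply: measurable_funB.
  apply: measurable_funD => //; apply: measurable_funM => //; apply: measurable_funX.
  exact: (measurableT_comp (measurable_trunclog K) mg).
exact: (measurableT_comp (measurable_trunclog _) mf).
Qed.

Lemma smooth_boundary_ge0 c K e b x y : 0 <= smooth_boundary c K e b x y.
Proof. exact: clamp01_ge0. Qed.

Lemma smooth_boundary_le1 c K e b x y : smooth_boundary c K e b x y <= 1.
Proof. exact: clamp01_le1. Qed.

Lemma smooth_boundary_lipschitz c K e b x y x' y' : 0 <= c -> 0 <= K -> 0 < e ->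
  `|smooth_boundary c K e b x y - smooth_boundary c K e b x' y'| <=
  (expR (c * K ^+ 2 + 1) + c * (2 * K) * expR K) / e * (`|x - x'| + `|y - y'|).
Proof.
move=> c0 K0 e0; apply: le_trans (clamp01_lipschitz _ _) _.
rewrite -mulrBl normrM (ger0_norm (_ : 0 <= e^-1)) ?invr_ge0 ?(ltW e0)//.
rewrite [leRHS]mulrAC ler_pM2r ?invr_gt0//.
set X := trunclog _ x; set X' := trunclog _ x'; set Y := trunclog _ y; set Y' := trunclog _ y'.
have hX : `|X - X'| <= expR (c * K ^+ 2 + 1) * `|x - x'| by exact: trunclog_lipschitz.
have hY : `|Y - Y'| <= expR K * `|y - y'| by exact: trunclog_lipschitz.
have hYY : `|c * Y ^+ 2 - c * Y' ^+ 2| <= c * (2 * K) * (expR K * `|y - y'|).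
  rewrite -mulrBr subr_sqr normrM (ger0_norm c0) -mulrA ler_wpM2l// normrM.
  rewrite mulrC ler_pM// (ger0_norm (_ : 0 <= Y + Y')) ?addr_ge0 ?trunclog_ge0//.
  by have := trunclog_le K y; have := trunclog_le K y'; rewrite -/Y -/Y'; lra.
have -> : b + c * Y ^+ 2 - X - (b + c * Y' ^+ 2 - X') = (c * Y ^+ 2 - c * Y' ^+ 2) - (X - X') by ring.
apply: (le_trans (ler_normB _ _)).
apply: (le_trans (lerD hYY hX)).
have h1 := mulr_ge0 (expR_ge0 (c * K ^+ 2 + 1)) (normr_ge0 (y - y')).
have h2 : 0 <= c * (2 * K) * expR K * `|x - x'| by rewrite !mulr_ge0 ?expR_ge0.
by rewrite mulrDl !mulrDr; lra.
Qed.

Lemma smooth_boundary1 c K e u v : 0 <= c -> 0 <= K -> 0 < e -> 0 <= u -> 0 <= v <= K ->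
  u <= c * v ^+ 2 -> smooth_boundary c K e e (expR (- u)) (expR (- v)) = 1.
Proof.
move=> c0 K0 e0 u0 /andP[v0 vK] uv; apply: clamp01_eq1.
rewrite !trunclog_expR// ler_pdivlMr// mul1r -addrA lerDl subr_ge0.
by rewrite (min_l vK) ge_min uv.
Qed.

Lemma smooth_boundary_le c K e u v : 0 <= c -> 0 <= K -> 0 < e <= 1 -> 0 <= u -> 0 <= v ->
  c * v ^+ 2 + e < u -> smooth_boundary c K e e (expR (- u)) (expR (- v)) = 0.
Proof.
move=> c0 K0 /andP[e0 e1] u0 v0 uv; apply: clamp01_eq0.
rewrite !trunclog_expR// ler_pdivrMr// mul0r subr_le0 le_min.
have h : Num.min v K ^+ 2 <= v ^+ 2 by rewrite lerXn2r ?nnegrE ?le_min ?v0// ge_min lexx.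
have h' : Num.min v K ^+ 2 <= K ^+ 2 by rewrite lerXn2r ?nnegrE ?le_min ?v0// ge_min lexx orbT.
have := ler_wpM2l c0 h; have := ler_wpM2l c0 h'; lra.
Qed.

Lemma smooth_boundary0 c K e u v : 0 <= c -> 0 <= K -> 0 < e -> 0 <= u -> 0 <= v ->
  c * v ^+ 2 < u -> smooth_boundary c K e 0 (expR (- u)) (expR (- v)) = 0.
Proof.
move=> c0 K0 e0 u0 v0 uv; apply: clamp01_eq0.
rewrite !trunclog_expR// ler_pdivrMr// mul0r add0r subr_le0 le_min.
have h : Num.min v K ^+ 2 <= v ^+ 2 by rewrite lerXn2r ?nnegrE ?le_min ?v0// ge_min lexx.
have h' : Num.min v K ^+ 2 <= K ^+ 2 by rewrite lerXn2r ?nnegrE ?le_min ?v0// ge_min lexx orbT.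
have := ler_wpM2l c0 h; have := ler_wpM2l c0 h'; lra.
Qed.

Lemma smooth_boundary_ge c K e u v : 0 <= c -> 0 <= K -> 0 < e -> 0 <= u -> 0 <= v <= K ->
  u + e <= c * v ^+ 2 -> smooth_boundary c K e 0 (expR (- u)) (expR (- v)) = 1.
Proof.
move=> c0 K0 e0 u0 /andP[v0 vK] uv; apply: clamp01_eq1.
rewrite !trunclog_expR// ler_pdivlMr// mul1r add0r (min_l vK) lerBrDr addrC.
by apply: le_trans uv; rewrite lerD2r ge_min lexx.
Qed.

End quadratic_boundary.

(** * Convergence of the probability of u <= c v^2 *)

Section ratio_limit.
Context {R : realType} d (T : measurableType d) (P : probability T R).
Context d' (T' : measurableType d') (P' : probability T' R).
Variables (U V : nat -> T -> R) (U' V' : T' -> R).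
Hypothesis mU : forall n, measurable_fun setT (U n).
Hypothesis mV : forall n, measurable_fun setT (V n).
Hypothesis mU' : measurable_fun setT U'.
Hypothesis mV' : measurable_fun setT V'.
Hypothesis U0 : forall n w, 0 <= U n w.
Hypothesis V0 : forall n w, 0 <= V n w.
Hypothesis U'0 : forall w, 0 <= U' w.
Hypothesis V'0 : forall w, 0 <= V' w.
Hypothesis cvg_laplace : forall r s : R, 0 <= r -> 0 <= s ->
  \int[P]_w (expR (- (r * U n w + s * V n w))) @[n --> \oo] -->
  \int[P']_w (expR (- (r * U' w + s * V' w))).

Let mexp d0 (T0 : measurableType d0) (f : T0 -> R) : measurable_fun setT f ->
  measurable_fun setT (fun w => expR (- f w)).
Proof. by move=> mf; do 2 apply: measurableT_comp => //. Qed.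

Let exp01 d0 (T0 : measurableType d0) (f : T0 -> R) w : (forall w, 0 <= f w) ->
  0 <= expR (- f w) <= 1.
Proof. by move=> f0; rewrite expR_ge0 expR_le1 oppr_le0 f0. Qed.

Let cvg_smooth_boundary c K e b : 0 <= c -> 0 <= K -> 0 < e ->
  \int[P]_w (smooth_boundary c K e b (expR (- U n w)) (expR (- V n w))) @[n --> \oo] -->
  \int[P']_w (smooth_boundary c K e b (expR (- U' w)) (expR (- V' w))).
Proof.
move=> c0 K0 e0.
have expE (u v : R) i j : expR (- u) ^+ i * expR (- v) ^+ j = expR (- (i%:R * u + j%:R * v)).
  by rewrite -!expRM_natl -expRD; congr expR; ring.
apply: (@cvg_lipschitz_expectation _ _ _ P _ _ P' (fun n w => expR (- U n w)) (fun n w => expR (- V n w))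
  (fun w => expR (- U' w)) (fun w => expR (- V' w)) _ _ _ _ _ _ _ _ _ (smooth_boundary c K e b)
  ((expR (c * K ^+ 2 + 1) + c * (2 * K) * expR K) / e) 1).
1-2: by move=> n; exact: mexp.
1-2: exact: mexp.
1-4: by move=> *; exact: exp01.
- move=> i j.
  have := cvg_laplace (ler0n R i) (ler0n R j).
  have -> : \int[P']_w (expR (- U' w) ^+ i * expR (- V' w) ^+ j) =
    \int[P']_w expR (- (i%:R * U' w + j%:R * V' w)).
    by apply: eq_Rintegral => w _; exact: expE.
  have -> // : (fun n => \int[P]_w (expR (- U n w) ^+ i * expR (- V n w) ^+ j)) =
    (fun n => \int[P]_w expR (- (i%:R * U n w + j%:R * V n w))).
  by apply/funext => n; apply: eq_Rintegral => w _; exact: expE.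
- by rewrite divr_ge0 ?(ltW e0)// addr_ge0 ?expR_ge0// !mulr_ge0 ?expR_ge0.
- by move=> x y x' y'; exact: smooth_boundary_lipschitz.
- by move=> x y; rewrite ger0_norm ?smooth_boundary_ge0 ?smooth_boundary_le1.
- by move=> n; apply: measurable_smooth_boundary; exact: mexp.
- by apply: measurable_smooth_boundary; exact: mexp.
Qed.

Let mexpUV d0 (T0 : measurableType d0) (u v : T0 -> R) r s :
  measurable_fun setT u -> measurable_fun setT v ->
  measurable_fun setT (fun w => expR (- (r * u w + s * v w))).
Proof. by move=> mu mv; apply: mexp; apply: measurable_funD; exact: measurable_funM. Qed.

Let mboundary d0 (T0 : measurableType d0) (u v : T0 -> R) c e :
  measurable_fun setT u -> measurable_fun setT v ->
  measurable [set w | u w <= c * v w ^+ 2 + e].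
Proof.
move=> mu mv; rewrite -[X in measurable X]setTI.
have := @measurable_fun_ler _ T0 R setT u (fun w => c * v w ^+ 2 + e) mu.
apply => //; apply: measurable_funD => //; apply: measurable_funM => //.
exact: measurable_funX.
Qed.

Lemma measurable_le_sqr d0 (T0 : measurableType d0) (u v : T0 -> R) c :
  measurable_fun setT u -> measurable_fun setT v ->
  measurable [set w | u w <= c * v w ^+ 2].
Proof.
move=> mu mv; have := mboundary c 0 mu mv.
by under eq_set do rewrite addr0.
Qed.

Let smooth_integrable d0 (T0 : measurableType d0) (P0 : probability T0 R) (u v : T0 -> R) c K e b :
  measurable_fun setT u -> measurable_fun setT v ->
  P0.-integrable setT (EFin \o (fun w => smooth_boundary c K e b (expR (- u w)) (expR (- v w)))).
Proof.
move=> mu mv; apply: (@bounded_integrable _ _ _ P0 _ 1).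
  by apply: measurable_smooth_boundary; exact: mexp.
by move=> w; rewrite ger0_norm ?smooth_boundary_ge0 ?smooth_boundary_le1.
Qed.

(** The probability is squeezed between expectations of the inner and the outer ramp. The outer ramp
    covers [V n w <= K] only; tightness of [V n] is read off the transform near 0. *)
Lemma cvg_ratio_boundary c : 0 <= c -> P' [set w | U' w = c * V' w ^+ 2] = 0%E ->
  fine (P [set w | U n w <= c * V n w ^+ 2]) @[n --> \oo] -->
  fine (P' [set w | U' w <= c * V' w ^+ 2]).
Proof.
move=> c0 atom.
set q := fine (P' _).
have L1 : \int[P']_w expR (- (0 * U' w + k.+1%:R^-1 * V' w)) @[k --> \oo] --> (1 : R).
  rewrite -[X in _ --> X](Rintegral_cst1 P').
  apply: (cvg_Rintegral_bounded (M := 1)) => //.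
  - by move=> n; exact: mexpUV.
  - move=> n w; apply: norm_expRN_le1.
    by rewrite mul0r add0r mulr_ge0// invr_ge0.
  - apply: aeW => w; rewrite [X in _ --> X](_ : _ = expR 0); last by rewrite expR0.
    apply: continuous_cvg; first exact: continuous_expR.
    rewrite -[X in _ --> X]oppr0; apply: cvgN; rewrite -[X in _ --> X](addr0 0).
    apply: cvgD; first by rewrite mul0r; exact: cvg_cst.
    by rewrite -[X in _ --> X](mul0r (V' w)); apply: cvgMr_tmp; exact: cvg_harmonic.
have inv_le (j k : nat) : (j <= k)%N -> (k.+1%:R^-1 : R) <= j.+1%:R^-1.
  by move=> jk; rewrite lef_pV2 ?posrE// ler_nat.
have upper_sets : fine (P' [set w | U' w <= c * V' w ^+ 2 + k.+1%:R^-1]) @[k --> \oo] --> q.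
  apply: fine_cvg; rewrite fineK ?fin_num_measure//; last exact: measurable_le_sqr.
  have -> : [set w | U' w <= c * V' w ^+ 2] =
      \bigcap_k [set w | U' w <= c * V' w ^+ 2 + k.+1%:R^-1].
    apply/seteqP; split => w /=; first by move=> h k _ /=; rewrite (le_trans h)// lerDl invr_ge0.
    move=> h; apply/ler_addgt0Pr => x x0.
    apply: (le_trans (h (Num.truncn x^-1) I)); rewrite lerD2l.
    by rewrite invf_ple ?posrE// ltW// truncnS_gt.
  apply: nonincreasing_cvg_mu.
  - by rewrite (le_lt_trans (probability_le1 _ _)) ?ltry//; exact: mboundary.
  - by move=> k; exact: mboundary.
  - by apply: bigcapT_measurable => k; exact: mboundary.
  - move=> j k jk; apply/subsetPset => w /= h; rewrite (le_trans h)// lerD2l.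
    exact: inv_le.
have mlow (x y : R) : measurable [set w | U' w + x <= c * V' w ^+ 2 /\ V' w <= y].
  apply: measurableI; rewrite -[X in measurable X]setTI.
    apply: (@measurable_fun_ler _ T' R setT (fun w => U' w + x) (fun w => c * V' w ^+ 2)) => //.
      exact: measurable_funD.
    by apply: measurable_funM => //; exact: measurable_funX.
  exact: (@measurable_fun_ler _ T' R setT V' (cst y)).
have lower_sets : fine (P' [set w | U' w + k.+1%:R^-1 <= c * V' w ^+ 2 /\ V' w <= k.+1%:R]) @[k --> \oo] --> q.
  apply: fine_cvg; rewrite fineK ?fin_num_measure//; last exact: measurable_le_sqr.
  have mV2 : measurable_fun setT (fun w => c * V' w ^+ 2).
    by apply: measurable_funM => //; exact: measurable_funX.
  have mlt : measurable [set w | U' w < c * V' w ^+ 2].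
    by rewrite -[X in measurable X]setTI; exact: (measurable_fun_ltr mU' mV2).
  have meq : measurable [set w | U' w = c * V' w ^+ 2].
    rewrite -[X in measurable X]setTI.
    rewrite (_ : mkset _ = (fun w => U' w == c * V' w ^+ 2) @^-1` [set true]).
      exact: (measurable_fun_eqr mU' mV2).
    by apply/seteqP; split => w /= /eqP.
  (* The sets shifted inward exhaust only the strict inequality; [atom] disposes of the curve
     itself. *)
  have -> : P' [set w | U' w <= c * V' w ^+ 2] = P' [set w | U' w < c * V' w ^+ 2].
    have -> : [set w | U' w <= c * V' w ^+ 2] =
      [set w | U' w < c * V' w ^+ 2] `|` [set w | U' w = c * V' w ^+ 2].
      apply/seteqP; split => w /=.
        by rewrite le_eqVlt => /orP[/eqP|]; [right|left].
      by move=> [/ltW//|->].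
    rewrite measureU//; first by move: atom => /= ->; rewrite adde0.
    by rewrite -subset0 => w /= [h1 h2]; move: h1; rewrite h2 ltxx.
  have E : [set w | U' w < c * V' w ^+ 2] =
      \bigcup_k [set w | U' w + k.+1%:R^-1 <= c * V' w ^+ 2 /\ V' w <= k.+1%:R].
    apply/seteqP; split => w /=; last first.
      by move=> [k _ /= [h _]]; apply: lt_le_trans h; rewrite ltrDl invr_gt0.
    move=> h; pose x := c * V' w ^+ 2 - U' w.
    have x0 : 0 < x by rewrite subr_gt0.
    exists (maxn (Num.truncn x^-1) (Num.truncn (V' w))) => //=; split.
      rewrite -lerBrDl -/x (le_trans (inv_le _ _ (leq_maxl _ _)))//.
      by rewrite invf_ple ?posrE// ltW// truncnS_gt.
    by rewrite (le_trans (ltW (truncnS_gt _)))// ler_nat ltnS leq_maxr.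
  rewrite E; apply: nondecreasing_cvg_mu.
  - by move=> k; exact: mlow.
  - by rewrite -E.
  - move=> j k jk; apply/subsetPset => w /= [h1 h2]; split.
      by apply: le_trans h1; rewrite lerD2l; exact: inv_le.
    by rewrite (le_trans h2)// ler_nat ltnS.
apply/cvgrPdist_le => eta eta0.
(* Where [V n w > K], [1 - exp (- V n w / K)] is at least [c2], so the transform at [1 / K] bounds
   the tail of [V n]. *)
have c1 : 0 < 1 - expR (-1) :> R by rewrite subr_gt0 expR_lt1 ltrN10.
set c2 := 1 - expR (-1) in c1.
have eta4 : 0 < eta / 4 by rewrite divr_gt0.
have ceta4 : 0 < c2 * (eta / 4) by rewrite mulr_gt0.
(* One index fixes both the cap [K = k + 1] and the ramp width [e = 1 / K]. Of the error [eta], a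
   quarter goes to the widened set, a quarter to the ramp expectation and half to the tail. *)
near \oo => k.
have up : `|q - fine (P' [set w | U' w <= c * V' w ^+ 2 + k.+1%:R^-1])| <= eta / 4.
  by near: k; move/cvgrPdist_le : upper_sets; exact.
have low : `|q - fine (P' [set w | U' w + k.+1%:R^-1 <= c * V' w ^+ 2 /\ V' w <= k.+1%:R])| <= eta / 4.
  by near: k; move/cvgrPdist_le : lower_sets; exact.
have tail : `|1 - \int[P']_w expR (- (0 * U' w + k.+1%:R^-1 * V' w))| <= c2 * (eta / 4).
  by near: k; move/cvgrPdist_le : L1; exact.
have K0 : 0 < (k.+1%:R : R) by rewrite ltr0n.
have k1 : (k.+1%:R^-1 : R) <= 1 by rewrite invf_le1 ?ler1n ?ltr0n.
have kp : 0 < (k.+1%:R^-1 : R) by rewrite invr_gt0.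
move: (k.+1%:R : R) K0 k1 kp up low tail => K K0 k1 kp; set e := K^-1 => up low tail.
near=> n.
have hp : `|\int[P']_w (smooth_boundary c K e e (expR (- U' w)) (expR (- V' w))) -
    \int[P]_w (smooth_boundary c K e e (expR (- U n w)) (expR (- V n w)))| <= eta / 4.
  by near: n; move/cvgrPdist_le : (@cvg_smooth_boundary c K e e c0 (ltW K0) kp); exact.
have hm : `|\int[P']_w (smooth_boundary c K e 0 (expR (- U' w)) (expR (- V' w))) -
    \int[P]_w (smooth_boundary c K e 0 (expR (- U n w)) (expR (- V n w)))| <= eta / 4.
  by near: n; move/cvgrPdist_le : (@cvg_smooth_boundary c K e 0 c0 (ltW K0) kp); exact.
have ht : `|\int[P']_w expR (- (0 * U' w + e * V' w)) -
    \int[P]_w expR (- (0 * U n w + e * V n w))| <= c2 * (eta / 4).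
  by near: n; move/cvgrPdist_le : (cvg_laplace (lexx 0) (ltW kp)); exact.
set p := fine (P _).
have pE : p = \int[P]_w \1_[set w | U n w <= c * V n w ^+ 2] w.
  by rewrite /p probability_indic//; exact: measurable_le_sqr.
have H1 : p <= \int[P]_w (smooth_boundary c K e e (expR (- U n w)) (expR (- V n w))) +
    c2^-1 * (1 - \int[P]_w expR (- (0 * U n w + e * V n w))).
  have mg := mexpUV 0 e (mU n) (mV n).
  set g := fun w => expR (- (0 * U n w + e * V n w)) in mg *.
  have g01 w : 0 <= g w <= 1.
    by rewrite /g mul0r add0r expR_ge0 expR_le1 oppr_le0 mulr_ge0 ?(ltW kp).
  have h01 w : 0 <= c2^-1 * (1 - g w) <= c2^-1.
    have /andP[? ?] := g01 w; rewrite mulr_ge0 ?invr_ge0 ?subr_ge0 ?(ltW c1)//=.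
    by rewrite ler_piMr ?invr_ge0 ?(ltW c1)// lerBlDr lerDl.
  have intg1 : P.-integrable setT (EFin \o (fun w => 1 - g w)).
    apply: (@bounded_integrable _ _ _ P _ 1); first exact: measurable_funB.
    by move=> w; have /andP[? ?] := g01 w; rewrite ger0_norm ?subr_ge0// lerBlDr lerDl.
  have intg : P.-integrable setT (EFin \o (fun w => c2^-1 * (1 - g w))).
    apply: (@bounded_integrable _ _ _ P _ c2^-1).
      by apply: measurable_funM => //; exact: measurable_funB.
    by move=> w; have /andP[? ?] := h01 w; rewrite ger0_norm.
  have -> : c2^-1 * (1 - \int[P]_w g w) = \int[P]_w (c2^-1 * (1 - g w)).
    rewrite RintegralZl// RintegralB//.
    - by rewrite Rintegral_cst1.
    - exact: (@bounded_integrable _ _ _ P _ `|1|).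
    - apply: (@bounded_integrable _ _ _ P _ 1) => // w.
      by have /andP[? ?] := g01 w; rewrite ger0_norm.
  rewrite pE -RintegralD//; last exact: smooth_integrable.
  apply: le_Rintegral => //.
  - by apply: indic_integrable; exact: measurable_le_sqr.
  - apply: (@bounded_integrable _ _ _ P _ (1 + c2^-1)).
      apply: measurable_funD; first by apply: measurable_smooth_boundary; exact: mexp.
      by apply: measurable_funM => //; exact: measurable_funB.
    move=> w; have /andP[? ?] := h01 w; rewrite (le_trans (ler_normD _ _))// lerD//.
      by rewrite ger0_norm ?smooth_boundary_ge0 ?smooth_boundary_le1.
    by rewrite ger0_norm.
  - move=> w _; have /andP[p1 _] := h01 w.
    rewrite indicE; case: (boolP (_ \in _)) => [|_] /=; last by rewrite addr_ge0 ?smooth_boundary_ge0.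
    rewrite inE/= => UV; case: (leP (V n w) K) => VK.
      by rewrite smooth_boundary1 ?V0 ?(ltW K0)// lerDl.
    apply: (@le_trans _ _ (c2^-1 * (1 - g w))); last by rewrite lerDr smooth_boundary_ge0.
    rewrite mulrC ler_pdivlMr// mul1r /c2 lerB// /g ler_expR mul0r add0r lerN2.
    by rewrite /e mulrC ler_pdivlMr// mul1r ltW.
have H2 : \int[P']_w (smooth_boundary c K e e (expR (- U' w)) (expR (- V' w))) <=
    fine (P' [set w | U' w <= c * V' w ^+ 2 + e]).
  rewrite probability_indic; last exact: mboundary.
  apply: le_Rintegral => //; [exact: smooth_integrable|by apply: indic_integrable; exact: mboundary|].
  move=> w _; rewrite indicE; case: (boolP (_ \in _)) => [_|]; first exact: smooth_boundary_le1.
  rewrite notin_setE/= => /negP; rewrite -ltNge => h.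
  by rewrite smooth_boundary_le ?(ltW K0) ?kp.
have H3 : \int[P]_w (smooth_boundary c K e 0 (expR (- U n w)) (expR (- V n w))) <= p.
  rewrite pE.
  apply: le_Rintegral => //; [exact: smooth_integrable|by apply: indic_integrable; exact: measurable_le_sqr|].
  move=> w _; rewrite indicE; case: (boolP (_ \in _)) => [_|]; first exact: smooth_boundary_le1.
  rewrite notin_setE/= => /negP; rewrite -ltNge => h.
  by rewrite smooth_boundary0 ?(ltW K0).
have H4 : fine (P' [set w | U' w + e <= c * V' w ^+ 2 /\ V' w <= K]) <=
    \int[P']_w (smooth_boundary c K e 0 (expR (- U' w)) (expR (- V' w))).
  rewrite probability_indic//.
  apply: le_Rintegral => //; [exact: indic_integrable|exact: smooth_integrable|].
  move=> w _; rewrite indicE; case: (boolP (_ \in _)) => [|_]; last exact: smooth_boundary_ge0.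
  by rewrite inE/= => -[h1 h2]; rewrite smooth_boundary_ge ?(ltW K0) ?V'0.
have H5 : c2^-1 * (1 - \int[P]_w expR (- (0 * U n w + e * V n w))) <= eta / 2.
  rewrite mulrC ler_pdivrMr//; move: tail ht.
  move: (\int[P]_w _) (\int[P']_w _) => x y.
  rewrite !ler_norml => /andP[_ h1] /andP[_ h2].
  have -> : eta / 2 * c2 = c2 * (eta / 4) + c2 * (eta / 4) by field.
  by move: (c2 * _) h1 h2 => z; lra.
move: up low hp hm H1 H2 H3 H4 H5; rewrite !ler_norml; lra.
Unshelve. all: by end_near.
Qed.

End ratio_limit.

(** * Regularly varying tails *)

Section regularly_varying_tail.
Context {R : realType}.
Variables (G : R -> R) (alpha : R).
Hypothesis alpha01 : 0 < alpha < 1.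
Hypothesis G_noninc : forall x y, x <= y -> G y <= G x.
Hypothesis G_gt0 : forall x, 0 < G x.
Hypothesis G_le1 : forall x, G x <= 1.
Hypothesis G_cvg0 : G x @[x --> +oo] --> 0.
Hypothesis G_rv : forall c : R, 0 < c -> G (c * x) / G x @[x --> +oo] --> c `^ (- alpha).
Notation mu := (@lebesgue_measure R).

(** Strictly between [alpha] and 1: above [alpha] for Potter's bound, below 1 for integrability near
    0. *)
Let beta := (alpha + 1) / 2.

Lemma potter_bound : exists A C : R, [/\ 0 < A, 1 <= C &
  forall a y, A <= a -> 0 < y <= 1 -> G (a * y) <= C * y `^ (- beta) * G a].
Proof.
have /andP[al0 al1] := alpha01.
have b0 : 0 < beta by rewrite /beta; lra.
(* As [alpha < beta], doubling a large argument divides the tail by at most [2^beta]. This is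
   iterated up to the least [k] with [1 <= 2^k y], for which [2^k <= 2 / y]. *)
have [A [A0 HA]] : exists A, 0 < A /\ forall x, A <= x -> G x <= 2 `^ beta * G (2 * x).
  have h : 2 `^ (- beta) < 2 `^ (- alpha) :> R.
    by rewrite /powR pnatr_eq0/= ltr_expR ltr_pM2r ?ln_gt0 ?ltr1n// /beta; lra.
  have := cvgr_ge _ (G_rv (ltr0n R 2)) _ h.
  move=> [M [Mr HM]]; exists (Num.max 1 (M + 1)); split.
    by rewrite lt_max ltr01.
  move=> x; rewrite ge_max => /andP[_ Mx].
  have Mx' : M < x by apply: lt_le_trans Mx; rewrite ltrDl.
  have /= := HM x Mx'.
  rewrite ler_pdivlMr// powRN mulrC ler_pdivrMr ?powR_gt0//.
  by rewrite mulrC.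
have iter k x : A <= x -> G x <= (2 ^+ k) `^ beta * G (2 ^+ k * x).
  elim: k x => [|k IH] x Ax; first by rewrite expr0 powR1 !mul1r.
  have x0 : 0 < x by exact: lt_le_trans Ax.
  apply: (le_trans (IH _ Ax)); rewrite exprSr powRM ?exprn_ge0// -mulrA.
  rewrite ler_wpM2l ?powR_ge0//.
  have -> : 2 ^+ k * 2 * x = 2 * (2 ^+ k * x) by ring.
  apply: HA; rewrite (le_trans Ax)// ler_peMl ?(ltW x0)//.
  by rewrite exprn_ege1// ler1n.
have two1 : 1 <= 2 `^ beta :> R.
  by rewrite -[leLHS](powRr0 2) ler_powR ?ler1n// ltW.
have big a y : A <= a * y -> 0 < a -> 0 < y <= 1 -> G (a * y) <= 2 `^ beta * y `^ (- beta) * G a.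
  move=> Aay a0 /andP[y0 y1].
  have exk : exists k, 1 <= 2 ^+ k * y.
    exists (Num.truncn y^-1).+1; rewrite -ler_pdivrMr// mul1r.
    apply: (le_trans (ltW (truncnS_gt _))).
    by rewrite -natrX ler_nat ltnW// ltn_expl.
  case: (ex_minnP exk) => k hk kmin.
  apply: (le_trans (iter k _ Aay)); apply: ler_pM; [exact: powR_ge0|exact: ltW| |]; last first.
    by apply: G_noninc; rewrite mulrCA ler_peMr// ltW.
  have -> : 2 `^ beta * y `^ (- beta) = (2 / y) `^ beta.
    rewrite powRM ?invr_ge0 ?(ltW y0)// -[y^-1]powR_inv1 ?(ltW y0)// -powRrM.
    by rewrite mulN1r.
  apply: ge0_ler_powR; [exact: ltW|by rewrite nnegrE exprn_ge0|by rewrite nnegrE divr_ge0// ltW|].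
  rewrite ler_pdivlMr//; case: k hk kmin => [|k] hk kmin.
    by rewrite mul1r (le_trans y1)// ler1n.
  rewrite leNgt; apply/negP => h.
  have : 1 <= 2 ^+ k * y.
    by move: h; rewrite exprS -mulrA ltr_pMr// => /ltW.
  by move=> /kmin; rewrite ltnn.
(* The factor [1 / G A] pays for [a * y < A], out of reach of doubling: there the tail is at most 1,
   and the bound is taken at [A / a], which is larger than [y]. *)
pose C := 2 `^ beta / G A.
have C1 : 1 <= C.
  rewrite /C ler_pdivlMr// mul1r (le_trans (G_le1 A))//.
exists A, C; split => // a y Aa y01; have /andP[y0 y1] := y01.
have a0 : 0 < a by exact: lt_le_trans Aa.
have CE : 2 `^ beta <= C.
  by rewrite /C ler_pdivlMr// ler_piMr// powR_ge0.
case: (leP A (a * y)) => Aay.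
  apply: (le_trans (big _ _ Aay a0 y01)).
  by rewrite ler_wpM2r ?(ltW (G_gt0 _))// ler_wpM2r ?powR_ge0.
apply: (le_trans (G_le1 _)).
have Aa01 : 0 < A / a <= 1 by rewrite divr_gt0//= ler_pdivrMr// mul1r.
have := big a (A / a); rewrite mulrCA divff ?gt_eqF// mulr1 => /(_ (lexx _) a0 Aa01) h.
have -> : C * y `^ (- beta) * G a = (2 `^ beta * y `^ (- beta) * G a) / G A.
  by rewrite /C; field; rewrite gt_eqF.
rewrite ler_pdivlMr// mul1r; apply: (le_trans h).
rewrite ler_wpM2r ?(ltW (G_gt0 _))// ler_wpM2l ?powR_ge0//.
rewrite !powRN lef_pV2 ?posrE ?powR_gt0//; last by case/andP: Aa01.
apply: ge0_ler_powR; [exact: ltW|by rewrite nnegrE ltW|by rewrite nnegrE; case/andP: Aa01 => /ltW|].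
by rewrite ler_pdivlMr// mulrC ltW.
Qed.

Lemma cvg_tail_integral (r s : R) (a : nat -> R) : 0 <= r -> 0 <= s ->
  a n @[n --> \oo] --> +oo ->
  (\int[mu]_(y in `]0%R, +oo[) (qlin_dens r s y * (G (a n * y) / G (a n)))%:E @[n --> \oo] -->
   stable_exponent alpha r s)%E.
Proof.
move=> r0 s0 aoo; have /andP[al0 al1] := alpha01.
have b01 : 0 < beta < 1 by rewrite /beta; lra.
have [A [C [A0 C1 HC]]] := potter_bound.
have mG : measurable_fun setT G.
  by apply: nonincreasing_measurable => // x y xy; exact: G_noninc.
have mGa n : measurable_fun setT (fun y => qlin_dens r s y * (G (a n * y) / G (a n))).
  apply: measurable_funM; first exact: measurable_qlin_dens.
  by apply: measurable_funM => //; apply: (measurableT_comp mG); exact: measurable_funM.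
(* Potter's bound dominates for [y <= 1] and monotonicity of [G] beyond 1; the sum of both bounds
   serves everywhere and is integrable. *)
pose g y := C * (qlin_dens r s y * y `^ (- beta) + qlin_dens r s y).
have intg : mu.-integrable `]0%R, +oo[ (EFin \o g).
  have i1 := integrable_stable_density b01 r0 s0.
  have i2 := integrable_qlin_dens r0 s0.
  have mD : measurable (`]0%R, +oo[%classic : set (measurableTypeR R)).
    exact: measurable_itv.
  have := @integrableZl _ (measurableTypeR R) R mu _ mD C _ (integrableD mD i1 i2).
  by apply: eq_integrable => // y _; rewrite /g /= -EFinD -EFinM.
have [N _ HN] : \forall n \near \oo, A <= a n by move/cvgryPge : aoo; exact.
have := @dominated_convergence _ _ _ mu `]0%R, +oo[%classic (measurable_itv _)
  (fun n y => (qlin_dens r s y * (G (a (n + N)%N * y) / G (a (n + N)%N)))%:E)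
  (fun y => (qlin_dens r s y * y `^ (- alpha))%:E) (EFin \o g).
case.
- by move=> n; apply/measurable_EFinP/measurable_funTS; exact: mGa.
- by apply/measurable_EFinP/measurable_funTS; exact: measurable_stable_density.
- apply: aeW => y /=; rewrite in_itv/= andbT => y0.
  apply: cvg_EFin; first exact: nearW.
  apply: cvgMl_tmp; rewrite (cvg_shiftn N (fun n => G (a n * y) / G (a n))).
  have := cvg_comp _ _ aoo (G_rv y0).
  have -> // : (fun x : R => G (y * x) / G x) \o a = (fun n => G (a n * y) / G (a n)).
  by apply/funext => n /=; rewrite (mulrC y).
- exact: intg.
- apply: aeW => y n /=; rewrite in_itv/= andbT => y0.
  have An : A <= a (n + N)%N by apply: HN => /=; rewrite leq_addl.
  have aN0 : 0 < a (n + N)%N by exact: lt_le_trans An.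
  have q0 := qlin_dens_ge0 r0 s0 (ltW y0).
  rewrite lee_fin ger0_norm; last by rewrite mulr_ge0// divr_ge0 ?(ltW (G_gt0 _)).
  have C0 : 0 <= C by exact: le_trans C1.
  rewrite /g mulrDr; case: (leP y 1) => y1.
    apply: (@le_trans _ _ (C * (qlin_dens r s y * y `^ (- beta)))); last first.
      by rewrite lerDl mulr_ge0.
    rewrite [leRHS]mulrCA ler_wpM2l// ler_pdivrMr//.
    by apply: HC => //; rewrite y0.
  apply: (@le_trans _ _ (C * qlin_dens r s y)); last first.
    by rewrite lerDr mulr_ge0// mulr_ge0// powR_ge0.
  rewrite mulrC ler_wpM2r// ler_pdivrMr// (le_trans (G_noninc (_ : a (n + N)%N <= _)))//.
    by rewrite ler_peMr ?(ltW aN0)// ltW.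
  by rewrite ler_peMl// ltW.
move=> _ _; rewrite (cvg_shiftn N (fun n => \int[mu]_(y in `]0%R, +oo[) (qlin_dens r s y * (G (a n * y) / G (a n)))%:E))%E.
exact.
Qed.

(** [a t] is a generalized inverse of [1 / G] at [t]. As [G] may jump, [t * G (a t)] need not be 1,
    but [t G (c a t) < 1 <= t G (a t / c)] for [c > 1], and regular variation compares both values
    with [G (a t)] as [c] decreases to 1. *)
Lemma tail_normalization : exists a : R -> R,
  a t @[t --> +oo] --> +oo /\ t * G (a t) @[t --> +oo] --> (1 : R).
Proof.
have /andP[al0 al1] := alpha01.
pose S (t : R) : set R := [set x | 1 <= t * G x].
pose a t := sup (S t).
have Sb t : 0 < t -> has_ubound (S t).
  move=> t0; have ti0 : 0 < t^-1 by rewrite invr_gt0.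
  have [M [Mr HM]] := cvgr_lt _ G_cvg0 _ ti0.
  exists (M + 1) => x /= Sx; rewrite leNgt; apply/negP => Mx.
  have Mx' : M < x by apply: lt_trans Mx; rewrite ltrDl.
  have := HM _ Mx'; rewrite -(ltr_pM2l t0) divff ?gt_eqF// ltNge => /negP; exact.
have aM M : \forall t \near +oo, S t M.
  apply: filterS (nbhs_pinfty_ge (num_real (G M)^-1)) => t Mt.
  by rewrite /S/= -ler_pdivrMr// mul1r.
have aoo : a t @[t --> +oo] --> +oo.
  apply/cvgryPge => M; near=> t.
  have t0 : 0 < t by near: t; exact: nbhs_pinfty_gt.
  by apply: ub_le_sup; [exact: Sb|near: t; exact: aM].
exists a; split => //.
have up c t : 0 < t -> 0 < a t -> 1 < c -> t * G (c * a t) < 1.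
  move=> t0 at0 c1; rewrite ltNge; apply/negP => h.
  have : c * a t <= a t by apply: ub_le_sup; [exact: Sb|exact: h].
  by rewrite leNgt => /negP; apply; rewrite ltr_pMl.
have down c t : S t 0 -> 0 < t -> 0 < a t -> 1 < c -> 1 <= t * G (c^-1 * a t).
  move=> S0 t0 at0 c1; have c0 : 0 < c by exact: lt_trans c1.
  have e0 : 0 < a t - c^-1 * a t.
    by rewrite subr_gt0 gtr_pMl// invf_lt1.
  have [x Sx] := sup_adherent e0 (conj (ex_intro _ 0 S0) (Sb _ t0)).
  rewrite -/(a t) opprB addrC subrK => cx; apply: (le_trans Sx).
  by rewrite ler_wpM2l ?(ltW t0)//; apply: G_noninc; exact: ltW.
apply/cvgrPdist_le => e e0; pose h := Num.min e 1 / 4.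
have h0 : 0 < h by rewrite divr_gt0// lt_min e0 ltr01.
have he : h <= e / 4 by rewrite ler_pM2r ?invr_gt0// ge_min lexx.
have h1 : h <= 1 / 4 by rewrite ler_pM2r ?invr_gt0// ge_min lexx orbT.
(* With this [c] the two ratios of tails tend to [1 / (1 + h)] and [1 + h]. *)
have [c [c1 ca]] : exists c, 1 < c /\ c `^ alpha = 1 + h.
  exists ((1 + h) `^ alpha^-1); split.
    rewrite /powR gt_eqF; last by rewrite ltr_wpDr// ltW.
    by rewrite expR_gt1 mulr_gt0 ?invr_gt0// ln_gt0// ltrDl.
  by rewrite -powRrM mulVf ?gt_eqF// powRr1//; lra.
have c0 : 0 < c by exact: lt_trans c1.
have R1 := cvg_comp _ _ aoo (G_rv c0).
have ci0 : 0 < c^-1 by rewrite invr_gt0.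
have R2 := cvg_comp _ _ aoo (G_rv ci0).
have E1 : c `^ (- alpha) = (1 + h)^-1 by rewrite powRN ca.
have E2 : c^-1 `^ (- alpha) = 1 + h.
  by rewrite -powR_inv1 ?(ltW c0)// -powRrM mulN1r opprK.
rewrite E1 in R1; rewrite E2 in R2.
have l1 : 1 - 2 * h < (1 + h)^-1.
  by rewrite -[ltRHS]mul1r ltr_pdivlMr; nra.
near=> t.
have t0 : 0 < t by near: t; exact: nbhs_pinfty_gt.
have at0 : 0 < a t by near: t; move/cvgryPgt : aoo; exact.
have S0 : S t 0 by near: t; exact: aM.
have H1 : 1 - 2 * h <= G (c * a t) / G (a t).
  by near: t; apply: (cvgr_ge _ R1).
have H2 : G (c^-1 * a t) / G (a t) <= 1 + 2 * h.
  by near: t; apply: (cvgr_le _ R2); lra.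
have := up c t t0 at0 c1; have := down c t S0 t0 at0 c1.
move: H1 H2; rewrite ler_pdivlMr// ler_pdivrMr//.
move=> H1 H2 D1 U1.
have H1' : t * ((1 - 2 * h) * G (a t)) <= 1.
  by apply: le_trans (ltW U1); rewrite ler_wpM2l ?(ltW t0).
have H2' : 1 <= t * ((1 + 2 * h) * G (a t)).
  by apply: (le_trans D1); rewrite ler_wpM2l ?(ltW t0).
rewrite mulrCA in H1'; rewrite mulrCA in H2'.
have y0 : 0 < t * G (a t) by rewrite mulr_gt0.
move: (t * G (a t)) y0 H1' H2' => y y0 H1' H2'.
have y2 : y <= 2.
  have : 2^-1 * y <= (1 - 2 * h) * y by rewrite ler_wpM2r ?(ltW y0)//; lra.
  lra.
have hy : h * y <= h * 2 by rewrite ler_wpM2l ?(ltW h0).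
by rewrite ler_norml; lra.
Unshelve. all: by end_near.
Qed.

End regularly_varying_tail.

(** * Laplace transform of a Pareto-type variable *)

Section qlin_tail.
Context {R : realType} d (T : measurableType d) (P : probability T R).

Lemma integral_qlin_tail r s (Y : T -> R) : 0 <= r -> 0 <= s ->
  measurable_fun setT Y -> (forall w, 0 <= Y w) ->
  (1 - \int[P]_w expR (- qlin r s (Y w)))%:E =
  (\int[(@lebesgue_measure R)]_(y in `]0%R, +oo[) ((qlin_dens r s y)%:E * P [set w | (y < Y w)%R]))%E.
Proof.
move=> r0 s0 mY Y0.
have me : measurable_fun setT (fun w => expR (- qlin r s (Y w))).
  apply: measurableT_comp => //; apply: measurableT_comp => //.
  by apply: (measurableT_comp (measurable_qlin r s)).
have e1 w : `|expR (- qlin r s (Y w))| <= 1.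
  by rewrite norm_expRN_le1// qlin_ge0.
have -> : 1 - \int[P]_w expR (- qlin r s (Y w)) = \int[P]_w (1 - expR (- qlin r s (Y w))).
  rewrite RintegralB//; first by rewrite Rintegral_cst1.
    by apply: (@bounded_integrable _ _ _ P _ 1) => // w; rewrite normr1.
  exact: (@bounded_integrable _ _ _ P _ 1).
have i1 : P.-integrable setT (EFin \o (fun w => 1 - expR (- qlin r s (Y w)))).
  apply: (@bounded_integrable _ _ _ P _ 1); first exact: measurable_funB.
  move=> w; rewrite ger0_norm; first by rewrite gerBl expR_ge0.
  by rewrite subr_ge0 -[leLHS]ger0_norm ?expR_ge0.
rewrite /Rintegral fineK; last exact: integrable_fin_num.
under eq_integral do rewrite -integral_qlin_dens//.
rewrite layer_cake//; [|exact: measurable_qlin_dens|by move=> y y0; rewrite qlin_dens_ge0// ltW].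
by apply: eq_integral => y _; rewrite setTI.
Qed.

End qlin_tail.

Section pareto_tail.
Context {R : realType} d (T : measurableType d) (P : probability T R).
Variables (X : {RV P >-> R}) (alpha : R).
Hypothesis alpha01 : 0 < alpha < 1.
Hypothesis Xpareto : pareto_type alpha (distr_fun X).
Notation mu := (@lebesgue_measure R).

Let G (x : R) := fine (ccdf X x).

Let ccdf_fin (x : R) : ccdf X x \is a fin_num.
Proof. by rewrite fin_num_measure. Qed.

Let GE x : G x = 1 - distr_fun X x.
Proof. by rewrite /G /distr_fun ccdf_1_cdf fineB// fin_num_measure. Qed.

Let G_noninc x y : x <= y -> G y <= G x.
Proof. by move=> xy; apply: fine_le => //; exact: ccdf_nonincreasing. Qed.

Let G_le1 x : G x <= 1.
Proof. by rewrite -lee_fin fineK ?ccdf_fin// probability_le1. Qed.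

Let G_cvg0 : G x @[x --> +oo] --> 0.
Proof. by apply: fine_cvg; exact: cvg_ccdfy0. Qed.

(** The ratio of the tail to an eventually positive function tends to 1, so the tail is positive
    arbitrarily far out, hence everywhere by monotonicity. *)
Let G_gt0 x : 0 < G x.
Proof.
have [_ [l [[x0 [_ l0]] _] H]] := Xpareto.
have := cvgr_gt _ H _ (@ltr01 R).
move=> [M [Mr HM]]; pose y := Num.max x (Num.max (M + 1) (Num.max x0 1)).
have My : M < y by rewrite !lt_max ltrDl ltr01 orbT.
have x0y : x0 <= y by rewrite !le_max lexx !orbT.
have y0 : 0 < y by rewrite !lt_max ltr01 !orbT.
have xy : x <= y by rewrite le_max lexx.
apply: (lt_le_trans _ (G_noninc xy)); have /= := HM _ My.
by rewrite -GE pmulr_lgt0// invr_gt0 mulr_gt0 ?powR_gt0// l0.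
Qed.

Let G_rv (c : R) : 0 < c -> G (c * x) / G x @[x --> +oo] --> c `^ (- alpha).
Proof.
move=> c0; have [_ [l [[x0 [_ l0]] lc] H]] := Xpareto.
pose g x := x `^ (- alpha) * l x.
have H' : G x / g x @[x --> +oo] --> (1 : R) by under eq_fun do rewrite GE.
have coo : c * x @[x --> +oo] --> +oo.
  by apply: gt0_cvgMry => //; exact: cvg_id.
have Hc := cvg_comp _ _ coo H'.
have Hi : (G x / g x)^-1 @[x --> +oo] --> (1 : R).
  by rewrite -[X in _ --> X]invr1; apply: cvgV => //; exact: oner_neq0.
have K : (G (c * x) / g (c * x)) * (c `^ (- alpha) * (l (c * x) / l x)) * (G x / g x)^-1 @[x --> +oo]
    --> 1 * (c `^ (- alpha) * 1) * 1.
  by apply: cvgM => //; apply: cvgM => //; apply: cvgM; [exact: cvg_cst|exact: lc].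
rewrite mul1r !mulr1 in K.
apply: cvg_trans K; apply: near_eq_cvg; near=> x.
have x0' : 0 < x by near: x; exact: nbhs_pinfty_gt.
have lx : l x != 0.
  by rewrite gt_eqF// l0//; near: x; apply: nbhs_pinfty_ge; rewrite num_real.
have lcx : l (c * x) != 0.
  have : x0 / c <= x by near: x; apply: nbhs_pinfty_ge; rewrite num_real.
  by rewrite ler_pdivrMr// mulrC => h; rewrite gt_eqF// l0.
rewrite /g powRM ?(ltW c0) ?(ltW x0')//.
field.
by rewrite lx lcx !gt_eqF ?powR_gt0// mulr_gt0.
Unshelve. all: by end_near.
Qed.

(** [X], [Lambda], [U] and [V] are nonnegative only almost surely. A version nonnegative at every
    point keeps exponentials bounded by 1 without exceptional sets. *)
Definition positive_part w := Num.max (X w) 0.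

Lemma positive_part_ge0 w : 0 <= positive_part w.
Proof. by rewrite le_max lexx orbT. Qed.

Lemma measurable_positive_part : measurable_fun setT positive_part.
Proof. by apply: measurable_maxr. Qed.

Let psi r s b := \int[P]_w expR (- qlin r s (b * positive_part w)).

Let tail_gt (a y : R) : 0 < a -> 0 < y ->
  P [set w | (y < a^-1 * positive_part w)%R] = (G (a * y))%:E.
Proof.
move=> a0 y0; rewrite /G fineK ?ccdf_fin//.
congr (P _); apply/seteqP; split => w /=; rewrite in_itv/= andbT ltr_pdivlMl//.
  by rewrite lt_max => /orP[//|]; rewrite ltNge mulr_ge0// ltW.
by rewrite lt_max => ->.
Qed.

Lemma laplace_tail r s (a : R) : 0 <= r -> 0 <= s -> 0 < a ->
  (1 - psi r s a^-1)%:E =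
  (\int[mu]_(y in `]0%R, +oo[) (qlin_dens r s y * G (a * y))%:E)%E.
Proof.
move=> r0 s0 a0; rewrite integral_qlin_tail//; last 2 first.
- by apply: measurable_funM => //; exact: measurable_positive_part.
- by move=> w; rewrite mulr_ge0 ?positive_part_ge0// invr_ge0 ltW.
apply: eq_integral => y; rewrite inE/= in_itv/= andbT => y0.
by rewrite tail_gt// EFinM.
Qed.

Lemma laplace_normalization : exists a : R -> R,
  (forall t, 0 < a t) /\
  forall r s (t : nat -> R), 0 <= r -> 0 <= s -> t n @[n --> \oo] --> +oo ->
    t n * (1 - psi r s (a (t n))^-1) @[n --> \oo] --> fine (stable_exponent alpha r s).
Proof.
have [a0 [a0oo ta0]] := tail_normalization alpha01 G_noninc G_gt0 G_cvg0 G_rv.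
(* Unchanged for large [t], and positive everywhere, so that dividing by it is harmless. *)
pose a t := Num.max 1 (a0 t).
have aE : \forall t \near +oo, a0 t = a t.
  by near=> t; rewrite /a max_r//; near: t; move/cvgryPge : a0oo; exact.
have aoo : a t @[t --> +oo] --> +oo.
  by apply: cvg_trans a0oo; apply: near_eq_cvg; exact: aE.
have ta : t * G (a t) @[t --> +oo] --> (1 : R).
  apply: cvg_trans ta0; apply: near_eq_cvg.
  by apply: filterS aE => t ->.
have a_gt0 t : 0 < a t by rewrite lt_max ltr01.
exists a; split => // r s t r0 s0 too.
have atoo := cvg_comp _ _ too aoo.
have Dfin := stable_exponent_fin_num alpha01 r0 s0.
have := cvg_tail_integral alpha01 G_noninc G_gt0 G_le1 G_rv r0 s0 atoo.
rewrite -{1}(fineK Dfin) => /fine_cvg.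
move: (cvg_comp _ _ too ta) => K1 K2.
have K3 : t n * G (a (t n)) * fine (\int[mu]_(y in `]0%R, +oo[)
    (qlin_dens r s y * (G (a (t n) * y) / G (a (t n))))%:E)%E @[n --> \oo] -->
    1 * fine (stable_exponent alpha r s) by exact: cvgM.
rewrite mul1r in K3; apply: cvg_trans K3; apply: near_eq_cvg.
near=> n => /=.
have an0 := a_gt0 (t n).
have g0 := G_gt0 (a (t n)).
have E : ((1 - psi r s (a (t n))^-1)%:E = (G (a (t n)))%:E * \int[mu]_(y in `]0%R, +oo[)
   (qlin_dens r s y * (G (a (t n) * y) / G (a (t n))))%:E)%E.
  rewrite laplace_tail// -ge0_integralZl//; last 3 first.
  - apply/measurable_EFinP/measurable_funTS/measurable_funM.
      exact: measurable_qlin_dens.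
    apply: measurable_funM => //; apply: (measurableT_comp _ (measurable_funM _ _)) => //.
    by apply: nonincreasing_measurable => // x y xy; exact: G_noninc.
  - move=> y /=; rewrite in_itv/= andbT => y0.
    by rewrite lee_fin mulr_ge0 ?qlin_dens_ge0 ?divr_ge0// ltW.
  - by rewrite lee_fin ltW.
  by apply: eq_integral => y _; rewrite -EFinM mulrCA (mulrC (G (a (t n)))) divfK// gt_eqF.
have I0 : (0 <= \int[mu]_(y in `]0%R, +oo[) (qlin_dens r s y * (G (a (t n) * y) / G (a (t n))))%:E)%E.
  apply: integral_ge0 => y /=; rewrite in_itv/= andbT => y0.
  by rewrite lee_fin mulr_ge0 ?qlin_dens_ge0 ?divr_ge0// ltW.
rewrite -mulrA; congr (_ * _); apply: EFin_inj; rewrite E EFinM; congr (_ * _)%E.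
(* Were the integral infinite, so would be the left side of [E], which is a real number. *)
rewrite fineK// ge0_fin_numE// ltey; apply/eqP => I; move: E.
by rewrite I gt0_muley ?lte_fin.
Unshelve. all: by end_near.
Qed.

End pareto_tail.

(** * Independence in functional form *)

Section functional_independence.
Context {R : realType} d (T : measurableType d) (P : probability T R).
Notation mu := (@lebesgue_measure R).

(* Writing [k (Z w)] as the length of ]0, k (Z w)[ turns it into a mixture of
   indicators of events [Z w \in B]. *)
Lemma integral_mul_comp d1 (T1 : measurableType d1)
  (m : {sigma_finite_measure set T1 -> \bar R}) (W Z : T1 -> R) (Z' : T -> R)
  (c : \bar R) (k : R -> R) :
  measurable_fun setT W -> (forall w, 0 <= W w) ->
  measurable_fun setT Z -> measurable_fun setT Z' ->
  measurable_fun setT k -> (forall x, 0 <= k x) -> (0 <= c)%E ->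
  (forall B, measurable B ->
     \int[m]_w (W w * \1_B (Z w))%:E = c * P (Z' @^-1` B))%E ->
  (\int[m]_w (W w * k (Z w))%:E = c * \int[P]_w (k (Z' w))%:E)%E.
Proof.
move=> mW W0 mZ mZ' mk k0 c0 H.
have mkZ : measurable_fun setT (k \o Z) by exact: measurableT_comp.
have mkZ' : measurable_fun setT (k \o Z') by exact: measurableT_comp.
have leb (x : R) : 0 <= x -> (\int[mu]_(y in `]0%R, x[) (cst 1 y : R)%:E = x%:E)%E.
  move=> x0; rewrite /cst integral_cst//= lebesgue_measure_itv/= lte_fin.
  by case: ltgtP x0 => // [x0 _|<-//]; rewrite ?oppr0 ?adde0 ?mul1e ?mule0.
transitivity (\int[m]_w ((W w)%:E * \int[mu]_(y in `]0%R, (k \o Z) w[) (cst 1 y : R)%:E))%E.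
  by apply: eq_integral => w _; rewrite leb//= EFinM.
rewrite weighted_layer_cake//.
have -> : (\int[P]_w (k (Z' w))%:E =
    \int[P]_(w in setT) \int[mu]_(y in `]0%R, (k \o Z') w[) (cst 1 y : R)%:E)%E.
  by apply: eq_integral => w _; rewrite leb/=.
have mS y : measurable [set t | y < k (Z' t)].
  rewrite -[X in measurable X]setTI.
  by have := measurable_fun_ltr (measurable_cst y) mkZ'; apply.
pose q y := P [set t | y < k (Z' t)].
have mq : measurable_fun [set: R] q.
  have -> : q = EFin \o (fun y => fine (q y)).
    by apply/funext => y /=; rewrite fineK// fin_num_measure//; exact: mS.
  apply/measurable_EFinP; apply: nonincreasing_measurable => // x y xy.
  apply: fine_le; rewrite ?fin_num_measure//; try exact: mS.
  by apply: le_measure; rewrite ?inE; [exact: mS|exact: mS|move=> w /=; exact: le_lt_trans].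
rewrite layer_cake//; under [in RHS]eq_integral do rewrite setTI mul1e -/(q _).
rewrite -ge0_integralZl//; last exact: measurable_funTS.
apply: eq_integral => y _; rewrite mul1e.
have mB : measurable (k @^-1` [set x | y < x]).
  by rewrite -[X in measurable X]setTI; apply: mk => //; rewrite -set_itvoy.
rewrite -[X in (_ * X)%E]/(P (Z' @^-1` (k @^-1` [set x | y < x]))) -H//.
apply: eq_integral => w _; congr (_ * _)%:E; rewrite indicE.
have -> : (Z w \in k @^-1` [set x | y < x]) = (y < k (Z w)) by apply/idP/idP; rewrite inE.
by case: (y < k (Z w)).
Qed.

Section iid_product.
Variables (X : nat -> {RV P >-> R}) (A : set T) (k : R -> R).
Hypothesis mA : measurable A.
Hypothesis AX : forall n (B : nat -> set R), (forall i, measurable (B i)) ->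
  P (A `&` \bigcap_(i in `I_n) X i @^-1` B i) = (P A * \prod_(i < n) P (X 0%N @^-1` B i))%E.
Hypothesis mk : measurable_fun setT k.
Hypothesis k0 : forall x, 0 <= k x.

Let psi : \bar R := (\int[P]_w (k (X 0%N w))%:E)%E.

Let mkX i : measurable_fun setT (fun w => k (X i w)).
Proof. exact: measurableT_comp. Qed.

(** Induction on the number [m] of factors [k]. The spare indicators allow the new factor to be at
    first an arbitrary indicator, which [integral_mul_comp] then exchanges for [k]. *)
Lemma integral_prod_iid_indic m n (B : nat -> set R) : (forall i, measurable (B i)) ->
  (\int[P]_w (\1_A w * \prod_(i < m) k (X i w) * \prod_(i < n) \1_(B i) (X (m + i)%N w))%:E =
   P A * psi ^+ m * \prod_(i < n) P (X 0%N @^-1` B i))%E.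
Proof.
elim: m n B => [|m IH] n B mB.
  rewrite expe0 mule1 -AX// -[A `&` _]setIT bigcap_mkord -integral_indic//; last first.
    apply: measurableI => //; apply: bigsetI_measurable => i _.
    by rewrite -[X in measurable X]setTI; exact: measurable_funPT.
  apply: eq_integral => w _; congr (_ %:E); rewrite big_ord0 mulr1 indicI /=; congr (_ * _).
  apply/esym/(big_morph (fun S : set T => \1_S w : R)).
    by move=> S S'; rewrite indicI.
  by rewrite indicT.
have mW : measurable_fun setT (fun w => \1_A w * \prod_(i < m) k (X i w) *
    \prod_(i < n) \1_(B i) (X (m.+1 + i)%N w)).
  apply: measurable_funM.
    apply: measurable_funM; first exact: measurable_indic.
    by apply: (@measurable_prod _ _ _ _ _ _ (fun i w => k (X (val i) w))).
  apply: (@measurable_prod _ _ _ _ _ _ (fun i w => \1_(B (val i)) (X (m.+1 + val i)%N w))) => i _.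
  by apply: measurableT_comp => //; exact: measurable_indic.
transitivity (\int[P]_w ((\1_A w * \prod_(i < m) k (X i w) *
    \prod_(i < n) \1_(B i) (X (m.+1 + i)%N w)) * k (X m w))%:E)%E.
  by apply: eq_integral => w _; rewrite big_ord_recr/=; congr (_ %:E); ring.
rewrite (@integral_mul_comp _ _ P _ _ (X 0%N) (P A * psi ^+ m * \prod_(i < n) P (X 0%N @^-1` B i))%E) //.
- rewrite -/psi expeS muleAC; congr (_ * _)%E.
  by rewrite -muleA; congr (_ * _)%E; rewrite muleC.
- move=> w; by rewrite mulr_ge0 ?mulr_ge0//; apply: prodr_ge0 => i _.
- rewrite !mule_ge0 ?expe_ge0//; first by apply: integral_ge0 => w _; rewrite lee_fin.
  by apply: prode_ge0.
move=> C mC; pose B' i := if i is j.+1 then B j else C.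
have mB' i : measurable (B' i) by case: i.
transitivity (\int[P]_w (\1_A w * \prod_(i < m) k (X i w) * \prod_(i < n.+1) \1_(B' i) (X (m + i)%N w))%:E)%E.
  apply: eq_integral => w _; rewrite [in RHS]big_ord_recl/= addn0; congr (_ %:E).
  rewrite -[LHS]mulrA [X in _ * X]mulrC; congr (_ * (_ * _)).
  by apply: eq_bigr => i _; rewrite addSnnS.
by rewrite IH// big_ord_recl/= !muleA muleAC.
Qed.

Lemma integral_prod_iid m :
  (\int[P]_(w in A) (\prod_(i < m) k (X i w))%:E = P A * psi ^+ m)%E.
Proof.
have := @integral_prod_iid_indic m 0 (fun=> setT) (fun=> measurableT).
rewrite big_ord0 mule1 => <-.
rewrite [LHS]integral_mkcond; apply: eq_integral => w _.
by rewrite patchE big_ord0 mulr1 indicE; case: ifP; rewrite ?mul1r ?mul0r.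
Qed.

End iid_product.

Lemma measurable_random_index (N : {RV P >-> nat}) (f : nat -> T -> R) :
  (forall n, measurable_fun setT (f n)) -> measurable_fun setT (fun w => f (N w) w).
Proof.
move=> mf _ Y mY.
have -> : setT `&` (fun w => f (N w) w) @^-1` Y =
    \bigcup_n (N @^-1` [set n] `&` f n @^-1` Y).
  by apply/seteqP; split => [w [_ Yw]|w [n _ [/= <-]]]; [exists (N w)|].
apply: bigcup_measurable => n _; apply: measurableI.
  by rewrite -[X in measurable X]setTI; exact: measurable_funPT.
by rewrite -[X in measurable X]setTI; exact: mf.
Qed.

Section random_number.
Variables (X : nat -> {RV P >-> R}) (N : R -> {RV P >-> nat}).
Hypothesis Xiid : iid X.
Hypothesis NX : independent_sigma_algebras P
    (family_sigma_algebra [set: nat] X)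
    (family_sigma_algebra [set t : R | 0 <= t] N).

Lemma random_number_independent (t : R) j n (B : nat -> set R) : 0 <= t ->
  (forall i, measurable (B i)) ->
  P (N t @^-1` [set j] `&` \bigcap_(i in `I_n) X i @^-1` B i) =
  (P (N t @^-1` [set j]) * \prod_(i < n) P (X 0%N @^-1` B i))%E.
Proof.
move=> t0 mB; have [Xind Xid] := Xiid.
have [-> | n0] := eqVneq n 0%N.
  by rewrite big_ord0 mule1; congr (P _); apply/seteqP; split => w; [case|split].
rewrite setIC NX; last 2 first.
- rewrite bigcap_mkord.
  apply: (@bigsetI_measurable _ (g_sigma_algebraType
    (\bigcup_(i in [set: nat]) g_sigma_algebra_preimage (X i)))) => i _.
  apply: sub_sigma_algebra; exists (i : nat) => //.
  by exists (B i) => //; rewrite setTI.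
- apply: sub_sigma_algebra; exists t => //.
  by exists [set j] => //; rewrite setTI.
rewrite muleC; congr (_ * _)%E.
pose J : {fset nat} := [fset i in iota 0 n]%fset.
have JE : [set` J] = `I_n.
  by apply/seteqP; split => i /=; rewrite !inE mem_iota.
rewrite -JE Xind//.
transitivity (\prod_(i <- iota 0 n) P (X 0%N @^-1` B i))%E; last first.
  by rewrite -(big_mkord xpredT (fun i => P (X 0%N @^-1` B i))) /index_iota subn0.
rewrite (perm_big (iota 0 n)); last first.
  by apply: uniq_perm; rewrite ?fset_uniq ?iota_uniq// => i; rewrite !inE.
apply: eq_bigr => i _; exact: (Xid i).
Qed.

(** Splitting over the values of [N t] leaves products of a fixed length. The transform of a random
    sum thus becomes the generating function of [N t] at the transform of one term. *)
Lemma expectation_random_product (t : R) (k : R -> R) : 0 <= t ->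
  measurable_fun setT k -> (forall x, 0 <= k x) -> (forall x, k x <= 1) ->
  \int[P]_w (\prod_(i < N t w) k (X i w)) =
  \int[P]_w (\int[P]_w' k (X 0%N w')) ^+ N t w.
Proof.
move=> t0 mk k0 k1.
have mA j : measurable (N t @^-1` [set j]).
  by rewrite -[X in measurable X]setTI; exact: measurable_funPT.
have NU : setT = \bigcup_j (N t @^-1` [set j]).
  by apply/seteqP; split => w // _; exists (N t w).
have NT : trivIset setT (fun j => N t @^-1` [set j]).
  by apply/trivIsetP => i j _ _ /eqP ij; rewrite -subset0 => w [/= -> ].
have mkX i : measurable_fun setT (fun w => k (X i w)) by exact: measurableT_comp.
have mp : measurable_fun setT (fun w => \prod_(i < N t w) k (X i w)).
  apply: (measurable_random_index _ (f := fun n w => \prod_(i < n) k (X i w))) => n.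
  by apply: (@measurable_prod _ _ _ _ _ _ (fun i w => k (X (val i) w))).
have mpsi : measurable_fun setT (fun w => (\int[P]_w' k (X 0%N w')) ^+ N t w).
  by apply: (measurable_random_index _ (f := fun n w => (\int[P]_w' k (X 0%N w')) ^+ n)).
have fin : (\int[P]_w' (k (X 0%N w'))%:E)%E \is a fin_num.
  apply: integrable_fin_num => //; apply: (@bounded_integrable _ _ _ P _ 1) => // w.
  by rewrite ger0_norm.
have cE : (\int[P]_w' (k (X 0%N w'))%:E)%E = (\int[P]_w' k (X 0%N w'))%:E.
  by rewrite /Rintegral fineK.
have : 0 <= \int[P]_w' k (X 0%N w') by apply: Rintegral_ge0.
move: (\int[P]_w' k (X 0%N w')) mpsi cE => c mpsi cE c0.
rewrite /Rintegral; congr fine; rewrite NU.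
rewrite !ge0_integral_bigcup//; last 4 first.
- exact/measurable_EFinP/measurable_funTS.
- by move=> w _; rewrite lee_fin exprn_ge0.
- exact/measurable_EFinP/measurable_funTS.
- by move=> w _; rewrite lee_fin; apply: prodr_ge0 => i _.
apply: eq_eseriesr => j _.
transitivity (\int[P]_(w in N t @^-1` [set j]) (\prod_(i < j) k (X i w))%:E)%E.
  by apply: eq_integral => w; rewrite inE/= => ->.
rewrite (integral_prod_iid (mA j) _ mk k0); last first.
  by move=> n B mB; exact: random_number_independent.
transitivity (\int[P]_(w in N t @^-1` [set j]) (c ^+ j)%:E)%E; last first.
  by apply: eq_integral => w; rewrite inE/= => ->.
by rewrite integral_cst// muleC EFin_expe cE.
Qed.

End random_number.

End functional_independence.

(** * From distribution functions to Laplace transforms *)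

Section cdf_continuity.
Context {R : realType} d (T : measurableType d) (P : probability T R).

Let F (Z : {RV P >-> R}) x := fine (cdf Z x).

Let F_nd (Z : {RV P >-> R}) : nondecreasing_fun (F Z).
Proof. by move=> x y xy; apply: fine_le; rewrite ?fin_num_measure// cdf_nondecreasing. Qed.

Lemma ae_continuous_cdf (Z : {RV P >-> R}) :
  {ae (@lebesgue_measure R), forall x, {for x, continuous (cdf Z)}}.
Proof.
(* A monotone function has countably many discontinuities in each of these bounded intervals. *)
pose D n := [set x | x \in (`]- n%:R, n%:R[ : interval R) /\ discontinuity (F Z) x].
have cD n : countable (D n).
  by apply: discontinuity_countable => x y _ _; exact: F_nd.
exists (\bigcup_n D n); split.
- apply: bigcup_measurable => n _.
  by apply: countable_measurable => //; exact: measurable_set1.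
- by apply: countable_lebesgue_measure0; apply: bigcup_countable.
move=> x /= nx; exists (Num.truncn `|x|).+1 => //=; split.
  by rewrite in_itv/= -ltr_norml truncnS_gt.
have right : F Z y @[y --> x^'+] --> F Z x.
  by apply: fine_cvg; rewrite fineK ?fin_num_measure//; exact: cdf_right_continuous.
have left : cvg (F Z y @[y --> x^'-]).
  apply: nondecreasing_at_left_is_cvgr.
    by near=> y; exact: in2W (@F_nd Z).
  by near=> y; exists (F Z x) => _ [z /= + <-]; rewrite in_itv/= => /andP[_ zx]; apply: F_nd; exact: ltW.
split=> //; first by apply/cvg_ex; exists (F Z x).
apply/eqP => E; apply: nx.
have cF : {for x, continuous (F Z)}.
  apply/left_right_continuousP; split => //.
  by move: left => /[dup] /cvg_ex[l hl] _; move: E; rewrite (cvg_lim _ hl)// (cvg_lim _ right)// => <-.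
have -> : cdf Z = EFin \o F Z by apply/funext => y /=; rewrite fineK// fin_num_measure.
by apply: cvg_EFin => //; exact: nearW.
Unshelve. all: by end_near.
Qed.

End cdf_continuity.

Section laplace_cdf.
Context {R : realType} d (T : measurableType d) (P : probability T R).
Context d' (T' : measurableType d') (Q : probability T' R).
Notation mu := (@lebesgue_measure R).

(** Under the integral of [th exp (- th y) P (Y > y)], convergence at continuity points is
    convergence almost everywhere. The parameter varies with [n] because it will be [- t ln psi],
    which only tends to its limit. *)
Lemma cvg_laplace_cdf (Y : nat -> {RV P >-> R}) (Z : {RV Q >-> R}) (th : nat -> R) (theta : R) :
  (forall n w, 0 <= Y n w) -> 0 < theta -> th n @[n --> \oo] --> theta ->
  (forall x, {for x, continuous (cdf Z)} -> cdf (Y n) x @[n --> \oo] --> cdf Z x) ->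
  \int[P]_w expR (- (th n * Y n w)) @[n --> \oo] -->
  \int[Q]_w expR (- (theta * positive_part Z w)).
Proof.
move=> Y0 theta0 thc YZ.
have [N _ HN] : \forall n \near \oo, theta / 2 <= th n <= 2 * theta.
  have h1 : theta / 2 < theta by lra.
  have h2 : theta < 2 * theta by lra.
  near=> n; apply/andP; split; near: n.
    exact: (cvgr_ge _ thc).
  exact: (cvgr_le _ thc).
rewrite -(cvg_shiftn N) /=.
pose psi n := \int[P]_w expR (- (th (n + N)%N * Y (n + N)%N w)).
have hN n : theta / 2 <= th (n + N)%N <= 2 * theta by apply: HN => /=; rewrite leq_addl.
have th0 n : 0 <= th (n + N)%N by have /andP[h _] := hN n; apply: le_trans h; lra.
pose f n y := ((qlin_dens 0 (th (n + N)%N) y)%:E * ccdf (Y (n + N)%N) y)%E.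
pose g y := ((qlin_dens 0 theta y)%:E * ccdf Z y)%E.
have psiE n : (1 - psi n)%:E = (\int[mu]_(y in `]0%R, +oo[) f n y)%E.
  have -> : psi n = \int[P]_w expR (- qlin 0 (th (n + N)%N) (Y (n + N)%N w)).
    by apply: eq_Rintegral => w _; rewrite /qlin mul0r add0r.
  rewrite integral_qlin_tail//; apply: eq_integral => y _; rewrite /f; congr (_ * P _)%E.
  by apply/seteqP; split => w /=; rewrite in_itv/= andbT.
have QE : (1 - \int[Q]_w expR (- (theta * positive_part Z w)))%:E =
    (\int[mu]_(y in `]0%R, +oo[) g y)%E.
  have -> : \int[Q]_w expR (- (theta * positive_part Z w)) =
      \int[Q]_w expR (- qlin 0 theta (positive_part Z w)).
    by apply: eq_Rintegral => w _; rewrite /qlin mul0r add0r.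
  rewrite integral_qlin_tail ?(ltW theta0)//; last 2 first.
  - exact: measurable_positive_part.
  - exact: positive_part_ge0.
  apply: eq_integral => y; rewrite inE/= in_itv/= andbT => y0; rewrite /g; congr (_ * Q _)%E.
  apply/seteqP; split => w /=; rewrite in_itv/= andbT /positive_part lt_max.
    by move=> /orP[//|]; rewrite ltNge ltW.
  by move=> ->.
have mq s : measurable_fun (`]0%R, +oo[%classic : set R) (fun y => (qlin_dens 0 s y)%:E).
  by apply/measurable_EFinP/measurable_funTS; exact: measurable_qlin_dens.
have mf n : measurable_fun (`]0%R, +oo[%classic : set R) (f n).
  by apply: emeasurable_funM => //; apply: measurable_funTS; exact: ccdf_measurable.
have mg : measurable_fun (`]0%R, +oo[%classic : set R) g.
  by apply: emeasurable_funM => //; apply: measurable_funTS; exact: ccdf_measurable.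
(* From [theta / 2 <= th] in the exponential and [th <= 2 theta = 4 (theta / 2)] in the
   prefactor. *)
pose h y := (4%:E * (qlin_dens 0 (theta / 2) y)%:E)%E.
have t20 : 0 <= theta / 2 by lra.
have inth : mu.-integrable `]0%R, +oo[ h.
  have mD : measurable (`]0%R, +oo[%classic : set (measurableTypeR R)).
    exact: measurable_itv.
  exact: (@integrableZl _ (measurableTypeR R) R mu _ mD 4 _ (integrable_qlin_dens (lexx 0) t20)).
have [||] := @dominated_convergence _ _ _ mu `]0%R, +oo[%classic (measurable_itv _)
    f g h mf mg _ inth.
- have := ae_continuous_cdf Z; apply: (@filterS _ _ (ae_filter_ringOfSetsType mu)) => y cy _.
  rewrite /g /f; apply: cvgeM => //.
  + by rewrite mule_def_fin// fin_num_measure.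
  + apply: cvg_EFin; first exact: nearW.
    apply: (cvg_comp _ _ (_ : th (n + N)%N @[n --> \oo] --> theta) (_ : qlin_dens 0 t y @[t --> theta] --> qlin_dens 0 theta y)).
      by rewrite (cvg_shiftn N th).
    rewrite /qlin_dens /qlin; apply: cvgM; first by apply: cvgD; [exact: cvg_cst|exact: cvg_id].
    apply: continuous_cvg; first exact: continuous_expR.
    by apply: cvgN; apply: cvgD; [exact: cvg_cst|apply: cvgMr_tmp; exact: cvg_id].
  + rewrite (cvg_shiftn N (fun n => ccdf (Y n) y)) ccdf_1_cdf.
    under eq_cvg do rewrite ccdf_1_cdf.
    apply: cvgeB; [by rewrite fin_num_adde_defl// fin_numN fin_num_measure|exact: cvg_cst|exact: YZ].
- apply: aeW => y n /=; rewrite in_itv/= andbT => y0.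
  have := hN n => /andP[t1 t2].
  have t3 : qlin_dens 0 (th (n + N)%N) y <= 4 * qlin_dens 0 (theta / 2) y.
    rewrite /qlin_dens /qlin !mulr0 !mul0r !add0r mulrA; apply: ler_pM => //.
    + lra.
    + by rewrite ler_expR lerN2 ler_wpM2r// ltW.
  rewrite gee0_abs ?mule_ge0 ?lee_fin ?qlin_dens_ge0 ?(ltW y0)//.
  apply: (@le_trans _ _ ((qlin_dens 0 (th (n + N)%N) y)%:E * 1)%E).
    by rewrite /f lee_wpmul2l ?probability_le1// lee_fin qlin_dens_ge0// ltW.
  by rewrite mule1 /h -EFinM lee_fin.
move=> _ _.
have -> : (fun n => \int[mu]_(x in `]0%R, +oo[) f n x)%E = (fun n => (1 - psi n)%:E).
  by apply/funext => n; rewrite psiE.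
rewrite -QE => /fine_cvg K.
have K' : 1 - (1 - psi n) @[n --> \oo] --> 1 - (1 - \int[Q]_w expR (- (theta * positive_part Z w))).
  by apply: cvgB; [exact: cvg_cst|exact: K].
rewrite opprB addrC subrK in K'.
by apply: cvg_trans K'; apply: near_eq_cvg; near=> n; rewrite opprB addrC subrK.
Unshelve. all: by end_near.
Qed.

End laplace_cdf.

(** * Laplace transform of the normalized random sums *)

Section log_asymptotics.
Context {R : realType}.

Lemma cvg1_of_mul (t psi : nat -> R) (D : R) : t n @[n --> \oo] --> +oo ->
  t n * (1 - psi n) @[n --> \oo] --> D -> psi n @[n --> \oo] --> (1 : R).
Proof.
move=> too tD.
have ti : (t n)^-1 @[n --> \oo] --> (0 : R).
  by apply/(gtr0_cvgV0 (f := t)) => //; move/cvgryPgt : too; exact.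
have K : 1 - (t n * (1 - psi n)) * (t n)^-1 @[n --> \oo] --> 1 - D * 0.
  by apply: cvgB; [exact: cvg_cst|exact: cvgM].
rewrite mulr0 subr0 in K; apply: cvg_trans K; apply: near_eq_cvg; near=> n.
have tn : 0 < t n by near: n; move/cvgryPgt : too; exact.
by rewrite mulrAC mulfV ?gt_eqF// mul1r opprB addrC subrK.
Unshelve. all: by end_near.
Qed.

(** Squeeze from [1 - x <= - ln x <= 1 / x - 1], with [psi] tending to 1. *)
Lemma cvg_mul_oppln (t psi : nat -> R) (D : R) : t n @[n --> \oo] --> +oo ->
  t n * (1 - psi n) @[n --> \oo] --> D ->
  t n * - ln (psi n) @[n --> \oo] --> D.
Proof.
move=> too tD; have p1 := cvg1_of_mul too tD.
have K2 : (t n * (1 - psi n)) * (psi n)^-1 @[n --> \oo] --> D.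
  have : (t n * (1 - psi n)) * (psi n)^-1 @[n --> \oo] --> D * 1^-1.
    by apply: cvgM => //; apply: cvgV => //; exact: oner_neq0.
  by rewrite invr1 mulr1.
apply: (squeeze_cvgr _ tD K2); near=> n.
have tn : 0 <= t n by near: n; move/cvgryPge : too; exact.
have p0 : 0 < psi n by near: n; exact: (cvgr_gt _ p1).
apply/andP; split.
  rewrite ler_wpM2l// lerNr opprB.
  have := @le_ln1Dx _ (psi n - 1); rewrite (addrC 1) subrK; apply.
  by rewrite ltrBrDl subrr.
rewrite -mulrA ler_wpM2l// mulrBl mul1r divff ?gt_eqF//.
have := @le_ln1Dx _ ((psi n)^-1 - 1); rewrite (addrC 1) subrK lnV ?posrE//; apply.
by rewrite ltrBrDl subrr invr_gt0.
Unshelve. all: by end_near.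
Qed.

End log_asymptotics.

Section random_sum_laplace.
Context {R : realType} d (T : measurableType d) (P : probability T R).
Context d' (T' : measurableType d') (Q : probability T' R).
Variables (X : nat -> {RV P >-> R}) (N : R -> {RV P >-> nat}) (Lambda : {RV Q >-> R}).
Variable alpha : R.
Hypothesis alpha01 : 0 < alpha < 1.
Hypothesis Xiid : iid X.
Hypothesis NX : independent_sigma_algebras P
    (family_sigma_algebra [set: nat] X)
    (family_sigma_algebra [set t : R | 0 <= t] N).
Hypothesis Xpareto : pareto_type alpha (distr_fun (X 0%N)).
Hypothesis NL : cvg_in_distribution P Q (fun t => time_average N t) Lambda.

Definition random_sum (p : nat) (b t : R) w :=
  \sum_(i < N t w) (b * positive_part (X i) w) ^+ p.

Lemma measurable_random_sum p b t : measurable_fun setT (random_sum p b t).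
Proof.
apply: (measurable_random_index _ (f := fun n w => \sum_(i < n) (b * positive_part (X i) w) ^+ p)) => n.
apply: (@measurable_sum _ _ _ _ _ _ (fun i w => (b * positive_part (X (val i)) w) ^+ p)) => i.
by apply: measurable_funX; apply: measurable_funM => //; exact: measurable_positive_part.
Qed.

Lemma random_sum_ge0 p b t w : 0 <= b -> 0 <= random_sum p b t w.
Proof. by move=> b0; apply: sumr_ge0 => i _; rewrite exprn_ge0// mulr_ge0 ?positive_part_ge0. Qed.

Lemma cvg_random_sum_laplace : exists a : R -> R, (forall t, 0 < a t) /\
  forall (t : nat -> R) r s, (forall n, 0 < t n) -> t n @[n --> \oo] --> +oo ->
  0 <= r -> 0 <= s ->
  \int[P]_w expR (- (r * random_sum 2 (a (t n)) (t n) w + s * random_sum 1 (a (t n)) (t n) w))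
    @[n --> \oo] -->
  \int[Q]_w expR (- (fine (stable_exponent alpha r s) * positive_part Lambda w)).
Proof.
have [a [a0 Ha]] := laplace_normalization alpha01 Xpareto.
exists (fun t => (a t)^-1); split; first by move=> t; rewrite invr_gt0.
move=> t r s t0 too r0 s0.
(* [cvg_laplace_cdf] asks for a positive limit parameter, while the exponent vanishes at
   [r = s = 0]. *)
have [rs0|rs_neq0] := eqVneq (r + s) 0.
  have [-> ->] : r = 0 /\ s = 0 by lra.
  have one d1 (T1 : measurableType d1) (P1 : probability T1 R) (f : T1 -> R) :
      (forall w, f w = 1) -> \int[P1]_w f w = 1.
    by move=> f1; rewrite (_ : f = cst 1) ?Rintegral_cst1//; exact/funext.
  rewrite one; last by move=> w; rewrite stable_exponent00 mul0r oppr0 expR0.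
  rewrite (_ : (fun n => _) = cst 1); first exact: cvg_cst.
  by apply/funext => n; rewrite one// => w; rewrite !mul0r addr0 oppr0 expR0.
have rs : 0 < r + s by rewrite lt_neqAle eq_sym rs_neq0 addr_ge0.
pose b n := (a (t n))^-1.
have b0 n : 0 <= b n by rewrite invr_ge0 ltW.
pose k n x := expR (- qlin r s (b n * Num.max x 0)).
have k0 n x : 0 <= k n x by exact: expR_ge0.
have k1 n x : k n x <= 1.
  by rewrite expR_le1 oppr_le0 qlin_ge0// mulr_ge0// le_max lexx orbT.
have mk n : measurable_fun [set: R] (k n).
  apply: measurableT_comp => //; apply: measurableT_comp => //.
  apply: (measurableT_comp (measurable_qlin r s)).
  by apply: measurable_funM => //; exact: measurable_maxr.
pose psi n := \int[P]_w k n (X 0%N w).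
have E n : \int[P]_w expR (- (r * random_sum 2 (b n) (t n) w + s * random_sum 1 (b n) (t n) w)) =
    \int[P]_w psi n ^+ N (t n) w.
  rewrite -expectation_random_product ?(ltW (t0 n))//; apply: eq_Rintegral => w _.
  rewrite -expR_sum sumrN; congr (expR (- _)).
  rewrite /random_sum !big_distrr/= -big_split/=.
  by apply: eq_bigr => i _; rewrite /qlin expr1.
have D0 : 0 < fine (stable_exponent alpha r s).
  rewrite -lte_fin fineK ?stable_exponent_gt0//.
  exact: stable_exponent_fin_num.
have H := Ha r s t r0 s0 too.
have p1 := cvg1_of_mul too H.
have K := cvg_mul_oppln too H.
have Y0 n w : 0 <= time_average N (t n) w by rewrite divr_ge0// ltW.
(* [psi^N] equals [exp (- (- t ln psi) (N / t))]: the transform of the time average at a moving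
   parameter. *)
have L := @cvg_laplace_cdf _ _ _ P _ _ Q (fun n => time_average N (t n)) Lambda
  (fun n => t n * - ln (psi n)) _ Y0 D0 K.
have {}L := L (fun x cx => cvg_comp _ _ too (NL cx)).
apply: cvg_trans L; apply: near_eq_cvg; near=> n.
have p0 : 0 < psi n by near: n; exact: (cvgr_gt _ p1).
have tn := t0 n.
rewrite -/(b n) E; apply: eq_Rintegral => w _.
rewrite /= /time_average -[psi n in RHS]lnK ?posrE// -expRM_natl; congr expR.
by field; rewrite gt_eqF.
Unshelve. all: by end_near.
Qed.

End random_sum_laplace.

Lemma cvg_expR_oppMy (R : realType) (c : nat -> R) v : c n @[n --> \oo] --> +oo -> 0 < v ->
  expR (- (c n * v)) @[n --> \oo] --> (0 : R).
Proof.
move=> coo v0.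
have cvoo : c n * v @[n --> \oo] --> +oo.
  apply/cvgryPge => A; move/cvgryPge : coo => /(_ (A / v)).
  by apply: filterS => n; rewrite ler_pdivrMr.
exact: (cvg_comp _ _ cvoo (@cvgr_expR R)).
Qed.

(** * Almost sure statements from integrals *)

Section almost_surely.
Context {R : realType} d (T : measurableType d) (P : probability T R).

Lemma ae_of_probability1 (A : set T) : measurable A -> P A = 1%E ->
  {ae P, forall w, A w}.
Proof.
move=> mA PA; exists (~` A); split; [exact: measurableC| |by []].
by rewrite probability_setC// PA subee.
Qed.

Lemma ae_integral_eq (f g : T -> R) : measurable_fun setT f -> measurable_fun setT g ->
  {ae P, forall w, f w = g w} -> (\int[P]_w (f w)%:E = \int[P]_w (g w)%:E)%E.
Proof.
move=> mf mg fg; apply: ae_eq_integral => //; [exact/measurable_EFinP|exact/measurable_EFinP|].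
by apply: filterS fg => w fgw _; rewrite fgw.
Qed.

Lemma ae_probability_eq (A B : set T) : measurable A -> measurable B ->
  {ae P, forall w, A w <-> B w} -> P A = P B.
Proof.
move=> mA mB AB; rewrite -[A]setIT -[B]setIT -!integral_indic//.
apply: ae_integral_eq; [exact: measurable_indic|exact: measurable_indic|].
apply: filterS AB => w ABw; rewrite !indicE; congr (_%:R); congr nat_of_bool.
by apply/idP/idP; rewrite !inE => /ABw.
Qed.

(* On [V < 0] one has [n * - V <= expR (- n * V)], so [W * - V] has integral at
   most [1 / n] there. *)
Lemma ae_ge0_of_laplace (W V : T -> R) : measurable_fun setT W -> measurable_fun setT V ->
  (forall w, 0 < W w) ->
  (forall n : nat, \int[P]_w (W w * expR (- (n.+1%:R * V w)))%:E <= 1)%E ->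
  {ae P, forall w, 0 <= V w}.
Proof.
move=> mW mV W0 H.
pose g w := W w * Num.max (- V w) 0.
have mg : measurable_fun setT g.
  by apply: measurable_funM => //; apply: measurable_maxr => //; exact: measurableT_comp.
have g0 w : 0 <= g w by rewrite mulr_ge0 ?(ltW (W0 w))// le_max lexx orbT.
have gn (n : nat) : (n.+1%:R%:E * \int[P]_w (g w)%:E <= 1)%E.
  rewrite -ge0_integralZl//; last 2 first.
  - exact/measurable_EFinP.
  - by move=> w _; rewrite lee_fin.
  apply: le_trans (H n); apply: ge0_le_integral => //.
  - by move=> w _; rewrite -EFinM lee_fin mulr_ge0.
  - by apply/measurable_EFinP; apply: measurable_funM.
  - apply/measurable_EFinP; apply: measurable_funM => //; apply: measurableT_comp => //.
    by apply: measurableT_comp => //; exact: measurable_funM.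
  move=> w _; rewrite -EFinM lee_fin /g mulrCA ler_wpM2l ?(ltW (W0 w))//.
  case: (leP (- V w) 0) => h; first by rewrite mulr0 expR_ge0.
  by rewrite -mulrN (le_trans _ (expR_ge1Dx _))// lerDr.
have Ig0 : (0 <= \int[P]_w (g w)%:E)%E by apply: integral_ge0 => w _; rewrite lee_fin.
have Ig : (\int[P]_w (g w)%:E = 0)%E.
  apply/eqP; rewrite eq_le Ig0 andbT.
  move: gn Ig0; case: (\int[P]_w (g w)%:E)%E => [x| |]; last by [].
    move=> gn _; rewrite lee_fin leNgt; apply/negP => x0.
    have := gn (Num.truncn x^-1); rewrite -EFinM lee_fin leNgt => /negP; apply.
    by rewrite -ltr_pdivrMr// mul1r truncnS_gt.
  by move=> /(_ 0%N); rewrite mul1e.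
have : (\int[P]_w `|(g w)%:E| = 0)%E.
  by rewrite -Ig; apply: eq_integral => w _; rewrite gee0_abs ?lee_fin.
have mgE : measurable_fun setT (EFin \o g) by exact/measurable_EFinP.
move=> /(ae_eq_integral_abs _ measurableT mgE).
apply: filterS => w /(_ I) [gw]; rewrite leNgt; apply/negP => Vw.
move/eqP: gw; rewrite mulf_eq0 gt_eqF//= max_l ?oppr_ge0 ?(ltW Vw)//.
by rewrite oppr_eq0 lt_eqF.
Qed.

(** The mass at [c] is at most [F (c) - F (c - 1 / (n + 1))], for [F] the distribution function of
    [Z]; this tends to 0 by continuity. *)
Lemma cdf_continuous_atom (Z : {RV P >-> R}) c : {for c, continuous (cdf Z)} ->
  P [set w | Z w = c] = 0%E.
Proof.
move=> cZ.
have mZ (B : set R) : measurable B -> measurable (Z @^-1` B).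
  by move=> mB; rewrite -[X in measurable X]setTI; exact: measurable_funPT.
have mE : measurable [set w | Z w = c] by apply: (mZ [set c]); exact: measurable_set1.
have le n : (P [set w | Z w = c] + cdf Z (c - n.+1%:R^-1) <= cdf Z c)%E.
  rewrite /cdf /distribution /pushforward /= -measureU//; last 2 first.
  - exact: mZ.
  - rewrite -subset0 => w [/= -> ]; rewrite in_itv/= => h.
    by move: h; rewrite leNgt gtrBl invr_gt0 ltr0n.
  apply: le_measure; rewrite ?inE; [apply: measurableU => //; exact: mZ|exact: mZ|].
  move=> w [/= ->|/=]; rewrite !in_itv/=; first exact: lexx.
  move=> h; apply: le_trans h _; by rewrite gerBl invr_ge0.
have cv : cdf Z (c - n.+1%:R^-1) @[n --> \oo] --> cdf Z c.
  have h : c - n.+1%:R^-1 @[n --> \oo] --> c.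
    have : c - n.+1%:R^-1 @[n --> \oo] --> c - 0.
      by apply: cvgB; [exact: cvg_cst|exact: cvg_harmonic].
    by rewrite subr0.
  exact: (cvg_comp _ _ h cZ).
have : (P [set w | Z w = c] + cdf Z c <= cdf Z c)%E.
  have h : (P [set w | Z w = c] + cdf Z (c - n.+1%:R^-1))%E @[n --> \oo] -->
      (P [set w | Z w = c] + cdf Z c)%E.
    by apply: cvgeD => //; [rewrite fin_num_adde_defl// fin_num_measure|exact: cvg_cst].
  rewrite -(cvg_lim _ h)//; apply: lime_le; first by apply/cvg_ex; eexists; exact: h.
  by apply: nearW => n; exact: le.
rewrite -leeBrDr ?fin_num_measure// subee ?fin_num_measure// => h.
by apply/eqP; rewrite eq_le h measure_ge0.
Qed.

End almost_surely.

(** * Properties of the limiting pair read off its transform *)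

Section stable_pair.
Context {R : realType} d (T : measurableType d) (P : probability T R).
Context d' (T' : measurableType d') (Q : probability T' R).
Variables (U V : {RV P >-> R}) (Lambda : {RV Q >-> R}) (alpha : R).
Hypothesis alpha01 : 0 < alpha < 1.
Hypothesis Lambda_gt0 : Q [set w | 0 < Lambda w] = 1%E.
Hypothesis UV : has_joint_laplace alpha Lambda U V.

Let D r s := fine (stable_exponent alpha r s).

Let D_ge0 r s : 0 <= r -> 0 <= s -> 0 <= D r s.
Proof. by move=> r0 s0; apply/fine_ge0/stable_exponent_ge0. Qed.

Let deltaE r s : 0 < r -> 0 <= s -> delta alpha r s = D r s.
Proof. by move=> r0 s0; rewrite /D -delta_stable_exponent. Qed.

Let mexp d1 (T1 : measurableType d1) (f : T1 -> R) : measurable_fun setT f ->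
  measurable_fun setT (fun w => expR (f w)).
Proof. by move=> mf; exact: measurableT_comp. Qed.

Let Lp_gt0 : {ae Q, forall w, 0 < Lambda w}.
Proof.
apply: ae_of_probability1 => //.
rewrite -[X in measurable X]setTI.
by have := measurable_fun_ltr (measurable_cst (0 : R)) (measurable_funPT Lambda); apply.
Qed.

Let Lp_eq : {ae Q, forall w, Lambda w = positive_part Lambda w}.
Proof. by apply: filterS Lp_gt0 => w h; rewrite /positive_part max_l// ltW. Qed.

Let mL := measurable_positive_part Lambda.

Let Lint theta : measurable_fun setT (fun w => expR (- (theta * positive_part Lambda w))).
Proof. by apply: mexp; apply: measurableT_comp => //; exact: measurable_funM. Qed.

Lemma expectation_mixing theta : 0 <= theta ->
  ('E_Q[fun w => expR (- theta * Lambda w)] =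
   (\int[Q]_w expR (- (theta * positive_part Lambda w)))%:E)%E.
Proof.
move=> t0; rewrite unlock /Rintegral fineK; last first.
  apply: integrable_fin_num => //; apply: (@bounded_integrable _ _ _ Q _ 1) => // w.
  by rewrite norm_expRN_le1// mulr_ge0// positive_part_ge0.
apply: ae_integral_eq => //; first by apply: mexp; exact: measurable_funM.
by apply: filterS Lp_eq => w ->; rewrite mulNr.
Qed.

Let joint_le1 r s : 0 < r -> 0 <= s ->
  (\int[P]_w (expR (- r * U w - s * V w))%:E <= 1)%E.
Proof.
move=> r0 s0; have := UV r0 s0; rewrite expectation_mixing ?deltaE ?D_ge0 ?(ltW r0)//.
rewrite unlock => ->; rewrite lee_fin.
rewrite -(Rintegral_cst1 Q).
apply: le_Rintegral => //.
- apply: (@bounded_integrable _ _ _ Q _ 1) => // w.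
  by rewrite norm_expRN_le1// mulr_ge0 ?positive_part_ge0 ?D_ge0// ltW.
- by apply: (@bounded_integrable _ _ _ Q _ 1) => // w; rewrite normr1.
- by move=> w _; rewrite /= expR_le1 oppr_le0 mulr_ge0 ?positive_part_ge0 ?D_ge0// ltW.
Qed.

(** A transform bounded by 1 leaves no mass on negative values. For [V] the weight [exp (- U)]
    enters, because the transform is given for [r > 0]. *)
Lemma stable_pair_ge0 : {ae P, forall w, 0 <= U w /\ 0 <= V w}.
Proof.
have U0 : {ae P, forall w, 0 <= U w}.
  apply: (@ae_ge0_of_laplace _ _ _ P (cst 1)) => // n.
  apply: le_trans (joint_le1 (ltr0Sn R n) (lexx 0)).
  rewrite le_eqVlt; apply/orP; left; apply/eqP; apply: eq_integral => w _.
  by rewrite /= mul1r mul0r subr0 mulNr.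
have V0 : {ae P, forall w, 0 <= V w}.
  apply: (@ae_ge0_of_laplace _ _ _ P (fun w => expR (- U w))) => //.
  - by apply: mexp; exact: measurableT_comp.
  - by move=> w; exact: expR_gt0.
  move=> n; apply: le_trans (joint_le1 ltr01 (ler0n R n.+1)).
  rewrite le_eqVlt; apply/orP; left; apply/eqP; apply: eq_integral => w _.
  by rewrite /= -expRD mulN1r.
by apply: filterS2 U0 V0.
Qed.

Let UV_eq : {ae P, forall w, U w = positive_part U w /\ V w = positive_part V w}.
Proof.
by apply: filterS stable_pair_ge0 => w [u0 v0]; rewrite /positive_part !max_l.
Qed.

Let mU := measurable_positive_part U.
Let mV := measurable_positive_part V.

Let mUV r s : measurable_fun setT
  (fun w => expR (- (r * positive_part U w + s * positive_part V w))).
Proof.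
by apply: mexp; apply: measurableT_comp => //; apply: measurable_funD; exact: measurable_funM.
Qed.

Let UVb r s w : 0 <= r -> 0 <= s ->
  `|expR (- (r * positive_part U w + s * positive_part V w))| <= 1.
Proof.
move=> r0 s0; apply: norm_expRN_le1.
by rewrite addr_ge0// mulr_ge0// positive_part_ge0.
Qed.

Lemma expectation_stable_pair r s : 0 <= r -> 0 <= s ->
  ('E_P[fun w => expR (- r * U w - s * V w)] =
   (\int[P]_w expR (- (r * positive_part U w + s * positive_part V w)))%:E)%E.
Proof.
move=> r0 s0; rewrite unlock /Rintegral fineK; last first.
  apply: integrable_fin_num => //; apply: (@bounded_integrable _ _ _ P _ 1) => // w.
  exact: UVb.
apply: ae_integral_eq => //.
  by apply: mexp; apply: measurable_funB; exact: measurable_funM.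
by apply: filterS UV_eq => w [<- <-]; rewrite opprD mulNr.
Qed.

(** The prescribed identity reaches [r = 0] through [r = 1 / (n + 1)], both sides being continuous
    along this sequence. *)
Lemma stable_pair_laplace r s : 0 <= r -> 0 <= s ->
  \int[P]_w expR (- (r * positive_part U w + s * positive_part V w)) =
  \int[Q]_w expR (- (D r s * positive_part Lambda w)).
Proof.
have pos r' s' : 0 < r' -> 0 <= s' ->
    \int[P]_w expR (- (r' * positive_part U w + s' * positive_part V w)) =
    \int[Q]_w expR (- (D r' s' * positive_part Lambda w)).
  move=> r0 s0; have := UV r0 s0.
  by rewrite expectation_mixing ?deltaE ?D_ge0 ?(ltW r0)// expectation_stable_pair ?(ltW r0)// => -[].
rewrite le_eqVlt => /orP[/eqP<-|]; last exact: pos.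
rewrite le_eqVlt => /orP[/eqP<-|s0].
  rewrite /D stable_exponent00.
  under eq_Rintegral do rewrite !mul0r addr0 oppr0 expR0.
  under [RHS]eq_Rintegral do rewrite mul0r oppr0 expR0.
  by rewrite !Rintegral_cst1.
have L1 : \int[P]_w expR (- (n.+1%:R^-1 * positive_part U w + s * positive_part V w)) @[n --> \oo] -->
    \int[P]_w expR (- (0 * positive_part U w + s * positive_part V w)).
  apply: (@cvg_Rintegral_bounded _ _ _ P _ _ 1) => //.
    by move=> n w; apply: UVb => //; exact: ltW.
  apply: aeW => w; apply: continuous_cvg; first exact: continuous_expR.
  apply: cvgN; apply: cvgD; last exact: cvg_cst.
  by apply: cvgMr_tmp; exact: cvg_harmonic.
have Dc : D n.+1%:R^-1 s @[n --> \oo] --> D 0 s.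
  have := cvg_stable_exponent_r0 alpha01 (ltW s0).
  by rewrite -{1}(fineK (stable_exponent_fin_num alpha01 (lexx 0) (ltW s0))) => /fine_cvg.
have L2 : \int[Q]_w expR (- (D n.+1%:R^-1 s * positive_part Lambda w)) @[n --> \oo] -->
    \int[Q]_w expR (- (D 0 s * positive_part Lambda w)).
  apply: (@cvg_Rintegral_bounded _ _ _ Q _ _ 1) => //.
    move=> n w; apply: norm_expRN_le1.
    by rewrite mulr_ge0 ?positive_part_ge0// D_ge0// ltW.
  apply: aeW => w; apply: continuous_cvg; first exact: continuous_expR.
  by apply: cvgN; apply: cvgMr_tmp; exact: Dc.
apply: (cvg_unique _ L1); first exact: norm_hausdorff.
apply: cvg_trans L2; apply: near_eq_cvg; apply: nearW => n.
by rewrite pos// ltW.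
Qed.

Lemma stable_laplace_l r : 0 <= r ->
  ('E_P[fun w => expR (- r * U w)] =
   'E_Q[fun w => expR (- (r `^ (alpha / 2) * Gamma (1 - alpha / 2)) * Lambda w)])%E.
Proof.
move=> r0.
have -> : (fun w => expR (- r * U w)) = (fun w => expR (- r * U w - 0 * V w)).
  by apply/funext => w; rewrite mul0r subr0.
have E : r `^ (alpha / 2) * Gamma (1 - alpha / 2) = D r 0.
  move: r0; rewrite le_eqVlt => /orP[/eqP<-|r0].
    rewrite /D stable_exponent00 powR0 ?mul0r//.
    by have /andP[a0 _] := alpha01; rewrite mulf_neq0// gt_eqF.
  by rewrite /D stable_exponent_r0.
by rewrite E expectation_stable_pair// stable_pair_laplace// expectation_mixing// D_ge0.
Qed.

Lemma stable_laplace_r s : 0 <= s ->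
  ('E_P[fun w => expR (- s * V w)] =
   'E_Q[fun w => expR (- (s `^ alpha * Gamma (1 - alpha)) * Lambda w)])%E.
Proof.
move=> s0.
have -> : (fun w => expR (- s * V w)) = (fun w => expR (- 0 * U w - s * V w)).
  by apply/funext => w; rewrite oppr0 mul0r sub0r mulNr.
have E : s `^ alpha * Gamma (1 - alpha) = D 0 s.
  move: s0; rewrite le_eqVlt => /orP[/eqP<-|s0].
    rewrite /D stable_exponent00 powR0 ?mul0r//.
    by have /andP[a0 _] := alpha01; rewrite gt_eqF.
  by rewrite /D stable_exponent_0s.
by rewrite E expectation_stable_pair// stable_pair_laplace// expectation_mixing// D_ge0.
Qed.

Let cvg_expRny (a : R) : 0 < a -> expR (n%:R * a) @[n --> \oo] --> +oo.
Proof.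
move=> a0; apply/cvgryPge => A; near=> n.
apply: le_trans (expR_ge1Dx _); rewrite -lerBlDl -ler_pdivrMr//.
by near: n; exact: nbhs_infty_ger.
Unshelve. all: by end_near.
Qed.

(** The transform at [(0, exp n)] tends to the probability of [V = 0]. The exponent there is a
    positive multiple of [exp (n alpha)] and [Lambda] is positive, so the limit is 0. Without mass
    at [V = 0], [U / V^2 <= c] means [U <= c V^2] in spite of the convention for division by 0. *)
Lemma stable_pair_gt0 : {ae P, forall w, 0 < V w}.
Proof.
have /andP[al0 al1] := alpha01.
have mV0 : measurable [set w | positive_part V w = 0].
  by rewrite -[X in measurable X]setTI; apply: (mV measurableT (measurable_set1 0)).
have L1 : \int[P]_w expR (- (0 * positive_part U w + expR n%:R * positive_part V w)) @[n --> \oo] -->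
    \int[P]_w \1_[set w | positive_part V w = 0] w.
  apply: (@cvg_Rintegral_bounded _ _ _ P _ _ 1) => //.
    by move=> n w; apply: UVb => //; exact: expR_ge0.
  apply: aeW => w; under eq_fun do rewrite mul0r add0r.
  have [V0|V0] := eqVneq (positive_part V w) 0.
    rewrite indicE mem_set//= V0; under eq_fun do rewrite mulr0 oppr0 expR0.
    exact: cvg_cst.
  rewrite indicE memNset//=; last exact/eqP.
  apply: cvg_expR_oppMy; last by rewrite lt_neqAle eq_sym V0 positive_part_ge0.
  by under eq_fun do rewrite -[X in expR X]mulr1; exact: cvg_expRny.
have L2 : \int[P]_w expR (- (0 * positive_part U w + expR n%:R * positive_part V w)) @[n --> \oo] -->
    \int[Q]_w (cst 0 w).
  under eq_fun do rewrite stable_pair_laplace ?expR_ge0//.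
  apply: (@cvg_Rintegral_bounded _ _ _ Q _ _ 1) => //.
    move=> n w; apply: norm_expRN_le1.
    by rewrite mulr_ge0 ?positive_part_ge0// D_ge0// expR_ge0.
  have C0 : 0 < D 0 1.
    rewrite /D -lte_fin fineK ?stable_exponent_fin_num// stable_exponent_gt0// add0r.
  have DE n : D 0 (expR n%:R) = expR (n%:R * alpha) * D 0 1.
    by rewrite /D !stable_exponent_0s ?expR_gt0//= powR1 mul1r expRM.
  apply: filterS2 Lp_gt0 Lp_eq => w l0 lE /=.
  under eq_fun do rewrite DE -mulrA.
  apply: cvg_expR_oppMy; first exact: cvg_expRny.
  by rewrite mulr_gt0// -lE.
have E : \int[P]_w \1_[set w | positive_part V w = 0] w = 0.
  rewrite -(cvg_unique _ L2 L1) ?Rintegral_cst ?mul0r//.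
rewrite -probability_indic// in E.
have PV0 : P [set w | positive_part V w = 0] = 0%E.
  by rewrite -[LHS]fineK ?fin_num_measure// E.
have : {ae P, forall w, positive_part V w <> 0}.
  by exists [set w | positive_part V w = 0]; split => // w /= /contrapT.
apply: filterS2 UV_eq => w [_ ->] h.
by rewrite lt_neqAle positive_part_ge0 andbT eq_sym; exact/eqP.
Qed.

Let mRV (Z : T -> R) (B : set R) : measurable_fun setT Z -> measurable B ->
  measurable (Z @^-1` B).
Proof. by move=> mZ mB; rewrite -[X in measurable X]setTI; exact: mZ. Qed.

Lemma cdf_quotient_sqr c :
  cdf (P := P) (quotient_sqr U V) c =
  P [set w | positive_part U w <= c * positive_part V w ^+ 2].
Proof.
rewrite -[LHS]/(P (quotient_sqr U V @^-1` `]-oo, c])).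
apply: ae_probability_eq; [exact: mRV|exact: measurable_le_sqr|].
apply: filterS2 UV_eq stable_pair_gt0 => w [uE vE] v0.
rewrite /= in_itv/= /quotient_sqr -uE -vE ler_pdivrMr// exprn_gt0//.
Qed.

Lemma atom_quotient_sqr c : {for c, continuous (cdf (P := P) (quotient_sqr U V))} ->
  P [set w | positive_part U w = c * positive_part V w ^+ 2] = 0%E.
Proof.
move=> /cdf_continuous_atom <-; apply: ae_probability_eq => //.
- rewrite (_ : mkset _ = (fun w => positive_part U w - c * positive_part V w ^+ 2) @^-1` [set 0]).
    apply: mRV; last exact: measurable_set1.
    by apply: measurable_funB => //; apply: measurable_funM => //; exact: measurable_funX.
  by apply/seteqP; split => w /=; [move=> ->; rewrite subrr|move/eqP; rewrite subr_eq0 => /eqP].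
- exact: (mRV _ (measurable_set1 c)).
apply: filterS2 UV_eq stable_pair_gt0 => w [uE vE] v0.
rewrite /= /quotient_sqr -uE -vE; split => [->|<-].
  by rewrite mulfK// gt_eqF// exprn_gt0.
by rewrite divfK// gt_eqF// exprn_gt0.
Qed.

End stable_pair.

(** * Convergence of the sample dispersion *)

Section sample_dispersion_limit.
Context {R : realType} d (T : measurableType d) (P : probability T R).
Context d' (T' : measurableType d') (Q : probability T' R).
Context d0 (T0 : measurableType d0) (P0 : probability T0 R).
Variables (X : nat -> {RV P >-> R}) (N : R -> {RV P >-> nat}) (Lambda : {RV Q >-> R}).
Variables (U V : {RV P0 >-> R}) (alpha : R).
Hypothesis Xiid : iid X.
Hypothesis X_gt0 : forall i, P [set w | 0 < X i w] = 1%E.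
Hypothesis NX : independent_sigma_algebras P
    (family_sigma_algebra [set: nat] X)
    (family_sigma_algebra [set t : R | 0 <= t] N).
Hypothesis alpha01 : 0 < alpha < 1.
Hypothesis Xpareto : pareto_type alpha (distr_fun (X 0%N)).
Hypothesis NL : D_averages_in_time N Lambda.
Hypothesis UV : has_joint_laplace alpha Lambda U V.

Let ae_X_gt0 : {ae P, forall w, forall i, 0 < X i w}.
Proof.
apply/ae_foralln => i; apply: ae_of_probability1; last exact: X_gt0.
rewrite -[X in measurable X]setTI.
by have := measurable_fun_ltr (measurable_cst (0 : R)) (measurable_funPT (X i)); apply.
Qed.

(** The scale [b] cancels. When [N t] is 0, both events hold: the dispersion is 0 by convention, the
    sums are empty, and [0 <= c]. *)
Let cdf_sample_dispersion (b t c : R) : 0 < b -> 0 <= c ->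
  cdf (P := P) (sample_dispersion X (N t)) c =
  P [set w | random_sum X N 2 b t w <= c * random_sum X N 1 b t w ^+ 2].
Proof.
move=> b0 c0.
rewrite -[LHS]/(P (sample_dispersion X (N t) @^-1` `]-oo, c])).
apply: ae_probability_eq.
- rewrite -[X in measurable X]setTI.
  by apply: (measurable_sample_dispersion X (N t)).
- by apply: measurable_le_sqr; exact: measurable_random_sum.
apply: filterS ae_X_gt0 => w X0.
rewrite /= in_itv/= /sample_dispersion /random_sum.
have XE p : \sum_(i < N t w) (b * positive_part (X i) w) ^+ p = b ^+ p * \sum_(i < N t w) X i w ^+ p.
  by rewrite big_distrr/=; apply: eq_bigr => i _; rewrite exprMn /positive_part max_l// ltW.
rewrite !XE expr1 exprMn mulrCA ler_pM2l ?exprn_gt0//.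
case: ifPn => N1; last first.
  by move: N1; rewrite lt0n negbK => /eqP ->; rewrite !big_ord0 expr0n mulr0 lexx c0.
under [X in _ * X ^+ _]eq_bigr do rewrite expr1.
rewrite ler_pdivrMr// exprn_gt0//.
move: (N t w) N1 => [//|m] _; rewrite big_ord_recr/= ltr_wpDl//.
by apply: sumr_ge0 => i _; exact: ltW.
Qed.

Lemma cvg_sample_dispersion :
  cvg_in_distribution P P0 (fun t => sample_dispersion X (N t)) (quotient_sqr U V).
Proof.
have [L0 NLcvg] := NL.
move=> c cZ; apply/cvge_pinftyP => u uoo.
(* A sequence tending to infinity may start below 0, whereas the limit of the random sums is stated
   along positive times. *)
pose t n := Num.max 1 (u n).
have t0 n : 0 < t n by rewrite lt_max ltr01.
have ut : \forall n \near \oo, t n = u n.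
  by near=> n; rewrite /t max_r//; near: n; move/cvgryPge : uoo; exact.
have too : t n @[n --> \oo] --> +oo.
  apply: cvg_trans uoo; apply: near_eq_cvg.
  by apply: filterS ut.
suff H : cdf (P := P) (sample_dispersion X (N (t n))) c @[n --> \oo] -->
    cdf (P := P0) (quotient_sqr U V) c.
  by apply: cvg_trans H; apply: near_eq_cvg; apply: filterS ut => n ->.
(* For negative [c] both distribution functions vanish; the ramps along [u = c v^2] require
   [0 <= c]. *)
have [c0|c0] := leP 0 c; last first.
  have -> : cdf (P := P0) (quotient_sqr U V) c = 0%E.
    rewrite (cdf_quotient_sqr alpha01 L0 UV) -[RHS](measure0 P0).
    apply: ae_probability_eq => //.
      by apply: measurable_le_sqr; exact: measurable_positive_part.
    apply: filterS (stable_pair_gt0 alpha01 L0 UV) => w v0 /=; split => //.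
    rewrite leNgt => /negP; apply; apply: (@lt_le_trans _ _ 0); last exact: positive_part_ge0.
    by rewrite nmulr_rlt0// exprn_gt0// /positive_part lt_max v0.
  rewrite (_ : (fun n => _) = cst 0%E); first exact: cvg_cst.
  apply/funext => n; rewrite -[LHS]/(P (sample_dispersion X (N (t n)) @^-1` `]-oo, c])).
  rewrite (_ : _ @^-1` _ = set0) ?measure0//; rewrite -subset0 => w /=; rewrite in_itv/=.
  rewrite leNgt => /negP; apply; apply: (lt_le_trans c0); rewrite /sample_dispersion.
  case: ifP => // _; rewrite divr_ge0 ?sqr_ge0//.
  by apply: sumr_ge0 => i _; exact: sqr_ge0.
have [a [a0 Ha]] := cvg_random_sum_laplace alpha01 Xiid NX Xpareto NLcvg.
rewrite (cdf_quotient_sqr alpha01 L0 UV).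
have cvgL r s : 0 <= r -> 0 <= s ->
    \int[P]_w expR (- (r * random_sum X N 2 (a (t n)) (t n) w + s * random_sum X N 1 (a (t n)) (t n) w))
      @[n --> \oo] -->
    \int[P0]_w expR (- (r * positive_part U w + s * positive_part V w)).
  by move=> r0 s0; rewrite (stable_pair_laplace alpha01 L0 UV r0 s0); exact: Ha.
have mS p n := measurable_random_sum X N p (a (t n)) (t n).
have S0 p n w : 0 <= random_sum X N p (a (t n)) (t n) w.
  by apply: random_sum_ge0; exact: ltW.
have K := cvg_ratio_boundary (mS 2%N) (mS 1%N) (measurable_positive_part U)
  (measurable_positive_part V) (S0 2%N) (S0 1%N) (positive_part_ge0 U)
  (positive_part_ge0 V) cvgL c0 (atom_quotient_sqr alpha01 L0 UV cZ).
rewrite -(cdf_quotient_sqr alpha01 L0 UV) in K *.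
have E n : cdf (P := P) (sample_dispersion X (N (t n))) c =
   (fine (P [set w | random_sum X N 2 (a (t n)) (t n) w <=
     c * random_sum X N 1 (a (t n)) (t n) w ^+ 2]))%:E.
  rewrite (cdf_sample_dispersion _ (a0 (t n)) c0) fineK// fin_num_measure//.
  exact: measurable_le_sqr.
rewrite -[X in _ --> X]fineK; last by rewrite fin_num_measure//; exact: measurable_le_sqr.
under eq_fun do rewrite E.
by apply: cvg_EFin; [exact: nearW|exact: K].
Unshelve. all: by end_near.
Qed.

End sample_dispersion_limit.

(** * Void probabilities of a thinned Poisson process *)

Section bounded_density_primitive.
Context {R : realType}.
Notation mu := (@lebesgue_measure R).
Variables (g : R -> R) (D : R).
Hypothesis mg : measurable_fun [set: R] g.
Hypothesis g01 : forall y, 0 <= g y <= 1.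
Hypothesis cg : forall y, 0 < y -> {for y, continuous g}.
Hypothesis gD : (\int[mu]_(y in `]0%R, +oo[) (g y)%:E)%E = D%:E.

Let I (t : R) : R := \int[mu]_(y in `[0, t]) g y.

Let g_integrable (a b : itv_bound R) (A : set R) : A = [set` Interval a b] ->
  (mu A < +oo)%E -> mu.-integrable A (EFin \o g).
Proof.
move=> -> fin; apply: measurable_bounded_integrable => //.
  exact: measurable_funTS.
exists 1; split => // x x1 y _ /=; have /andP[g0 g1] := g01 y.
by rewrite ger0_norm// (le_trans g1)// ltW.
Qed.

Let g_integrable_itv (x y : R) : mu.-integrable `[x, y] (EFin \o g).
Proof.
apply: (g_integrable (erefl _)).
by rewrite /= lebesgue_measure_itv/=; case: ifP => // _; rewrite -EFinD ltry.
Qed.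

Let I_diff x y : 0 <= x -> x <= y -> 0 <= I y - I x <= y - x.
Proof.
move=> x0 xy; rewrite /I Rintegral_itvB//.
have m2 : mu `]x, y] = (y - x)%:E.
  rewrite lebesgue_measure_itv/= lte_fin; move: xy; rewrite le_eqVlt.
  by case/orP => [/eqP ->|->//]; rewrite ltxx subrr.
apply/andP; split; first by apply: Rintegral_ge0 => z _; have /andP[] := g01 z.
have -> : y - x = \int[mu]_(z in `]x, y]) 1.
  by rewrite Rintegral_cst//= m2 mul1r.
apply: le_Rintegral => //.
- by apply: (g_integrable (erefl _)); rewrite /= m2 ltry.
- apply: measurable_bounded_integrable => //; first by rewrite /= m2 ltry.
  by exists 1; split => // z z1 w _ /=; rewrite normr1 ltW.
- by move=> z _; have /andP[] := g01 z.
Qed.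

Let I0 : I 0 = 0.
Proof. by rewrite /I set_itv1 Rintegral_set1. Qed.

Let I_neg t : t < 0 -> I t = 0.
Proof. by move=> t0; rewrite /I set_itv_ge ?Rintegral_set0// bnd_simp -ltNge. Qed.

Let I_nd x y : x <= y -> I x <= I y.
Proof.
move=> xy; have [x0|x0] := leP 0 x; first by have /andP[] := I_diff x0 xy; rewrite subr_ge0.
rewrite I_neg//; apply: Rintegral_ge0 => z _; by have /andP[] := g01 z.
Qed.

Let I_derive (t : R) : 0 < t -> is_derive t 1 I (g t).
Proof.
move=> t0; have tt : t < t + 1 by rewrite ltrDl.
have [d1 d2] := continuous_FTC1_closed tt (g_integrable_itv 0 (t + 1)) t0 (cg t0).
by rewrite derive1E in d2; exact: (DeriveDef d1 d2).
Qed.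

Let cvg_I : I n%:R @[n --> \oo] --> D.
Proof.
have E : `]0%R, +oo[%classic = \bigcup_k `]0%R, (k%:R : R)]%classic :> set R.
  apply/seteqP; split => x /=; rewrite in_itv/= ?andbT.
    by move=> x0; exists (Num.truncn x).+1 => //=; rewrite in_itv/= x0 ltW// truncnS_gt.
  by move=> [k _ /=]; rewrite in_itv/= => /andP[].
have K : (\int[mu]_(x in `]0%R, n%:R]) (g x)%:E @[n --> \oo] --> D%:E)%E.
  rewrite -gD E; apply: ge0_nondecreasing_set_cvg_integral => //.
  - apply/nondecreasing_seqP => n; apply/subsetPset => x /=; rewrite !in_itv/=.
    by move=> /andP[-> /le_trans]; apply; rewrite ler_nat.
  - by move=> n; apply/measurable_EFinP/measurable_funTS.
  - by move=> n x _; rewrite lee_fin; have /andP[] := g01 x.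
rewrite (_ : (fun n => _) = fine \o (fun n => \int[mu]_(x in `]0%R, n%:R]) (g x)%:E)%E).
  exact: fine_cvg K.
apply/funext => n; rewrite /I -Rintegral_itv_obnd_cbnd//.
apply: (g_integrable (erefl _)).
by rewrite /= lebesgue_measure_itv/=; case: ifP => // _; rewrite -EFinD ltry.
Qed.

(** The derivative is claimed at positive points only: [g] will be a thinning, and its continuity is
    available only there. *)
Lemma bounded_density_primitive : exists I : R -> R,
  [/\ I 0 = 0, forall x y : R, 0 <= x -> x <= y -> 0 <= I y - I x <= y - x,
      forall x y, x <= y -> I x <= I y,
      forall t : R, 0 < t -> is_derive t 1 I (g t) &
      I n%:R @[n --> \oo] --> D].
Proof. by exists I; split => //; exact: cvg_I. Qed.

End bounded_density_primitive.

Section void_probability.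
Context {R : realType}.
Notation mu := (@lebesgue_measure R).
Variables (g I : R -> R) (D : R).
Hypothesis mg : measurable_fun [set: R] g.
Hypothesis g01 : forall y, 0 <= g y <= 1.
Hypothesis cg : forall y, 0 < y -> {for y, continuous g}.
Hypothesis I0 : I 0 = 0.
Hypothesis I_diff : forall x y, 0 <= x -> x <= y -> 0 <= I y - I x <= y - x.
Hypothesis I_nd : forall x y, x <= y -> I x <= I y.
Hypothesis I_derive : forall t : R, 0 < t -> is_derive t 1 I (g t).
Hypothesis cvg_I : I n%:R @[n --> \oo] --> D.

Let I_leD t : I t <= D.
Proof.
have [n tn] : exists n : nat, t <= n%:R.
  by exists (Num.truncn t).+1; rewrite ltW// truncnS_gt.
apply: (le_trans (I_nd tn)); rewrite -(cvg_lim _ cvg_I)//.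
apply: nondecreasing_cvgn_le; first by move=> i j ij; apply: I_nd; rewrite ler_nat.
by apply/cvg_ex; eexists; exact: cvg_I.
Qed.

(* The probability that a unit Poisson process thinned by [g] has no point
   beyond [t]. *)
Definition void_prob t := expR (I t - D).

Lemma void_prob_gt0 t : 0 < void_prob t. Proof. exact: expR_gt0. Qed.

Lemma void_prob_le1 t : void_prob t <= 1.
Proof. by rewrite expR_le1 subr_le0 I_leD. Qed.

Lemma void_prob0 : void_prob 0 = expR (- D).
Proof. by rewrite /void_prob I0 sub0r. Qed.

Lemma measurable_void_prob : measurable_fun [set: R] void_prob.
Proof.
apply: measurableT_comp => //; apply: measurable_funB => //.
by apply: nondecreasing_measurable => // x y _ _; exact: I_nd.
Qed.

Lemma cvg_void_prob1 (t : nat -> R) : t n @[n --> \oo] --> +oo ->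
  void_prob (t n) @[n --> \oo] --> (1 : R).
Proof.
move=> too.
have H : I (t n) - D @[n --> \oo] --> (0 : R).
  rewrite -[X in _ --> X](subrr D); apply: cvgB; last exact: cvg_cst.
  apply/cvgrPdist_le => e e0.
  have De : D - e < D by rewrite gtrBl.
  have [n _ /(_ n (leqnn n)) /= In] := cvgr_ge _ cvg_I _ De.
  near=> m.
  have tm : n%:R <= t m by near: m; move/cvgryPge : too; exact.
  rewrite ger0_norm ?subr_ge0// lerBlDr -lerBlDl (le_trans In)//.
  exact: I_nd.
by have := cvg_comp _ _ H (@continuous_expR R 0); rewrite expR0.
Unshelve. all: by end_near.
Qed.

(** In Poisson terms: the first point after [t] lies at [t + u] with [u] exponential, it stays
    unmarked with probability [1 - g (t + u)], and no later point is marked. Analytically, [F] is a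
    primitive of the integrand. *)
Lemma void_prob_renewal t : 0 <= t ->
  (\int[mu]_(u in `]0%R, +oo[) (expR (- u) * ((1 - g (t + u)) * void_prob (t + u)))%:E)%E =
  (void_prob t)%:E.
Proof.
move=> t0.
pose f u := expR (- u) * ((1 - g (t + u)) * void_prob (t + u)).
pose F u := - (expR (- u) * void_prob (t + u)).
have f0 u : 0 <= f u.
  rewrite !mulr_ge0 ?expR_ge0//; first by rewrite subr_ge0; have /andP[] := g01 (t + u).
have dF (u : R) : 0 < u -> is_derive u 1 F (f u).
  move=> u0; have tu : 0 < t + u by rewrite ltr_wpDl.
  have dI := I_derive tu.
  rewrite /F /void_prob; apply: trigger_derive.
  rewrite /f /void_prob /GRing.scale/=; ring.
have cI y : 0 <= y -> forall e : R, 0 < e -> 0 <= I (y + e) - I y <= e.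
  move=> y0 e e0; have := I_diff y0 (_ : y <= y + e).
  by rewrite (addrC y e) addrK; apply; rewrite lerDr ltW.
have mf : measurable_fun [set: R] f.
  apply: measurable_funM; first by apply: measurableT_comp => //; exact: measurableT_comp.
  apply: measurable_funM.
    by apply: measurable_funB => //; apply: (measurableT_comp mg); exact: measurable_funD.
  by apply: (measurableT_comp measurable_void_prob); exact: measurable_funD.
have Fy : F u @[u --> +oo] --> (0 : R).
  have h1 : - expR (- u) @[u --> +oo] --> (0 : R).
    by rewrite -[X in _ --> X]oppr0; apply: cvgN; exact: cvgr_expR.
  apply: (squeeze_cvgr _ h1 (cvg_cst 0)); apply: nearW => u; apply/andP; split.
    by rewrite lerN2 ler_piMr ?expR_ge0// void_prob_le1.
  by rewrite oppr_le0 mulr_ge0// expR_ge0.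
have cF (u : R) : 0 < u -> {for u, continuous F}.
  by move=> u0; exact: is_derive_continuous (dF u u0).
have cIu (u : R) : 0 < u -> {for u, continuous I}.
  by move=> u0; exact: is_derive_continuous (I_derive u0).
have cadd (u : R) : {for u, continuous (fun u => t + u)}.
  by apply: cvgD; [exact: cvg_cst|exact: cvg_id].
have cf (u : R) : 0 < u -> {for u, continuous f}.
  move=> u0; have tu : 0 < t + u by rewrite ltr_wpDl.
  apply: cvgM.
    by apply: continuous_comp; [exact: opp_continuous|exact: continuous_expR].
  apply: cvgM.
    by apply: cvgB; [exact: cvg_cst|apply: (continuous_comp (@cadd u)); exact: cg].
  have K : I (t + x) - D @[x --> u] --> I (t + u) - D.
    by apply: cvgB; [apply: (continuous_comp (@cadd u)); exact: cIu|exact: cvg_cst].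
  exact: (cvg_comp _ _ K (@continuous_expR R (I (t + u) - D))).
have step (n : nat) : (\int[mu]_(x in `[(n.+1%:R^-1)%R, +oo[) (f x)%:E = (- F n.+1%:R^-1)%:E)%E.
  have a0 : 0 < n.+1%:R^-1 :> R by rewrite invr_gt0.
  transitivity ((0 : R)%:E - (F n.+1%:R^-1)%:E)%E; last by rewrite sub0e.
  apply: ge0_continuous_FTC2y.
  - by move=> x _; exact: f0.
  - apply: continuous_in_subspaceT => x; rewrite inE/= in_itv/= andbT => ax.
    by apply: cf; exact: lt_le_trans ax.
  - exact: Fy.
  - by move=> x ax; have [] := dF x (lt_trans a0 ax).
  - by apply: cvg_at_right_filter; exact: cF.
  - move=> x; rewrite in_itv/= andbT => ax.
    by rewrite derive1E; have [_ ->] := dF x (lt_trans a0 ax).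
have L := @cvg_integral_0y _ (EFin \o f).
have {}L : (- F n.+1%:R^-1)%:E @[n --> \oo] --> (\int[mu]_(u in `]0%R, +oo[) (f u)%:E)%E.
  rewrite (_ : (fun n => _) = (fun n : nat => \int[mu]_(x in `[(n.+1%:R^-1)%R, +oo[) (f x)%:E)%E).
    apply: L; first exact/measurable_EFinP/measurable_funTS.
    by move=> x _; rewrite lee_fin.
  by apply/funext => n; rewrite step.
have L2 : (- F n.+1%:R^-1)%:E @[n --> \oo] --> (void_prob t)%:E.
  apply: cvg_EFin; first exact: nearW.
  have h0 : n.+1%:R^-1 @[n --> \oo] --> (0 : R) by exact: cvg_harmonic.
  have hI : I (t + n.+1%:R^-1) - I t @[n --> \oo] --> (0 : R).
    apply: (squeeze_cvgr _ (cvg_cst 0) h0); apply: nearW => n.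
    by apply: cI => //; rewrite invr_gt0.
  have hI2 : I (t + n.+1%:R^-1) - D - n.+1%:R^-1 @[n --> \oo] --> I t - D.
    have K : (I (t + n.+1%:R^-1) - I t) + (I t - D) - n.+1%:R^-1 @[n --> \oo] --> 0 + (I t - D) - 0.
      by apply: cvgB => //; apply: cvgD => //; exact: cvg_cst.
    rewrite add0r subr0 in K; apply: cvg_trans K; apply: near_eq_cvg; apply: nearW => n.
    by rewrite addrA subrK.
  have := cvg_comp _ _ hI2 (@continuous_expR R (I t - D)).
  apply: cvg_trans; apply: near_eq_cvg; apply: nearW => n.
  by rewrite /= /F /void_prob opprK -expRD addrC.
exact: (cvg_unique _ L L2).
Qed.

End void_probability.

(** * An exponential variable with an independent uniform one *)

Section exponential_variable.
Context {R : realType}.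
Notation mu := (@lebesgue_measure R).
Notation U := (measurableTypeR R).

Definition std_exp : probability U R.
Proof. unshelve refine (exponential_prob (1 : R) : probability U R); exact: ltr01. Defined.

Definition expo (w : R) : R := - ln (dexp w).

Lemma expo_ge0 w : 0 <= expo w.
Proof. by rewrite oppr_ge0 ln_le0//; have /andP[] := dexp01 w. Qed.

Lemma measurable_expo : measurable_fun [set: U] expo.
Proof.
apply: measurableT_comp => //; apply: measurableT_comp; first exact: measurable_ln.
exact: measurable_dexp.
Qed.

Let nlog (x : U) : U := - ln x.

Let mnlog : measurable_fun setT nlog.
Proof. by apply: measurableT_comp => //; exact: measurable_ln. Qed.

Let nlog_ray a : unif (nlog @^-1` `]-oo, a]) = std_exp `]-oo, a]%classic.
Proof.
rewrite unifE; last by rewrite -[X in measurable X]setTI; exact: mnlog.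
have [a0|a0] := ltP a 0.
  rewrite (_ : _ `&` _ = set0); last first.
    rewrite -subset0 => x [/=]; rewrite !in_itv/= => xa /andP[x0 x1].
    have : 0 <= nlog x by rewrite oppr_ge0 ln_le0.
    by rewrite leNgt => /negP; apply; exact: le_lt_trans a0.
  rewrite measure0; apply/esym; apply: integral0_eq => x /=; rewrite in_itv/= => xa.
  by rewrite lt0_exponential_pdf// (le_lt_trans xa).
(* The isolated point 0 appears because [ln 0] is 0; it has measure 0. *)
have -> : nlog @^-1` `]-oo, a] `&` `[0, 1] = [set 0] `|` `[expR (- a), 1].
  apply/seteqP; split => x /=; rewrite !in_itv/=.
    move=> [xa /andP[x0 x1]]; move: x0; rewrite le_eqVlt => /orP[/eqP <-|x0]; first by left.
    by right; rewrite x1 andbT -[x]lnK ?posrE// ler_expR lerNl.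
  move=> [->|/andP[ax x1]].
    by rewrite /nlog ln0// oppr0 a0 lexx ler01.
  have x0 : 0 < x by apply: lt_le_trans ax; exact: expR_gt0.
  by rewrite x1 (ltW x0) /nlog lerNl -[leLHS]expRK ler_ln// posrE expR_gt0.
rewrite measureU//; last first.
  rewrite -subset0 => x [/= ->]; rewrite in_itv/= => /andP[+ _].
  by rewrite leNgt expR_gt0.
rewrite /= lebesgue_measure_set1 add0e lebesgue_measure_itv/= lte_fin.
have -> : std_exp `]-oo, a]%classic = exponential_prob 1 `[0, a].
  rewrite /std_exp /= /exponential_prob integral_mkcond [RHS]integral_mkcond.
  apply: eq_integral => x _; rewrite !patchE !mem_setE !in_itv/=.
  by case: (ltP x 0) => x0 //=; rewrite lt0_exponential_pdf//; case: ifP.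
move: a0; rewrite le_eqVlt => /orP[/eqP<-|a0].
  rewrite oppr0 expR0 ltxx /exponential_prob set_itv1 integral_set1//.
by rewrite exponential_prob_itv0c// mulN1r -[X in (_ < X)%R]expR0 ltr_expR oppr_lt0 a0.
Qed.

Lemma nlog_law A : measurable A -> unif (nlog @^-1` A) = std_exp A.
Proof.
move=> mA; have := @probability_preimage_rays _ _ _ unif setT nlog 1 std_exp measurableT mnlog ler01.
rewrite -[in LHS](setTI (nlog @^-1` A)) => ->//; first by rewrite mul1e.
by move=> a; rewrite setTI mul1e nlog_ray.
Qed.

Lemma integral_nlog (phi : R -> R) : measurable_fun setT phi -> (forall u, 0 <= phi u) ->
  (\int[unif]_x (phi (- ln x))%:E = \int[mu]_(u in `]0%R, +oo[) (expR (- u) * phi u)%:E)%E.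
Proof.
move=> mphi phi0.
have pdf0 (u : R) : 0 <= exponential_pdf 1 u by exact: exponential_pdf_ge0.
have mpdf : measurable_fun [set: U] (exponential_pdf (1 : R)) by exact: measurable_exponential_pdf.
have := @integral_mul_comp R _ U unif _ U mu (exponential_pdf 1) id nlog 1 phi mpdf pdf0
  (@measurable_id _ _ _) mnlog mphi phi0 lee01.
rewrite mul1e => <-; last first.
  move=> B mB; rewrite mul1e nlog_law// /std_exp /= /exponential_prob [RHS]integral_mkcond.
  apply: eq_integral => x _; rewrite patchE indicE.
  by case: (x \in B); rewrite ?mulr1 ?mulr0.
rewrite [RHS]integral_itv_obnd_cbnd; last first.
  apply/measurable_EFinP/measurable_funTS/measurable_funM => //.
  by apply: measurableT_comp => //; exact: measurableT_comp.
rewrite [RHS]integral_mkcond; apply: eq_integral => x _.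
rewrite /exponential_pdf !patchE; case: ifPn => x0; last by rewrite mul0r.
by rewrite mul1r mulN1r.
Qed.

(* The recursion [w |-> (expo w, dexp2 w)] splits one uniform variable into an
   exponential one and an independent uniform one. *)
Lemma unif_expo_split (f : R -> R -> R) (phi : R -> R) :
  measurable_fun [set: U * U] (fun z => f z.1 z.2) -> (forall u y, 0 <= f u y) ->
  measurable_fun setT phi -> (forall u, 0 <= phi u) ->
  (forall u : R, (0 <= u)%R -> \int[unif]_y (f u y)%:E = (phi u)%:E)%E ->
  (\int[unif]_w (f (expo w) (dexp2 w))%:E =
   \int[mu]_(u in `]0%R, +oo[) (expR (- u) * phi u)%:E)%E.
Proof.
move=> mf f0 mphi phi0 H.
pose f' (z : U * U) := (f (Num.max (- ln z.1) 0) z.2)%:E.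
have mmax : measurable_fun [set: R] (fun u => Num.max u 0) by exact: measurable_maxr.
have mf' : measurable_fun setT f'.
  apply/measurable_EFinP; apply: (measurableT_comp (f := fun z : U * U => f z.1 z.2)
    (g := fun z : U * U => (Num.max (- ln z.1) 0, z.2)) mf).
  apply/measurable_fun_pairP; split => //=.
    by apply: (measurableT_comp mmax); exact: (measurableT_comp mnlog).
  exact: measurable_snd.
transitivity (\int[unif]_w f' (dexp w, dexp2 w))%E.
  by apply: eq_integral => w _; rewrite /f'/= max_l// expo_ge0.
rewrite unif_split//; last by move=> z; rewrite lee_fin.
transitivity (\int[unif]_x (phi (Num.max (- ln x) 0))%:E)%E.
  by apply: eq_integral => x _; rewrite -H// le_max lexx orbT.
rewrite (@integral_nlog (fun u => phi (Num.max u 0)))//; last exact: measurableT_comp.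
by apply: eq_integral => u; rewrite inE/= in_itv/= andbT => u0; rewrite max_l// ltW.
Qed.

End exponential_variable.

(** * Arrival times of a unit Poisson process *)

Section arrivals.
Context {R : realType}.
Notation U := (measurableTypeR R).

(** The recursion peels off the first waiting time and feeds the independent uniform [dexp2 w] to
    the rest, so conditioning on the first arrival is exactly [unif_expo_split]. *)
Fixpoint arrival (n : nat) (w : R) : R :=
  if n is m.+1 then expo w + arrival m (dexp2 w) else 0.

Lemma arrival_ge0 n w : 0 <= arrival n w.
Proof. by elim: n w => [|n IH] w //=; rewrite addr_ge0 ?expo_ge0. Qed.

Lemma arrivalS n w : arrival n w <= arrival n.+1 w.
Proof.
elim: n w => [|n IH] w; first by rewrite /= addr0 expo_ge0.
by rewrite -[leRHS]/(expo w + arrival n.+1 (dexp2 w)) lerD2l.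
Qed.

Lemma measurable_arrival n : measurable_fun [set: U] (arrival n).
Proof.
elim: n => [|n IH] /=; first exact: measurable_cst.
apply: measurable_funD; first exact: measurable_expo.
exact: (measurableT_comp IH measurable_dexp2).
Qed.

Section renewal.
Variables (k G : R -> R).
Hypothesis mk : measurable_fun [set: R] k.
Hypothesis k01 : forall y, 0 <= k y <= 1.
Hypothesis mG : measurable_fun [set: R] G.
Hypothesis G01 : forall y, 0 <= G y <= 1.
Hypothesis renewal : forall t, 0 <= t ->
  (\int[(@lebesgue_measure R)]_(u in `]0%R, +oo[) (expR (- u) * (k (t + u) * G (t + u)))%:E = (G t)%:E)%E.

(** When [k] is the probability that a point escapes marking and [G] the void probability: the
    conditional probability, given the first [n] points after [t], that no point after [t] is
    marked. *)
Fixpoint martingale n t w : R :=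
  if n is m.+1 then k (t + expo w) * martingale m (t + expo w) (dexp2 w) else G t.

Lemma martingaleE n t w :
  martingale n t w = \prod_(i < n) k (t + arrival i.+1 w) * G (t + arrival n w).
Proof.
elim: n t w => [|n IH] t w /=; first by rewrite big_ord0 mul1r addr0.
rewrite IH big_ord_recl /= addr0 -mulrA addrA; congr (_ * (_ * _)).
by apply: eq_bigr => i _; rewrite /= add0n -addrA.
Qed.

Lemma martingale01 n t w : 0 <= martingale n t w <= 1.
Proof.
elim: n t w => [|n IH] t w //=.
have /andP[k0 k1] := k01 (t + expo w); have /andP[m0 m1] := IH (t + expo w) (dexp2 w).
by rewrite mulr_ge0//= mulr_ile1.
Qed.

Lemma measurable_martingale n : measurable_fun [set: R * U] (fun z => martingale n z.1 z.2).
Proof.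
elim: n => [|n IH] /=; first exact: (measurableT_comp mG).
have mte : measurable_fun [set: R * U] (fun z => z.1 + expo z.2).
  by apply: measurable_funD => //; exact: (measurableT_comp measurable_expo).
apply: measurable_funM; first exact: (measurableT_comp mk).
apply: (measurableT_comp (f := fun z : R * U => martingale n z.1 z.2)
  (g := fun z : R * U => (z.1 + expo z.2, dexp2 z.2)) IH).
apply/measurable_fun_pairP; split => //=.
by apply: (measurableT_comp measurable_dexp2).
Qed.

(** The renewal equation is the one-step martingale property. The start [t] stays general because
    the induction restarts from the first arrival. *)
Lemma integral_martingale n t : 0 <= t -> (\int[unif]_w (martingale n t w)%:E = (G t)%:E)%E.
Proof.
elim: n t => [|n IH] t t0.
  by rewrite -[RHS]mule1 -(@probability_setT _ _ _ (@unif R)) -integral_cst.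
rewrite /= (@unif_expo_split R (fun u y => k (t + u) * martingale n (t + u) y) (fun u => k (t + u) * G (t + u))).
- exact: renewal.
- apply: measurable_funM.
    by apply: (measurableT_comp mk); exact: measurable_funD.
  apply: (measurableT_comp (f := fun z : R * U => martingale n z.1 z.2)
    (g := fun z : U * U => (t + z.1, z.2)) (@measurable_martingale n)).
  by apply/measurable_fun_pairP; split => //=; [exact: measurable_funD|exact: measurable_snd].
- move=> u y; have /andP[k0 _] := k01 (t + u); have /andP[m0 _] := martingale01 n (t + u) y.
  exact: mulr_ge0.
- by apply: measurable_funM; [apply: (measurableT_comp mk)|apply: (measurableT_comp mG)]; exact: measurable_funD.
- move=> u; have /andP[k0 _] := k01 (t + u); have /andP[m0 _] := G01 (t + u).
  exact: mulr_ge0.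
move=> u u0.
under eq_integral do rewrite EFinM.
rewrite ge0_integralZl//.
- by rewrite IH ?addr_ge0// -EFinM.
- apply/measurable_EFinP.
  apply: (measurableT_comp (f := fun z : R * U => martingale n z.1 z.2)
    (g := fun y : U => (t + u, y)) (@measurable_martingale n)).
  by apply/measurable_fun_pairP; split; [exact: measurable_cst|exact: measurable_id].
- by move=> y _; rewrite lee_fin; have /andP[] := martingale01 n (t + u) y.
- by rewrite lee_fin; have /andP[] := k01 (t + u).
Qed.

End renewal.
End arrivals.

Lemma nondecreasing_cvgny (R : realType) (u : nat -> R) : nondecreasing_seq u ->
  ~ (exists M : nat, forall n, u n <= M%:R) -> u n @[n --> \oo] --> +oo.
Proof.
move=> nd ub; apply/cvgryPge => A; have [n An] : exists n, (Num.truncn A).+1%:R < u n.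
  apply: contrapT => h; apply: ub; exists (Num.truncn A).+1 => n.
  by rewrite leNgt; apply/negP => h'; apply: h; exists n.
exists n => // m /= /nd; apply: le_trans; apply: le_trans (ltW An).
exact: ltW (truncnS_gt A).
Qed.

Section arrival_cvgy.
Context {R : realType}.
Notation U := (measurableTypeR R).

Let c n : R := \int[unif]_w expR (- arrival n w).

Let mc n : measurable_fun [set: U] (fun w => expR (- arrival n w)).
Proof.
by apply: measurableT_comp => //; apply: measurableT_comp => //; exact: measurable_arrival.
Qed.

Let c01 n w : `|expR (- @arrival R n w)| <= 1.
Proof. by rewrite norm_expRN_le1// arrival_ge0. Qed.

Let cE n : (\int[unif]_w (expR (- arrival n w))%:E = (c n)%:E)%E.
Proof.
rewrite /c /Rintegral fineK//; apply: integrable_fin_num => //.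
exact: (@bounded_integrable _ _ _ (@unif R) _ 1).
Qed.

Let c_ge0 n : 0 <= c n.
Proof. by apply: Rintegral_ge0 => w _; exact: expR_ge0. Qed.

(** A unit exponential waiting time contributes the factor [E exp (- u) = 1 / 2], seen as half the
    mass of the density [2 exp (- 2 u)]. *)
Let c_half n : c n.+1 <= 2^-1 * c n.
Proof.
rewrite -lee_fin -cE /=.
under eq_integral do rewrite opprD expRD.
rewrite (@unif_expo_split R (fun u y => expR (- u) * expR (- arrival n y)) (fun u => expR (- u) * c n)) //; last first.
- move=> u u0; under eq_integral do rewrite EFinM.
  rewrite ge0_integralZl//.
  - by rewrite cE -EFinM.
  - exact/measurable_EFinP.
- by move=> u; rewrite mulr_ge0 ?expR_ge0 ?c_ge0.
- by apply: measurable_funM => //; apply: measurableT_comp => //; exact: measurableT_comp.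
- apply: measurable_funM.
    by apply: measurableT_comp => //; exact: measurableT_comp.
  by apply: (measurableT_comp (@mc n)).
have E (u : R) : expR (- u) * (expR (- u) * c n) = 2^-1 * c n * qlin_dens 0 2 u.
  rewrite /qlin_dens /qlin mulr0 !mul0r !add0r (_ : - (2 * u) = - u - u); last by ring.
  by rewrite expRD; field.
under eq_integral do rewrite E EFinM.
have h2 : 0 <= 2^-1 * c n by rewrite mulr_ge0.
rewrite ge0_integralZl//.
- by rewrite -[leRHS]mule1 lee_wpmul2l// integral_qlin_dens_le1.
- by apply/measurable_EFinP/measurable_funTS; exact: measurable_qlin_dens.
- move=> u /=; rewrite in_itv/= andbT => u0.
  by rewrite lee_fin qlin_dens_ge0// ltW.
Qed.

Let c_le n : c n <= 2^-1 ^+ n.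
Proof.
elim: n => [|n IH]; last first.
  by apply: (le_trans (c_half n)); rewrite exprS ler_wpM2l.
have -> : c 0 = \int[unif]_w (cst 1 w).
  by apply: eq_Rintegral => w _; rewrite /= oppr0 expR0.
by rewrite Rintegral_cst1.
Qed.

Lemma arrival_nd n m w : (n <= m)%N -> @arrival R n w <= arrival m w.
Proof.
by move=> /subnK <-; elim: (m - n)%N => [//|k IH]; exact: le_trans (arrivalS _ _).
Qed.

(** By Markov's inequality, arrivals that all stay below [M] have probability at most
    [exp (M) 2^(-n)] for every [n]. *)
Lemma ae_arrival_cvgy : {ae @unif R, forall w, arrival n w @[n --> \oo] --> +oo}.
Proof.
pose B (M : nat) := \bigcap_n [set w : U | arrival n w <= M%:R].
have mBn n M : measurable [set w : U | arrival n w <= M%:R].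
  rewrite (_ : mkset _ = arrival n @^-1` `]-oo, M%:R]); last first.
    by apply/seteqP; split => w /=; rewrite in_itv.
  by rewrite -[X in measurable X]setTI; exact: measurable_arrival.
have mB M : measurable (B M) by exact: bigcap_measurable.
have B0 M : unif (B M) = 0%E.
  apply/eqP; rewrite eq_le measure_ge0 andbT.
  rewrite -[unif _]fineK ?fin_num_measure// lee_fin.
  have le n : fine (unif (B M)) <= expR M%:R * 2^-1 ^+ n.
    rewrite -ler_pdivrMl ?expR_gt0// -expRN; apply: le_trans (c_le n).
    rewrite probability_indic// -RintegralZl//; last exact: indic_integrable.
    apply: le_Rintegral => //.
    - apply: (@bounded_integrable _ _ _ (@unif R) _ (expR (- M%:R))).
        by apply: measurable_funM => //; exact: measurable_indic.
      move=> w; rewrite ger0_norm ?mulr_ge0 ?expR_ge0// ler_piMr ?expR_ge0//.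
    - exact: (@bounded_integrable _ _ _ (@unif R) _ 1).
    - move=> w _; rewrite indicE; have [wB|wB] := boolP (w \in B M); last by rewrite mulr0 expR_ge0.
      by rewrite mulr1 ler_expR lerN2; move: wB; rewrite inE => /(_ n I).
  have h : expR M%:R * 2^-1 ^+ n @[n --> \oo] --> expR M%:R * (0 : R).
    by apply: cvgMl_tmp; apply: cvg_expr; rewrite ger0_norm// invf_lt1// ltr1n.
  rewrite mulr0 in h; rewrite -(cvg_lim _ h)//; apply: limr_ge; first by apply/cvg_ex; eexists; exact: h.
  by apply: nearW => n; exact: le.
have : (@unif R).-negligible (\bigcup_M B M).
  apply: negligible_bigcup => M; exists (B M); split; [exact: mB|exact: B0|exact: subset_refl].
apply: negligibleS => w /= nw; apply: contrapT => wB; apply: nw.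
apply: nondecreasing_cvgny; first by move=> n m; exact: arrival_nd.
by move=> [M h]; apply: wB; exists M => // n _; exact: h.
Qed.

End arrival_cvgy.

(** * LePage's series *)

Section stable_series.
Context {R : realType}.
Notation mu := (@lebesgue_measure R).
Notation U := (measurableTypeR R).
Variable alpha : R.
Hypothesis alpha01 : 0 < alpha < 1.

Definition jump_sum (p n : nat) (w : R) : R :=
  \sum_(i < n) jump alpha (arrival i.+1 w) ^+ p.

Let D r s := fine (stable_exponent alpha r s).

Let S := jump_sum.

Lemma measurable_jump_sum p n : measurable_fun [set: U] (S p n).
Proof.
apply: (@measurable_sum _ _ _ _ _ _ (fun i w => jump alpha (arrival (val i).+1 w) ^+ p)) => i.
apply: measurable_funX.
apply: (measurableT_comp (measurable_jump alpha)); exact: (@measurable_arrival R i.+1).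
Qed.

Lemma jump_sum_ge0 p n w : 0 <= S p n w.
Proof. by apply: sumr_ge0 => i _; rewrite exprn_ge0// jump_ge0. Qed.

Lemma jump_sumS p n w : S p n.+1 w = S p n w + jump alpha (arrival n.+1 w) ^+ p.
Proof. by rewrite /S /jump_sum big_ord_recr. Qed.

Lemma jump_sum_nd p w : nondecreasing_seq (S p ^~ w).
Proof.
by apply/nondecreasing_seqP => n; rewrite jump_sumS lerDl exprn_ge0// jump_ge0.
Qed.

(** A bound on the sums of jumps bounds the sums of squares too, so one event of convergence serves
    both series. *)
Lemma jump_sum2_le n w : S 2 n w <= S 1 n w ^+ 2.
Proof.
elim: n => [|n IH]; first by rewrite /S /jump_sum !big_ord0 expr0n.
rewrite !jump_sumS expr1 sqrrD (le_trans (lerD IH (lexx _)))//.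
by rewrite lerD2r lerDl mulrn_wge0// mulr_ge0 ?jump_sum_ge0 ?jump_ge0.
Qed.

Let E r s n w := expR (- (r * S 2 n w + s * S 1 n w)).

Let mE r s n : measurable_fun [set: U] (E r s n).
Proof.
apply: measurableT_comp => //; apply: measurableT_comp => //.
by apply: measurable_funD; apply: measurable_funM => //; exact: measurable_jump_sum.
Qed.

Let E01 r s n w : 0 <= r -> 0 <= s -> `|E r s n w| <= 1.
Proof.
move=> r0 s0; apply: norm_expRN_le1.
by rewrite addr_ge0// mulr_ge0// jump_sum_ge0.
Qed.

(** The martingale has mean [exp (- D r s)] for every [n], and its last factor, the void probability
    beyond the [n]-th arrival, tends to 1 because the arrivals diverge. *)
Lemma cvg_jump_sum_laplace r s : 0 <= r -> 0 <= s ->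
  \int[unif]_w E r s n w @[n --> \oo] --> expR (- D r s).
Proof.
move=> r0 s0.
have mg := measurable_thinning alpha r s.
have g01 y := thinning01 alpha y r0 s0.
have gD : (\int[mu]_(y in `]0%R, +oo[) (thinning alpha r s y)%:E)%E = (D r s)%:E.
  by rewrite integral_thinning// /D fineK// stable_exponent_fin_num.
have cg := @continuous_thinning R alpha r s.
have [I [I0 Id Ind Ider Icvg]] := bounded_density_primitive mg g01 cg gD.
pose G := void_prob I (D r s).
have G01 y : 0 <= G y <= 1 by rewrite (ltW (void_prob_gt0 _ _ _)) void_prob_le1.
have mG : measurable_fun [set: R] G by exact: measurable_void_prob.
pose k y := 1 - thinning alpha r s y.
have k01 y : 0 <= k y <= 1 by have := g01 y; rewrite /k; lra.
have mk : measurable_fun [set: R] k by exact: measurable_funB.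
have ren t : 0 <= t ->
    (\int[mu]_(u in `]0%R, +oo[) (expR (- u) * (k (t + u) * G (t + u)))%:E = (G t)%:E)%E.
  by move=> t0; apply: (void_prob_renewal mg g01 cg).
have M := integral_martingale mk k01 mG G01 ren _ (lexx 0).
have ME n w : martingale k G n 0 w = E r s n w * G (arrival n w).
  rewrite martingaleE add0r; congr (_ * _).
  rewrite /E /S /jump_sum !big_distrr/= -big_split/= -sumrN expR_sum.
  by apply: eq_bigr => i _; rewrite add0r /k /thinning subKr /qlin expr1.
have mGa n : measurable_fun [set: U] (fun w => G (arrival n w)).
  by apply: (measurableT_comp mG); exact: measurable_arrival.
have EG01 n w : `|E r s n w * G (arrival n w)| <= 1.
  have /andP[g0 g1] := G01 (arrival n w).
  rewrite normrM; apply: mulr_ile1; rewrite ?normr_ge0//; first exact: E01.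
  by rewrite (ger0_norm g0).
have EG01' n w : `|E r s n w - E r s n w * G (arrival n w)| <= `|1 - G (arrival n w)|.
  rewrite -[X in X - _]mulr1 -mulrBr normrM ler_piMl ?normr_ge0//; exact: E01.
have MR n : \int[unif]_w (E r s n w * G (arrival n w)) = expR (- D r s).
  apply: EFin_inj; rewrite -(void_prob0 (D r s) I0) -[RHS](M n) /Rintegral fineK.
    by apply: eq_integral => w _; rewrite ME.
  apply: integrable_fin_num => //; apply: (@bounded_integrable _ _ _ (@unif R) _ 1).
    exact: measurable_funM.
  exact: EG01.
have L : \int[unif]_w (E r s n w - E r s n w * G (arrival n w)) @[n --> \oo] --> \int[unif]_w (cst 0 w).
  apply: (@cvg_Rintegral_bounded _ _ _ (@unif R) _ _ 1) => //.
  - by move=> n; apply: measurable_funB => //; exact: measurable_funM.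
  - move=> n w; apply: (le_trans (EG01' n w)).
    by have /andP[g0 g1] := G01 (arrival n w); rewrite ger0_norm; lra.
  - have := @ae_arrival_cvgy R; apply: (@filterS _ _ (ae_filter_ringOfSetsType (@unif R))) => w aw.
    have G1 := cvg_void_prob1 Ind Icvg aw.
    have h : 1 - G (arrival n w) @[n --> \oo] --> (0 : R).
      by rewrite -[X in _ --> X](subrr 1); apply: cvgB; [exact: cvg_cst|exact: G1].
    apply/cvgrPdist_le => e e0; move/cvgrPdist_le : h => /(_ e e0).
    by apply: filterS => n; rewrite !sub0r !normrN; exact: le_trans (EG01' n w).
have iE n : (@unif R).-integrable setT (EFin \o E r s n).
  by apply: (@bounded_integrable _ _ _ (@unif R) _ 1) => // w; exact: E01.
have L' : \int[unif]_w (E r s n w - E r s n w * G (arrival n w)) + expR (- D r s) @[n --> \oo] -->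
    \int[unif]_w (cst 0 w) + expR (- D r s).
  by apply: cvgD; [exact: L|exact: cvg_cst].
rewrite Rintegral_cst// mul0r add0r in L'.
apply: cvg_trans L'; apply: near_eq_cvg; apply: nearW => n.
rewrite RintegralB//; last first.
  apply: (@bounded_integrable _ _ _ (@unif R) _ 1); first exact: measurable_funM.
  exact: EG01.
by rewrite MR subrK.
Qed.

(** The event of convergence. Multiplying by its indicator makes the limit exist at every point,
    which gives measurability and nonnegativity everywhere. *)
Let C : set U := \bigcup_M \bigcap_n [set w : U | S 1 n w <= M%:R].

Let mC : measurable C.
Proof.
apply: bigcup_measurable => M _; apply: bigcap_measurable => // n _.
rewrite (_ : mkset _ = S 1 n @^-1` `]-oo, M%:R]); last first.
  by apply/seteqP; split => w /=; rewrite in_itv.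
by rewrite -[X in measurable X]setTI; exact: measurable_jump_sum.
Qed.

Let ub p w : C w -> (p = 1 \/ p = 2)%N -> exists M, forall n, S p n w <= M.
Proof.
move=> [M _ CM] [->|->]; first by exists M%:R => n; exact: CM.
exists (M%:R ^+ 2) => n; apply: (le_trans (jump_sum2_le n w)).
by rewrite lerXn2r ?nnegrE ?jump_sum_ge0//; exact: CM.
Qed.

Definition jump_series p w : R := limn (fun n => \1_C w * S p n w).

Let cvg_series p w : (p = 1 \/ p = 2)%N ->
  \1_C w * S p n w @[n --> \oo] --> jump_series p w.
Proof.
move=> p12; rewrite /jump_series indicE; have [wC|wC] := boolP (w \in C); last first.
  apply/cvg_ex; exists 0; rewrite (_ : (fun n => _) = cst 0); first exact: cvg_cst.
  by apply/funext => n; rewrite mul0r.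
have [M HM] := ub (set_mem wC) p12.
apply: nondecreasing_is_cvgn.
  by move=> n m nm; rewrite !mul1r; exact: jump_sum_nd.
by exists M => _ [n _ <-]; rewrite mul1r.
Qed.

Lemma measurable_jump_series p : (p = 1 \/ p = 2)%N -> measurable_fun [set: U] (jump_series p).
Proof.
move=> p12; apply: (measurable_fun_cvg (h := fun n w => \1_C w * S p n w)).
  by move=> n; apply: measurable_funM; [exact: measurable_indic|exact: measurable_jump_sum].
by move=> w _; exact: cvg_series.
Qed.

Lemma jump_series_ge0 p w : (p = 1 \/ p = 2)%N -> 0 <= jump_series p w.
Proof.
move=> p12; rewrite -(cvg_lim _ (@cvg_series p w p12))//; apply: limr_ge.
  by apply/cvg_ex; eexists; exact: cvg_series.
by apply: nearW => n; rewrite mulr_ge0// jump_sum_ge0.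
Qed.

Let measurable_expR_series r s :
  measurable_fun [set: U] (fun w => expR (- (r * jump_series 2 w + s * jump_series 1 w))).
Proof.
apply: measurableT_comp => //; apply: measurableT_comp => //; apply: measurable_funD.
  by apply: measurable_funM => //; apply: measurable_jump_series; right.
by apply: measurable_funM => //; apply: measurable_jump_series; left.
Qed.

Let cvg_E r s w : C w -> E r s n w @[n --> \oo] -->
  expR (- (r * jump_series 2 w + s * jump_series 1 w)).
Proof.
move=> Cw.
have h p : (p = 1 \/ p = 2)%N -> S p n w @[n --> \oo] --> jump_series p w.
  move=> /(@cvg_series p w); rewrite indicE mem_set//=.
  by under eq_fun do rewrite mul1r.
have K : - (r * S 2 n w + s * S 1 n w) @[n --> \oo] --> - (r * jump_series 2 w + s * jump_series 1 w).
  by apply: cvgN; apply: cvgD; apply: cvgMl_tmp; apply: h; [right|left].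
exact: (cvg_comp _ _ K (@continuous_expR R _)).
Qed.

(** Off [C] the sums diverge and their exponential vanishes in the limit, so the limit transform at
    [(0, s)] is at most the probability of [C]. Letting [s] tend to 0 forces that probability to be
    1. *)
Let ae_C : {ae @unif R, forall w, C w}.
Proof.
apply: ae_of_probability1 => //.
have le s : 0 < s -> expR (- D 0 s) <= fine (unif C).
  move=> s_gt0; have s0 := ltW s_gt0; pose h w := \1_C w * expR (- (0 * jump_series 2 w + s * jump_series 1 w)).
  have h0 w : 0 <= h w by rewrite mulr_ge0// expR_ge0.
  have h1 w : h w <= \1_C w.
    rewrite ler_piMr// expR_le1 oppr_le0 mul0r add0r mulr_ge0// jump_series_ge0//.
    by left.
  have mh : measurable_fun [set: U] h.
    by apply: measurable_funM; [exact: measurable_indic|exact: measurable_expR_series].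
  have L : \int[unif]_w E 0 s n w @[n --> \oo] --> \int[unif]_w h w.
    apply: (@cvg_Rintegral_bounded _ _ _ (@unif R) _ _ 1) => //; first by move=> n w; exact: E01.
    apply: aeW => w; rewrite /h indicE; have [wC|wC] := boolP (w \in C).
      by rewrite mul1r; apply: cvg_E; exact: set_mem.
    rewrite mul0r /E.
    have Soo : S 1 n w @[n --> \oo] --> +oo.
      apply: nondecreasing_cvgny; first exact: jump_sum_nd.
      by move=> [M SM]; move/negP: wC; apply; rewrite inE; exists M => // n _; exact: SM.
    by under eq_fun do rewrite mul0r add0r mulrC; exact: cvg_expR_oppMy.
  rewrite -(cvg_unique _ L (cvg_jump_sum_laplace (lexx 0) s0)); last exact: norm_hausdorff.
  rewrite probability_indic//; apply: le_Rintegral => //; last exact: indic_integrable.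
  apply: (@bounded_integrable _ _ _ (@unif R) _ 1) => // w; rewrite ger0_norm//.
  by apply: (le_trans (h1 w)); rewrite indicE; case: (_ \in _).
have C1 : 1 <= fine (unif C).
  have L : expR (- (n.+1%:R^-1 * Gamma (1 - alpha))) @[n --> \oo] --> (1 : R).
    have K : - (n.+1%:R^-1 * Gamma (1 - alpha)) @[n --> \oo] --> - (0 * Gamma (1 - alpha)).
      by apply: cvgN; apply: cvgMr_tmp; exact: cvg_harmonic.
    by have := cvg_comp _ _ K (@continuous_expR R _); rewrite mul0r oppr0 expR0.
  rewrite -(cvg_lim _ L)//; apply: limr_le; first by apply/cvg_ex; eexists; exact: L.
  apply: nearW => n; have /andP[a0 a1] := alpha01.
  have n0 : 0 < n.+1%:R^-1 :> R by rewrite invr_gt0.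
  (* This [s] satisfies [s^alpha = 1 / (n + 1)], which makes the exponent explicit. *)
  have := le (n.+1%:R^-1 `^ alpha^-1) (powR_gt0 _ n0).
  rewrite /D stable_exponent_0s ?powR_gt0//.
  by rewrite -powRrM mulVf ?gt_eqF// powRr1// ltW.
apply/eqP; rewrite eq_le probability_le1//=.
by rewrite -[X in (_ <= X)%E]fineK ?fin_num_measure// lee_fin.
Qed.

Lemma jump_series_laplace r s : 0 <= r -> 0 <= s ->
  \int[unif]_w expR (- (r * jump_series 2 w + s * jump_series 1 w)) = expR (- D r s).
Proof.
move=> r0 s0; apply: (cvg_unique _ _ (cvg_jump_sum_laplace r0 s0)); first exact: norm_hausdorff.
apply: (@cvg_Rintegral_bounded _ _ _ (@unif R) _ _ 1) => //.
- by move=> n w; exact: E01.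
- by have := ae_C; apply: (@filterS _ _ (ae_filter_ringOfSetsType (@unif R))) => w; exact: cvg_E.
Qed.

End stable_series.

(** * Existence of the limiting pair, and the theorem *)

Lemma stable_pair_exists (R : realType) d (T : measurableType d) (Q : probability T R)
    (Lambda : {RV Q >-> R}) (alpha : R) :
  0 < alpha < 1 -> Q [set w | 0 < Lambda w] = 1%E ->
  exists (d0 : measure_display) (T0 : measurableType d0) (P0 : probability T0 R)
    (X Y : {RV P0 >-> R}), has_joint_laplace alpha Lambda X Y.
Proof.
move=> alpha01 L0; have /andP[a0 a1] := alpha01.
(* By homogeneity, scaling the jumps by [Lambda^(1 / alpha)] multiplies their exponent by [Lambda];
   independence of the series and [Lambda] is the product measure. *)
pose c (y : T) := positive_part Lambda y `^ alpha^-1.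
have c0 y : 0 <= c y by exact: powR_ge0.
have mc : measurable_fun setT c.
  exact: (measurableT_comp (measurable_powR _) (measurable_positive_part Lambda)).
pose f (z : measurableTypeR R * T) := c z.2 ^+ 2 * jump_series alpha 2 z.1.
pose g (z : measurableTypeR R * T) := c z.2 * jump_series alpha 1 z.1.
have m2 : measurable_fun [set: measurableTypeR R] (jump_series alpha 2).
  by apply: measurable_jump_series => //; right.
have m1 : measurable_fun [set: measurableTypeR R] (jump_series alpha 1).
  by apply: measurable_jump_series => //; left.
have mf : measurable_fun setT f.
  apply: measurable_funM; last exact: (measurableT_comp m2).
  by apply: measurable_funX; exact: (measurableT_comp mc).
have mg : measurable_fun setT g.
  by apply: measurable_funM; [exact: (measurableT_comp mc)|exact: (measurableT_comp m1)].
pose P0 : probability (measurableTypeR R * T)%type R := ((@unif R) \x Q)%E.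
exists _, (measurableTypeR R * T)%type, P0.
exists (mfun_Sub (mem_set mf)), (mfun_Sub (mem_set mg)) => r s r0 s0.
have D0 : 0 <= delta alpha r s.
  rewrite -lee_fin delta_stable_exponent//.
  by apply: stable_exponent_ge0 => //; exact: ltW.
rewrite (expectation_mixing L0 D0) unlock /=.
pose h (z : measurableTypeR R * T) := (expR (- r * f z - s * g z))%:E.
have mh : measurable_fun setT h.
  apply/measurable_EFinP; apply: measurableT_comp => //.
  by apply: measurable_funB; exact: measurable_funM.
have h0 z : (0 <= h z)%E by rewrite lee_fin expR_ge0.
rewrite -[LHS]/(\int[((@unif R) \x Q)%E]_z h z)%E.
rewrite (@fubini_tonelli2 _ _ _ _ _ (@unif R) Q h mh h0) /Rintegral fineK; last first.
  apply: integrable_fin_num => //; apply: (@bounded_integrable _ _ _ Q _ 1).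
    apply: measurableT_comp => //; apply: measurableT_comp => //.
    by apply: measurable_funM => //; exact: measurable_positive_part.
  by move=> w; rewrite norm_expRN_le1// mulr_ge0// positive_part_ge0.
apply: eq_integral => y _; rewrite /fubini_G.
have r1 : 0 <= r * c y ^+ 2 by rewrite mulr_ge0 ?(ltW r0)// sqr_ge0.
have s1 : 0 <= s * c y by rewrite mulr_ge0.
have J := jump_series_laplace alpha01 r1 s1.
have -> : delta alpha r s * positive_part Lambda y =
    fine (stable_exponent alpha (r * c y ^+ 2) (s * c y)).
  have DE := delta_stable_exponent alpha01 r0 s0.
  (* Scaling is stated for positive factors; where the factor is 0, both exponents vanish. *)
  have [cy0|cy] := eqVneq (c y) 0.
    rewrite cy0 expr0n/= !mulr0 stable_exponent00 /=.
    move/eqP: cy0; rewrite powR_eq0 => /andP[/eqP -> _]; exact: mulr0.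
  have cy0 : 0 < c y by rewrite lt_neqAle eq_sym cy c0.
  rewrite (stable_exponent_scaling alpha01 (ltW r0) s0 cy0) -DE -EFinM /=.
  by rewrite /c -powRrM mulVf ?gt_eqF// powRr1 ?positive_part_ge0// mulrC.
rewrite -J /Rintegral fineK; last first.
  apply: integrable_fin_num => //; apply: (@bounded_integrable _ _ _ (@unif R) _ 1).
    apply: measurableT_comp => //; apply: measurableT_comp => //.
    by apply: measurable_funD; exact: measurable_funM.
  move=> w; rewrite norm_expRN_le1// addr_ge0// mulr_ge0//.
    by apply: jump_series_ge0; right.
  by apply: jump_series_ge0; left.
apply: eq_integral => x _; rewrite /h /f /g /=; congr (expR _)%:E; ring.
Qed.

(** Existence of a pair is part of the claim, so that the assertions about every pair with the given
    transform, on any probability space, are not vacuous. *)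
Theorem theorem1 (R : realType)
    (d : measure_display) (Omega : measurableType d) (P : probability Omega R)
    (X : nat -> {RV P >-> R}) (N : R -> {RV P >-> nat})
    (d' : measure_display) (Omega' : measurableType d')
    (Q : probability Omega' R) (Lambda : {RV Q >-> R}) (alpha : R) :
  iid X ->
  (forall i, P [set w | 0 < X i w] = 1%E) ->
  counting_process N ->
  independent_sigma_algebras P
    (family_sigma_algebra [set: nat] X)
    (family_sigma_algebra [set t : R | 0 <= t] N) ->
  0 < alpha < 1 ->
  pareto_type alpha (distr_fun (X 0%N)) ->
  D_averages_in_time N Lambda ->
  (exists (d0 : measure_display) (Omega0 : measurableType d0)
      (P0 : probability Omega0 R) (U V : {RV P0 >-> R}),
    has_joint_laplace alpha Lambda U V) /\
  (forall (d0 : measure_display) (Omega0 : measurableType d0)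
      (P0 : probability Omega0 R) (U V : {RV P0 >-> R}),
    has_joint_laplace alpha Lambda U V ->
    [/\ cvg_in_distribution P P0 (fun t => sample_dispersion X (N t))
          (quotient_sqr U V),
        (forall r : R, 0 <= r ->
          ('E_P0[fun w => expR (- r * U w)] =
           'E_Q[fun w => expR (- (r `^ (alpha / 2) * Gamma (1 - alpha / 2))
                               * Lambda w)])%E)
      & (forall s : R, 0 <= s ->
          ('E_P0[fun w => expR (- s * V w)] =
           'E_Q[fun w => expR (- (s `^ alpha * Gamma (1 - alpha))
                               * Lambda w)])%E)]).
Proof.
move=> Xiid X0 _ NX alpha01 Xp NL; have [L0 _] := NL.
split; first exact: stable_pair_exists.
move=> d0 Omega0 P0 U V UV; split.
- exact: (cvg_sample_dispersion Xiid X0 NX alpha01 Xp NL UV).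
- by move=> r r0; rewrite (stable_laplace_l alpha01 L0 UV r0).
- by move=> s s0; rewrite (stable_laplace_r alpha01 L0 UV s0).
Qed.
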